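(* For every $d\ge 2$, the measure $\mu$ is tail trivial: every event in the tail $\sigma$-field $\mathcal{F}_\infty=\bigcap_{n\in\mathbb{N}}\sigma\{\eta(x):|x|\ge n\}$ has $\mu$-probability $0$ or $1$.
   Context: Abelian sandpile on $\mathbb{Z}^d$: $\Delta_{xx}=2d$, $\Delta_{xy}=-1$ if $|x-y|=1$, $0$ otherwise; $\Delta_V$ its restriction to $V\times V$. $\Omega=\{1,\dots,2d\}^{\mathbb{Z}^d}$ with product topology. For finite $V$, toppling $z\in V$ maps $\xi$ to $\xi-(\Delta_V)_{z\cdot}$ and is legal if $\xi(z)>2d$; $a_{x,V}\xi$ is the stable result of legal topplings applied to $\xi+\delta_x$. $\mathcal{R}_V$ is the set of recurrent states of the Markov chain on $\{1,\dots,2d\}^V$ applying $a_{X,V}$ with $X$ i.i.d. from a strictly positive distribution on $V$; $\mu_V$ is the uniform measure on $\mathcal{R}_V$ (regarded as a measure on $\Omega$ via cylinder events). For $d\ge 2$ it is known that $\mu_V$ converges weakly to a probability measure $\mu$ on $\Omega$ as $V\uparrow\mathbb{Z}^d$. *)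

(* Defs.v *)
From HB Require Import structures.
From Stdlib Require Import Relation_Operators.
From mathcomp Require Import all_boot all_order all_algebra finmap.
From mathcomp Require Import all_classical all_reals all_analysis.

Set Implicit Arguments.
Unset Strict Implicit.
Unset Printing Implicit Defensive.

Import Order.TTheory GRing.Theory Num.Theory.
Local Open Scope classical_set_scope.
Local Open Scope ring_scope.

Definition site (d : nat) := {ffun 'I_d -> int}.

Definition dist1 d (x y : site d) : nat := (\sum_(i < d) `|x i - y i|%N)%N.
Definition norm1 d (x : site d) : nat := (\sum_(i < d) `|x i|%N)%N.

Definition lap d (x y : site d) : int :=
  if x == y then (2 * d)%:Z else if dist1 x y == 1%N then -1 else 0.

(* For d >= 1, (d.-1).*2.+2 = 2d; the element h of this ordinal type stands
   for the height (val h).+1 in {1,...,2d}. *)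
Definition height (d : nat) := 'I_((d.-1).*2.+2).
HB.instance Definition _ d := Finite.on (height d).
HB.instance Definition _ d := isPointed.Build (height d) ord0.

Definition hval d (h : height d) : int := ((val h).+1)%:Z.

(* Integer-valued (possibly unstable) configurations; only the values on V
   matter for the dynamics in V, the others are left unchanged. *)
Definition topple d (V : {fset site d}) (z : site d) (xi : site d -> int)
  : site d -> int :=
  fun y => if y \in V then xi y - lap z y else xi y.

Definition legal_topple d (V : {fset site d}) (xi xi' : site d -> int) : Prop :=
  exists2 z, z \in V & ((2 * d)%:Z < xi z /\ xi' = topple V z xi).

Definition stable_on d (V : {fset site d}) (xi : site d -> int) : Prop :=
  forall y, y \in V -> xi y <= (2 * d)%:Z.

Definition stabilizes d (V : {fset site d}) (xi zeta : site d -> int) : Prop :=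
  clos_refl_trans _ (legal_topple V) xi zeta /\ stable_on V zeta.

Definition delta d (x : site d) : site d -> int := fun y => (y == x)%:Z.

Definition emb d (V : {fset site d}) (eta : {ffun V -> height d}) : site d -> int :=
  fun y => match (insub y : option V) with
           | Some y' => hval (eta y')
           | None => 0
           end.

(* Transition of the Markov chain: eta -> a_{x,V} eta, for some x in V
   (every x in V has positive probability under the strictly positive law). *)
Definition chain_step d (V : {fset site d}) (eta eta' : {ffun V -> height d}) : Prop :=
  exists2 x, x \in V & stabilizes V (fun y => emb eta y + delta x y) (emb eta').

Definition recurrent d (V : {fset site d}) (eta : {ffun V -> height d}) : Prop :=
  forall eta', clos_refl_trans _ (@chain_step d V) eta eta' ->
               clos_refl_trans _ (@chain_step d V) eta' eta.

Definition RV d (V : {fset site d}) : {set {ffun V -> height d}} :=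
  [set eta | `[< recurrent eta >]].

Definition Omega0 (d : nat) := site d -> height d.

Definition coord_events d : set (set (Omega0 d)) :=
  [set C | exists (x : site d) (h : height d), C = [set w | w x = h]].

Definition Omega (d : nat) := g_sigma_algebraType (@coord_events d).

Definition restr d (L : {fset site d}) (w : Omega0 d) : {ffun L -> height d} :=
  [ffun y : L => w (val y)].

Definition cyl d (L : {fset site d}) (A : {set {ffun L -> height d}}) : set (Omega d) :=
  [set w | restr L w \in A].

(* mu_V, the uniform measure on R_V, evaluated on an event C of Omega that is
   determined by the heights in V (as cylinder events with base inside V are). *)
Definition muV (R : realType) d (V : {fset site d}) (C : set (Omega d)) : R :=
  (#|[set eta in RV V |
       `[< forall w : Omega d, (forall y : V, w (val y) = eta y) -> C w >]]|%:R)
  / (#|RV V|%:R).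

(* weak convergence mu_V -> mu as V increases to Z^d
   (convergence on every cylinder event, along the net of finite volumes) *)
Definition sandpile_limit (R : realType) d (mu : probability (Omega d) R) : Prop :=
  forall (L : {fset site d}) (A : {set {ffun L -> height d}}) (e : R), 0 < e ->
    exists2 W : {fset site d}, fsubset L W &
      forall V : {fset site d}, fsubset W V ->
        `| fine (mu (cyl A)) - muV R V (cyl A) | < e.

Definition far_events d (n : nat) : set (set (Omega d)) :=
  [set C | exists (x : site d) (h : height d),
           (n <= norm1 x)%N /\ C = [set w | w x = h]].

Definition tail_event d (E : set (Omega d)) : Prop :=
  forall n : nat, <<s @far_events d n >> E.

Definition tail_trivial (R : realType) d (mu : probability (Omega d) R) : Prop :=
  forall E : set (Omega d), tail_event E -> (mu E = 0%E \/ mu E = 1%E).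

(* Main.v *)
(* By Dhar's criterion the recurrent heights are those for which a fire lit at
   the sink reaches every site, a site burning once fewer of its neighbours
   than its height are still unburnt.  The burnt sets obtained by holding back
   successively smaller sets of sites have the same joint law when the uniform
   heights are replaced by uniform pointers, a site burning once the site it
   points to is burnt; the pointers for which everything burns are the spanning
   trees rooted at the sink, and the sites left unburnt when W is held back are
   the descendants of W in the tree, its past.

   Heights: given the past of W, the heights in it and those outside of it are
   independent, so an event near L and an event far away interact only through
   the pasts of L and of W.  Pointers: given the set Z of the ancestors of the
   complement of W, the remaining pointers form a uniform spanning tree of the
   complement of Z, a large volume, for which the law near L is close to mu.
   Hence the two events decouple, provided that the past of a finite set stays
   bounded, uniformly in the volume.

   This holds on average over the sites of a box.  Given the path from y to the
   sink, the probability that the path from w joins it at y is harmonic in w off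
   the path, with energy at most 2d; a Poincare inequality at many disjoint
   scales shows that the descendants of y at a given scale are then rarely
   spread.  But sites with large pasts in a common tile are mostly comparable
   for the tree order, since otherwise rerouting the tree inside the tile would
   create too many branchings of large pasts, and many comparable sites force
   such a spread.  The average bound passes to every site v of every large
   volume because the probability that the past of v is U is a constant times
   the probability of a single height pattern on U, which converges.

   Thus mu (A `&` E) = mu A * mu E in the limit for A local and E a tail event,
   and approximating E by A gives mu E = mu E * mu E. *)
Require Import Defs.
From HB Require Import structures.
From Stdlib Require Import Relation_Operators.
From mathcomp Require Import all_boot all_order all_algebra finmap.
From mathcomp Require Import boolp reals.
From mathcomp Require Import zify ring lra.

Set Implicit Arguments.
Unset Strict Implicit.
Unset Printing Implicit Defensive.
Import Order.TTheory GRing.Theory Num.Theory.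
Local Open Scope ring_scope.

(** * Burning *)

(** The hypothesis gives convergence for heights only; nothing is assumed about limits of spanning
    trees. So a statement on trees is proved in one finite volume, and what must be compared between
    volumes is first rewritten as the probability of a height pattern. This is the role of
    [past_law]: that the past of a site is [U] and that the heights on [U] are minimal are events
    with the same factor outside of [U]. Without it the atypical sites left by an average over a box
    could not be excluded.

    The average bound is a competition between scales. If a proportion delta of the sites had large
    pasts, then at each of J scales the chains a -> y -> b inside tiles would number at least a
    constant times delta^3 of their maximum, up to small errors, whereas the energy available to all
    scales together is at most 2d, because disjoint annuli around y share one harmonic function. The
    other error terms are made small fractions of delta^3 per scale, and then J is taken large.

    That d is at least 2 matters twice: a walk between two points far from y in every coordinate,
    changing one coordinate at a time, avoids the inner tile, and the square of the side of a tile
    is at most its volume. *)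

Section Closure.
Variable X : finType.
Implicit Types (B C I Hd U : {set X}) (fire : X -> {set X} -> bool).

(** Sites of [Hd] are held back: they are burnt only if they were so at the start. *)
Definition stp fire Hd B := B :|: [set x | (x \notin Hd) && fire x B].
Definition cl fire Hd I := iter #|X| (stp fire Hd) I.

Definition fire_mono fire :=
  forall x B C, B \subset C -> fire x B -> fire x C.

Lemma stp_sub fire Hd B : B \subset stp fire Hd B.
Proof. exact: subsetUl. Qed.

Lemma iter_stp_sub fire Hd n B : B \subset iter n (stp fire Hd) B.
Proof. by elim: n => //= n IH; apply: subset_trans IH (stp_sub _ _ _). Qed.

Lemma cl_sub fire Hd I : I \subset cl fire Hd I.
Proof. exact: iter_stp_sub. Qed.

Lemma cl_ind fire Hd (P : {set X} -> Prop) I :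
  P I -> (forall B, P B -> P (stp fire Hd B)) -> P (cl fire Hd I).
Proof. by move=> P0 PS; rewrite /cl; elim: #|X| => //= n; apply: PS. Qed.

Lemma stp_cl fire Hd I : stp fire Hd (cl fire Hd I) = cl fire Hd I.
Proof.
set f := stp fire Hd.
(* Until the iterates stop they gain a site in every round, so [#|X|] rounds reach the fixed
   point. *)
suff H n : f (iter n f I) = iter n f I \/ (n <= #|iter n f I|)%N.
  case: (H #|X|.+1) => [E|]; last by rewrite leqNgt ltnS max_card.
  have [//|le] := H #|X|.
  have /eqP E2: iter #|X| f I == [set: X] by rewrite eqEcard subsetT cardsT.
  rewrite /cl -/f E2; apply/eqP; rewrite eqEsubset subsetT.
  exact: stp_sub.
elim: n => [|n [IH|IH]]; first by right.
  by left; rewrite !iterS IH.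
have [E|NE] := eqVneq (f (iter n f I)) (iter n f I).
  by left; rewrite !iterS E.
right; apply: leq_ltn_trans IH _; apply: proper_card.
by rewrite properEneq eq_sym NE stp_sub.
Qed.

Lemma cl_closed fire Hd I x :
  x \notin Hd -> fire x (cl fire Hd I) -> x \in cl fire Hd I.
Proof. by move=> xH xf; rewrite -stp_cl inE inE xH xf orbT. Qed.

Lemma cl_min fire Hd I C : fire_mono fire -> I \subset C ->
  (forall x, x \notin Hd -> fire x C -> x \in C) -> cl fire Hd I \subset C.
Proof.
move=> mo IC cC; apply: (@cl_ind fire Hd (fun B => B \subset C)) => // B BC.
apply/subsetP => x; rewrite inE => /orP[/(subsetP BC)//|].
by rewrite inE => /andP[xH xf]; apply: cC xH (mo _ _ _ BC xf).
Qed.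

Lemma cl_fired fire Hd I x : fire_mono fire -> x \in cl fire Hd I ->
  (x \in I) || ((x \notin Hd) && fire x (cl fire Hd I)).
Proof.
move=> mo; rewrite /cl; elim: #|X| => [->//|n IH] /=.
rewrite {1}/stp inE => /orP[/IH/orP[->//|/andP[-> xf]]|].
  by rewrite (mo _ _ _ (stp_sub _ _ _) xf) orbT.
rewrite inE => /andP[-> xf].
by rewrite (mo _ _ _ (stp_sub _ _ _) xf) orbT.
Qed.

Lemma cl_mono fire Hd Hd' I I' : fire_mono fire -> Hd' \subset Hd ->
  I \subset I' -> cl fire Hd I \subset cl fire Hd' I'.
Proof.
move=> mo HH II; apply: cl_min => //; first exact: subset_trans II (cl_sub _ _ _).
move=> x xH; apply: cl_closed; apply: contra xH; exact: (subsetP HH).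
Qed.

(** The order of burning is irrelevant: what burns while more sites are held back is an intermediate
    stage. So the burnt sets for shrinking held sets all occur in a single run. *)
Lemma cl_cl fire Hd Hd' I : fire_mono fire -> Hd' \subset Hd ->
  cl fire Hd' (cl fire Hd I) = cl fire Hd' I.
Proof.
move=> mo HH; apply/eqP; rewrite eqEsubset; apply/andP; split.
  apply: cl_min => //; first exact: cl_mono.
  by move=> x; apply: cl_closed.
by apply: cl_mono => //; apply: cl_sub.
Qed.

(** No site of [U] burns, so holding back all of [U] changes nothing, and the resulting condition
    concerns only sites outside of [U]. *)
Lemma cl_holdE fire Hd I U : fire_mono fire -> Hd \subset U ->
  cl fire Hd I = ~: U -> cl fire U I = ~: U.
Proof.
move=> mo HU E; have sub : cl fire U I \subset ~: U by rewrite -E; apply: cl_mono.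
apply/eqP; rewrite eqEsubset sub /= -{1}E.
apply: cl_min => //; first exact: cl_sub.
move=> x xH xf; apply: cl_closed => //.
rewrite -in_setC -E; apply: cl_closed => //.
by rewrite E; apply: mo xf.
Qed.

Lemma eq_cl fire fire' Hd I :
  (forall x B, x \notin Hd -> x \notin I -> fire x B = fire' x B) ->
  cl fire Hd I = cl fire' Hd I.
Proof.
move=> E; rewrite /cl; elim: #|X| => //= n ->.
set B := iter n _ I.
apply/setP => x; rewrite !inE.
case: (boolP (x \in B)) => //= xB; case: (boolP (x \in Hd)) => //= xH.
apply: E => //; apply: contra xB; exact: (subsetP (iter_stp_sub _ _ _ _)).
Qed.

(** A nonempty [F] in which no site can burn first is a forbidden subconfiguration; the sites left
    unburnt form the largest one. *)
Lemma cl_fullP fire U : fire_mono fire ->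
  reflect (forall F : {set X}, F \subset U -> F != set0 ->
             exists2 x, x \in F & fire x (~: F))
          (cl fire set0 (~: U) == setT).
Proof.
move=> mo; apply: (iffP eqP) => [E F FU /set0Pn[y yF]|H].
  case: (boolP [exists x in F, fire x (~: F)]) => [/exists_inP[x]|]; first by exists x.
  rewrite negb_exists_in => /forall_inP nf.
  have: cl fire set0 (~: U) \subset ~: F.
    apply: cl_min => //; first by rewrite setCS.
    move=> x _ xf; rewrite inE; apply/negP => xF.
    by move: (nf x xF); rewrite xf.
  by rewrite E => /subsetP/(_ y (in_setT _)); rewrite inE yF.
apply/eqP; rewrite -[_ == _]negbK; apply/negP => NE.
have [||x xF] := H (~: cl fire set0 (~: U)).
- by rewrite -setCS setCK cl_sub.
- by apply: contra NE => /eqP E; rewrite -[cl _ _ _]setCK E setC0.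
rewrite setCK => xf; move: xF; rewrite inE => /negP; apply.
by apply: cl_closed xf; rewrite inE.
Qed.

End Closure.

Section ClosureIso.
Variables (X Y : finType) (phi : X -> Y).
Variables (fireX : X -> {set X} -> bool) (fireY : Y -> {set Y} -> bool).
Hypotheses (moX : fire_mono fireX) (moY : fire_mono fireY) (injphi : injective phi).
Hypothesis compat : forall x (B : {set Y}), ~: (phi @: setT) \subset B ->
  fireY (phi x) B = fireX x (phi @^-1: B).

(** [Y] is burnt outside the image of [phi] from the start, so this complement plays the role of a
    sink for [X]. *)
Lemma cl_iso (Hd I : {set Y}) : ~: (phi @: setT) \subset I ->
  phi @^-1: cl fireY Hd I = cl fireX (phi @^-1: Hd) (phi @^-1: I).
Proof.
move=> II; apply/eqP; rewrite eqEsubset; apply/andP; split.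
  set C := cl fireX _ _.
  have sub : cl fireY Hd I \subset ~: (phi @: setT) :|: phi @: C.
    have pC : phi @^-1: (~: (phi @: setT) :|: phi @: C) = C.
      apply/setP => x; rewrite !inE imset_f ?inE //=.
      by rewrite mem_imset.
    apply: cl_min => //.
      apply/subsetP => y yI; rewrite !inE.
      case: (boolP (y \in phi @: setT)) => //= /imsetP[x _ yx].
      rewrite yx mem_imset //; apply: (subsetP (cl_sub _ _ _)).
      by rewrite inE -yx.
    move=> y yH yf; rewrite !inE.
    case: (boolP (y \in phi @: setT)) => //= /imsetP[x _ yx].
    rewrite yx mem_imset //; apply: cl_closed; first by rewrite inE -yx.
    by move: yf; rewrite yx compat ?subsetUl // pC.
  apply/subsetP => x; rewrite inE => /(subsetP sub).
  by rewrite !inE imset_f ?inE //= mem_imset.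
apply: cl_min => //; first by apply: preimsetS; apply: cl_sub.
move=> x; rewrite inE => xH xf; rewrite inE; apply: cl_closed => //.
by rewrite compat //; apply: subset_trans II (cl_sub _ _ _).
Qed.

End ClosureIso.

Section Rules.
Variables (X D : finType) (nb : X -> D -> option X).
Implicit Types (B C I Hd U V W L : {set X}) (p : X -> D) (h : X -> nat).

(** [None] is the sink, burnt from the start, so directions that leave the volume are always
    open. *)
Definition opn B x : {set D} :=
  [set i | if nb x i is Some y then y \in B else true].

Lemma opn_mono x B C : B \subset C -> opn B x \subset opn C x.
Proof.
move=> BC; apply/subsetP => i; rewrite !inE; case: (nb x i) => // y.
exact: (subsetP BC).
Qed.

Definition fireP p x B := p x \in opn B x.
(** Heights are stored minus one: the inequality says that the unburnt neighbours are fewer than the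
    true height. *)
Definition fireK h x B := (#|D| <= h x + #|opn B x|)%N.

Lemma firePE p x B : fireP p x B = (p x \in opn B x). Proof. by []. Qed.

Lemma fireP_mono p : fire_mono (fireP p).
Proof. by move=> x B C BC; apply: (subsetP (opn_mono x BC)). Qed.

Lemma fireK_mono h : fire_mono (fireK h).
Proof.
move=> x B C BC /leq_trans; apply; rewrite leq_add2l.
exact: subset_leq_card (opn_mono x BC).
Qed.

End Rules.

(** In a nested family the pattern of an element is determined by the first set that contains it, so
    it is enough that the successive layers have equal sizes. The induction removes the smallest
    set. *)
Lemma chain_count (S T : finType) (Q : seq bool -> bool)
    (Ss : seq {set S}) (Ts : seq {set T}) (E : {set S}) (F : {set T}) :
  [seq #|A :&: E| | A : {set S} <- Ss] = [seq #|A :&: F| | A : {set T} <- Ts] -> #|E| = #|F| ->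
  pairwise (fun A B : {set S} => A \subset B) Ss ->
  pairwise (fun A B : {set T} => A \subset B) Ts ->
  #|[set i in E | Q [seq i \in A | A : {set S} <- Ss]]| =
  #|[set j in F | Q [seq j \in A | A : {set T} <- Ts]]|.
Proof.
elim: Ss Ts E F Q => [|A Ss IH] [|B Ts] // E F Q /=.
  move=> _ EF _ _.
  have set_const (U : finType) (b : bool) (G : {set U}) :
      #|[set i in G | b]| = (b * #|G|)%N.
    case: b; rewrite ?mul1n ?mul0n; first by congr #|pred_of_set _|; apply/setP => i; rewrite inE andbT.
    by apply/eqP; rewrite cards_eq0; apply/eqP/setP => i; rewrite !inE andbF.
  by rewrite !set_const EF.
case=> EAB Etl EF /andP[/allP Amin pS] /andP[/allP Bmin pT].
have split (U : finType) (A0 G : {set U}) (Us : seq {set U}) :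
    (forall C, C \in Us -> A0 \subset C) ->
    #|[set i in G | Q ((i \in A0) :: [seq i \in C | C : {set U} <- Us])]| =
    ((Q (nseq (size Us).+1 true)) * #|A0 :&: G| +
     #|[set i in G :\: A0 | Q (false :: [seq i \in C | C : {set U} <- Us])]|)%N.
  move=> mn; rewrite -(cardsID A0); congr (_ + _)%N; last first.
    congr #|pred_of_set _|; apply/setP => i; rewrite !inE.
    by case: (i \in A0); rewrite ?andbF.
  have ->: [set i in G | Q ((i \in A0) :: [seq i \in C | C : {set U} <- Us])] :&: A0 =
    [set i in A0 :&: G | Q (nseq (size Us).+1 true)].
    apply/setP => i; rewrite !inE; case: (boolP (i \in A0)) => iA; rewrite ?andbF ?andbT //=.
    congr (_ && Q (_ :: _)).
    elim: Us mn => //= C Us IHU mn.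
    rewrite (subsetP (mn _ (mem_head _ _)) _ iA) IHU // => C' C'U.
    by apply: mn; rewrite inE C'U orbT.
  case: (Q _); rewrite ?mul1n ?mul0n.
    by congr #|pred_of_set _|; apply/setP => i; rewrite inE andbT.
  by apply/eqP; rewrite cards_eq0; apply/eqP/setP => i; rewrite !inE andbF.
rewrite !split // EAB; congr ((nat_of_bool (Q (true :: _))) * _ + _)%N.
  by congr nseq; rewrite -(size_map (fun A : {set S} => #|A :&: E|)) Etl size_map.
apply: (IH Ts (E :\: A) (F :\: B) (fun s => Q (false :: s))) => //; last first.
  have := cardsID A E; have := cardsID B F; rewrite -EF setIC -EAB setIC => <-.
  by move/addnI.
have cd (U : finType) (A0 G : {set U}) (Us : seq {set U}) :
    (forall C, C \in Us -> A0 \subset C) ->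
    [seq #|C :&: (G :\: A0)| | C : {set U} <- Us] =
    [seq (#|C :&: G| - #|A0 :&: G|)%N | C : {set U} <- Us].
  move=> mn; apply/eq_in_map => C /mn AC.
  rewrite (_ : C :&: (G :\: A0) = (C :&: G) :\: A0); last first.
    by apply/setP => x; rewrite !inE andbCA.
  rewrite cardsD; congr (_ - #|pred_of_set _|)%N; apply/setP => x; rewrite !inE.
  case xA: (x \in A0); rewrite ?andbF //= andbT.
  by rewrite (subsetP AC _ xA).
rewrite !cd // EAB.
rewrite (map_comp (fun k => (k - #|B :&: F|)%N) (fun C : {set S} => #|C :&: E|)) Etl.
by rewrite -map_comp.
Qed.

Lemma card_ffun_forall (X T : finType) (C : X -> pred T) :
  #|[set f : {ffun X -> T} | [forall x, C x (f x)]]| = (\prod_x #|C x|)%N.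
Proof.
rewrite (_ : #|_| = #|family C|); last first.
  by rewrite cardsE; apply: eq_card => f; rewrite !inE.
by rewrite card_family foldrE big_map big_enum.
Qed.

Lemma card_threshold (m k : nat) : (k <= m)%N ->
  #|[set j : 'I_m | (m <= j + k)%N]| = k.
Proof.
move=> km; rewrite -[in RHS](card_ord k).
rewrite -(card_imset _ (@rev_ord_inj m)).
rewrite -(@card_imset _ _ (fun j : 'I_k => widen_ord km j)); last first.
  by move=> i j /(congr1 val) /= /val_inj.
apply: eq_card => j; apply/imsetP/imsetP => -[i].
  rewrite inE => ile ->; have lt : (rev_ord i < k)%N.
    by rewrite /=; have := ltn_ord i; lia.
  by exists (Ordinal lt) => //; apply: val_inj.
move=> _ ->; exists (rev_ord (widen_ord km i)); last by rewrite rev_ordK.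
by rewrite inE /=; have := ltn_ord i; lia.
Qed.

Section Equidistribution.
Variables (X D : finType) (nb : X -> D -> option X) (m : nat).
Hypothesis card_D : #|D| = m.
Local Notation H := 'I_m.
Local Notation fireP := (fireP nb).
Local Notation opn := (opn nb).

Definition fireH (h : {ffun X -> H}) := fireK nb (fun x => h x).

Lemma fireHE h x B : fireH h x B = (#|D| <= h x + #|opn B x|)%N.
Proof. by []. Qed.

Definition run (fire : X -> {set X} -> bool) := scanl (fun B Hd => stp fire Hd B).

(** The condition that the burnt sets [bs] impose on the single site [x], given the values [vs] of
    its rule at these sets. The rule at [x] reads only the height or pointer at [x], so a prescribed
    run is a product event. *)
Fixpoint traj_ok (x : X) (B : {set X}) (hs bs : seq {set X}) (vs : seq bool) :=
  match hs, bs with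
  | [::], [::] => true
  | Hd :: hs', B' :: bs' =>
    ((x \in B') == (x \in B) || ((x \notin Hd) && head false vs)) &&
    traj_ok x B' hs' bs' (behead vs)
  | _, _ => false
  end.

Lemma run_traj fire I hs bs : size bs = size hs -> (run fire I hs == bs) =
  [forall x, traj_ok x I hs bs [seq fire x B | B : {set X} <- I :: bs]].
Proof.
elim: hs I bs => [|Hd hs IH] I [|B bs] //=; first by move=> _; apply/esym/forallP.
case=> /IH{}IH; rewrite eqseq_cons.
apply/andP/forallP => [[/eqP <- r] x|Hall].
  by rewrite !inE eqxx /=; move: r; rewrite IH => /forallP.
have EB : stp fire Hd I = B.
  by apply/setP => x; have /andP[/eqP -> _] := Hall x; rewrite !inE.
rewrite EB eqxx IH; split=> //; apply/forallP => x.
by have /andP[_] := Hall x.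
Qed.

Lemma run_pairwise fire I hs :
  pairwise (fun A B : {set X} => A \subset B) (I :: run fire I hs).
Proof.
elim: hs I => //= Hd hs IH I; have /= -> := IH (stp fire Hd I).
rewrite stp_sub /= andbT; have /= /andP[/allP al _] := IH (stp fire Hd I).
by apply/allP => B /al; apply: subset_trans (stp_sub _ _ _).
Qed.

(** Both counts are products over the sites. At one site, the heights that burn next to the
    successive burnt sets and the directions open at them form two nested families with equal
    cardinalities, so [chain_count] applies. *)
Lemma card_run I hs bs : size bs = size hs ->
  #|[set h : {ffun X -> H} | run (fireH h) I hs == bs]| =
  #|[set p : {ffun X -> D} | run (fireP p) I hs == bs]|.
Proof.
move=> sz.
(* Runs increase, so a list that does not increase is reached by neither rule. *)
case: (boolP (pairwise (fun A B : {set X} => A \subset B) (I :: bs))) => [pw|npw]; last first.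
  have E0 (T : finType) (f : T -> X -> {set X} -> bool) :
      #|[set h | run (f h) I hs == bs]| = 0%N.
    apply/eqP; rewrite cards_eq0; apply/eqP/setP => h; rewrite !inE.
    by apply/negbTE; apply: contra npw => /eqP <-; apply: run_pairwise.
  by rewrite !E0.
pose CK x (i : H) := traj_ok x I hs bs
  [seq i \in A | A : {set H} <- [seq [set j : H | m <= j + #|opn B x|]%N | B : {set X} <- I :: bs]].
pose CP x (i : D) := traj_ok x I hs bs
  [seq i \in A | A : {set D} <- [seq opn B x | B : {set X} <- I :: bs]].
have -> : [set h : {ffun X -> H} | run (fireH h) I hs == bs] =
          [set h : {ffun X -> H} | [forall x, CK x (h x)]].
  apply/setP => h; rewrite !inE run_traj //; apply: eq_forallb => x; rewrite /CK.
  congr (traj_ok _ _ _ _ _); rewrite -map_comp; apply: eq_map => B /=.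
  by rewrite inE /fireH /fireK card_D.
have -> : [set p : {ffun X -> D} | run (fireP p) I hs == bs] =
          [set p : {ffun X -> D} | [forall x, CP x (p x)]].
  apply/setP => p; rewrite !inE run_traj //; apply: eq_forallb => x; rewrite /CP.
  by congr (traj_ok _ _ _ _ _); rewrite -map_comp.
rewrite !card_ffun_forall; apply: eq_bigr => x _.
have := @chain_count H D (traj_ok x I hs bs)
  [seq [set j : H | m <= j + #|opn B x|]%N | B : {set X} <- I :: bs]
  [seq opn B x | B : {set X} <- I :: bs] setT setT.
rewrite !cardsT card_ord card_D !pairwise_map => cc.
have -> : #|CK x| = #|[set i in setT | traj_ok x I hs bs
  [seq i \in A | A : {set H} <- [seq [set j : H | m <= j + #|opn B x|]%N | B : {set X} <- I :: bs]]]|.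
  by apply: eq_card => i; rewrite in_set in_setT.
have -> : #|CP x| = #|[set i in setT | traj_ok x I hs bs
  [seq i \in A | A : {set D} <- [seq opn B x | B : {set X} <- I :: bs]]]|.
  by apply: eq_card => i; rewrite in_set in_setT.
apply: cc => //.
- rewrite -!map_comp; apply: eq_map => B /=; rewrite !setIT card_threshold //.
  by rewrite -card_D max_card.
- apply: sub_pairwise pw => A B AB /=; apply/subsetP => j; rewrite !inE => /leq_trans; apply.
  by rewrite leq_add2l; apply: subset_leq_card; apply: opn_mono.
- by apply: sub_pairwise pw => A B AB /=; apply: opn_mono.
Qed.

Variable R : realFieldType.

Lemma sum_run (G : seq {set X} -> R) I hs :
  \sum_(h : {ffun X -> H}) G (run (fireH h) I hs) =
  \sum_(p : {ffun X -> D}) G (run (fireP p) I hs).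
Proof.
have szr fire : size (run fire I hs) == size hs by rewrite size_scanl.
pose tr fire : (size hs).-tuple {set X} := Tuple (szr fire).
have E (T : finType) (f : T -> X -> {set X} -> bool) :
    \sum_(h : T) G (run (f h) I hs) =
    \sum_(b : (size hs).-tuple {set X}) G b *+ #|[set h | run (f h) I hs == b]|.
  rewrite (partition_big (fun h => tr (f h)) xpredT) //=; apply: eq_bigr => b _.
  rewrite -sumr_const; apply: congr_big => // h; first by rewrite inE.
  by move=> /eqP <-.
by rewrite !E; apply: eq_bigr => b _; rewrite card_run // size_tuple.
Qed.

(* When the open directions of an unburnt site grow from a set A to a set B, the
   number of directions in B \ A equals the number of heights for which the
   site starts to burn. *)
Lemma equidistribution (G : {set X} -> {set X} -> {set X} -> R) H1 H2 H3 I :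
  \sum_(h : {ffun X -> H}) (G (cl (fireH h) H1 I)
     (cl (fireH h) H2 (cl (fireH h) H1 I))
     (cl (fireH h) H3 (cl (fireH h) H2 (cl (fireH h) H1 I)))) =
  \sum_(p : {ffun X -> D}) (G (cl (fireP p) H1 I)
     (cl (fireP p) H2 (cl (fireP p) H1 I))
     (cl (fireP p) H3 (cl (fireP p) H2 (cl (fireP p) H1 I)))).
Proof.
pose n := #|X|.
(* A closure is [n] rounds; three closures in a row are one run, read at the times [n], [n + n] and
   [n + n + n]. *)
pose hs := nseq n H1 ++ nseq n H2 ++ nseq n H3.
pose G' bs := G (nth I (I :: bs) n) (nth I (I :: bs) (n + n)) (nth I (I :: bs) (n + n + n)).
have nthrun fire k : (k <= n + n + n)%N -> nth I (I :: run fire I hs) k =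
    foldl (fun B Hd => stp fire Hd B) I (take k hs).
  move=> kn; rewrite /run.
  have -> : I :: scanl (fun B Hd => stp fire Hd B) I hs =
     [seq foldl (fun B Hd => stp fire Hd B) I (take k hs) | k <- iota 0 (size hs).+1].
    elim: (hs) (I) => // Hd hs' IH J; rewrite [scanl _ _ _]/=.
    have -> : iota 0 (size (Hd :: hs')).+1 = 0%N :: iota (1 + 0) (size hs').+1 by [].
    by rewrite iotaDl map_cons -map_comp IH.
  by rewrite (nth_map 0%N) ?nth_iota ?size_iota //= !size_cat !size_nseq; lia.
have fold_cl (fire : X -> {set X} -> bool) Hd J : foldl (fun B Hd => stp fire Hd B) J (nseq n Hd) = cl fire Hd J.
  have it k : foldl (fun B Hd => stp fire Hd B) J (nseq k Hd) = iter k (stp fire Hd) J.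
    by elim: k J => //= k IH J; rewrite IH -iterSr.
  exact: it.
have GE fire : G' (run fire I hs) = G (cl fire H1 I) (cl fire H2 (cl fire H1 I))
     (cl fire H3 (cl fire H2 (cl fire H1 I))).
  rewrite /G' !nthrun; [|lia..].
  have -> : take (n + n + n) hs = hs by rewrite take_oversize // !size_cat !size_nseq; lia.
  have -> : take n hs = nseq n H1 by rewrite take_cat size_nseq ltnn subnn take0 cats0.
  have -> : take (n + n) hs = nseq n H1 ++ nseq n H2.
    rewrite /hs catA take_cat size_cat !size_nseq ltnn subnn take0 cats0 //.
  by rewrite /hs !foldl_cat !fold_cl.
under eq_bigr do rewrite -GE.
by rewrite sum_run; apply: eq_bigr => p _; rewrite GE.
Qed.

End Equidistribution.

(** * Trees *)

Section Trees.
Variables (X D : finType) (nb : X -> D -> option X).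
Implicit Types (B C I Hd U V W L : {set X}) (p q : {ffun X -> D}).
Local Notation fireP p := (fireP nb p).

Definition st p : rel X := fun x y => nb x (p x) == Some y.
Definition tree p := cl (fireP p) set0 set0 == setT.
Definition past p y : {set X} := [set x | connect (st p) x y].
Definition anc p x : {set X} := [set y | connect (st p) x y].

Lemma stE p x y : st p x y = (nb x (p x) == Some y). Proof. by []. Qed.

Lemma treeE p : tree p = (cl (fireP p) set0 set0 == setT). Proof. by []. Qed.

Lemma st_fun p x y z : st p x y -> st p x z -> y = z.
Proof. by rewrite /st => /eqP -> /eqP[]. Qed.

Lemma connect_step p x y : connect (st p) x y -> x != y ->
  exists2 z, st p x z & connect (st p) z y.
Proof.
move=> /connectP[[|z s] /= + ->]; first by rewrite eqxx.
by case/andP=> xz zs _; exists z => //; apply/connectP; exists s.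
Qed.

Lemma connect_last p x y : connect (st p) x y -> x != y ->
  exists2 z, connect (st p) x z & st p z y.
Proof.
move=> /connectP[s]; case/lastP: s => [|s z] /= + ->; first by rewrite eqxx.
rewrite rcons_path last_rcons => /andP[xs sz] _; exists (last x s) => //.
by apply/connectP; exists s.
Qed.

Lemma connect_total p x y z : connect (st p) x y -> connect (st p) x z ->
  connect (st p) y z || connect (st p) z y.
Proof.
move=> /connectP[s + ->]; elim: s x => [|w s IH] x /=; first by move=> _ ->.
case/andP => xw ws xz; have [<-|xz'] := eqVneq x z.
  by apply/orP; right; apply/connectP; exists (w :: s); rewrite //= xw.
have [w' xw' wz] := connect_step xz xz'.
by apply: IH => //; rewrite (st_fun xw xw').
Qed.

(** In a tree a site burns strictly after the site it points to. *)
Lemma tree_acyc p x y : tree p -> st p x y -> ~~ connect (st p) y x.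
Proof.
move=> tp; move: x y; suff H : forall x, x \in cl (fireP p) set0 set0 ->
    forall y, st p x y -> ~~ connect (st p) y x.
  by move=> x y; apply: H; rewrite (eqP tp) inE.
apply: (@cl_ind _ (fireP p) set0
  (fun B => forall x, x \in B -> forall y, st p x y -> ~~ connect (st p) y x)).
  by move=> x; rewrite inE.
move=> B IB x; rewrite inE => /orP[/IB//|].
rewrite !inE /= => fx y xy; apply/negP => yx.
move: fx; rewrite firePE inE (eqP xy) => yB.
have [E|yx'] := eqVneq y x; first by move: yB xy; rewrite E => xB /(IB _ xB); rewrite connect0.
have [z yz zx] := connect_step yx yx'.
by have /negP := IB _ yB _ yz; apply; apply: connect_trans zx (connect1 xy).
Qed.

Lemma tree_anti p x y : tree p -> connect (st p) x y -> connect (st p) y x -> x = y.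
Proof.
move=> tp xy yx; apply/eqP/negPn/negP => NE.
have [z xz zy] := connect_step xy NE.
by have /negP := tree_acyc tp xz; apply; apply: connect_trans yx.
Qed.

Lemma past_refl p x : x \in past p x. Proof. by rewrite inE connect0. Qed.

Lemma past_sub p x y : connect (st p) x y -> past p x \subset past p y.
Proof.
by move=> xy; apply/subsetP => z; rewrite !inE => /connect_trans; apply.
Qed.

Lemma past_proper p x y : tree p -> connect (st p) x y -> x != y ->
  (#|past p x| < #|past p y|)%N.
Proof.
move=> tp xy NE; apply: proper_card; rewrite properE past_sub //=.
apply/subsetPn; exists y; rewrite ?past_refl // inE.
by apply: contra NE => yx; rewrite (tree_anti tp xy yx).
Qed.

Lemma no_fire p B x : ~~ fireP p x B -> exists2 y, st p x y & y \notin B.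
Proof.
rewrite firePE inE /st; case: (nb x (p x)) => // y yB; by exists y.
Qed.

Lemma not_cl_next p x Hd I : x \notin cl (fireP p) Hd I -> x \notin Hd ->
  exists2 y, st p x y & y \notin cl (fireP p) Hd I.
Proof.
move=> xC xH; apply: no_fire; apply: contra xC; exact: cl_closed.
Qed.

(** Used with the size of the past as rank, which increases strictly along the pointers of a tree: a
    set whose sites all point back into the set is empty. *)
Lemma escape (p : {ffun X -> D}) (F : {set X}) (r : X -> nat) :
  (forall x, x \in F -> exists y, (y \in F) && (r x < r y)%N) -> F = set0.
Proof.
move=> H; apply/eqP/set0Pn => -[x0 x0F].
case: (arg_maxnP (fun x => r x) x0F) => x xF mx.
have [y /andP[yF]] := H x xF; rewrite ltnNge.
by rewrite [(_ <= _)%N]mx.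
Qed.

Lemma tree_clC p Hd : tree p ->
  ~: cl (fireP p) Hd set0 = [set x | [exists y in Hd, connect (st p) x y]].
Proof.
move=> tp; apply/setP => x; rewrite !inE; apply/idP/exists_inP => [xC|[y yH xy]].
  pose F := ~: cl (fireP p) Hd set0 :&: [set x | ~~ [exists y in Hd, connect (st p) x y]].
  suff F0 : F = set0.
    apply/exists_inP; rewrite -[X in is_true X]negbK; apply/negP => NE.
    have : x \in F by rewrite !inE xC.
    by rewrite F0 inE.
  apply: (@escape p _ (fun x => #|past p x|)) => z; rewrite !inE => /andP[zC NE].
  have zH : z \notin Hd.
    by apply: contra NE => zH; apply/exists_inP; exists z; rewrite ?connect0.
  have [y zy yC] := not_cl_next zC zH; exists y; rewrite !inE yC /=.
  rewrite past_proper ?connect1 // ?andbT.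
    apply: contra NE => /exists_inP[w wH yw]; apply/exists_inP; exists w => //.
    by apply: connect_trans yw; apply: connect1.
  by apply/eqP => E; have := tree_acyc tp zy; rewrite E connect0.
apply/negP => xC.
move: yH; apply/negP; suff: y \in cl (fireP p) Hd set0.
  by move/(cl_fired (fireP_mono (nb:=nb) (p:=p))); rewrite inE => /andP[].
move: xC xy => + /connectP[s + ->]; elim: s x => //= w s IH x xC /andP[xw ws].
apply: IH ws; move: xC => /(cl_fired (fireP_mono (nb:=nb) (p:=p))).
by rewrite inE /= => /andP[_]; rewrite {1}firePE inE (eqP xw).
Qed.

Lemma connect_agree p q C : {in C, p =1 q} ->
  (forall x y, x \in C -> st p x y -> y \in C) ->
  forall x y, x \in C -> connect (st p) x y -> connect (st q) x y.
Proof.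
move=> pq cC x y xC /connectP[s + ->]; elim: s x xC => //= w s IH x xC /andP[xw ws].
apply: connect_trans (IH _ (cC _ _ xC xw) ws).
by apply: connect1; rewrite /st -pq.
Qed.

Definition big p M : {set X} := [set x | (M <= #|past p x|)%N].
Definition kids p M b : {set X} := [set c in big p M | st p c b].
Definition branching p M : {set X} := [set b | (2 <= #|kids p M b|)%N].

(* Every large vertex is the child of at most one vertex, so branchings are not
   more numerous than the minimal large vertices, whose pasts are disjoint. *)
Lemma card_branching p M : tree p -> (0 < M)%N ->
  (#|branching p M| * M <= #|X|)%N.
Proof.
move=> tp M0; set Q := big p M.
have Qup x y : x \in Q -> connect (st p) x y -> y \in Q.
  by rewrite !inE => xQ xy; apply: leq_trans xQ (subset_leq_card (past_sub xy)).
pose lv := [set x in Q | #|kids p M x| == 0%N].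
have le1 : (\sum_(x in Q) #|kids p M x| <= #|Q|)%N.
  under eq_bigr do rewrite -sum1_card big_mkcond.
  rewrite exchange_big /= -sum1_card [leqRHS]big_mkcond; apply: leq_sum => c _.
  case: (boolP (c \in Q)) => cQ; last first.
    rewrite big1 // => x _; rewrite inE; case: (boolP (c \in big p M)) => //= cb.
    by rewrite cb in cQ.
  case: (pickP (fun x => st p c x)) => [x0 cx0|none]; last first.
    by rewrite big1 // => x _; rewrite inE none andbF.
  have x0Q : x0 \in Q := Qup _ _ cQ (connect1 cx0).
  rewrite (bigD1 x0) //= big1 ?addn0; first by case: ifP.
  move=> x /andP[_ NE]; rewrite inE; case: ifP => // /andP[_ cx].
  by rewrite (st_fun cx cx0) eqxx in NE.
have le2 : (#|branching p M| <= #|lv|)%N.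
  have brQ : branching p M \subset Q.
    apply/subsetP => b; rewrite inE => b2.
    have /card_gt0P[c] : (0 < #|kids p M b|)%N by lia.
    by rewrite inE => /andP[cQ cb]; apply: Qup cQ (connect1 cb).
  have : (\sum_(x in Q) (#|kids p M x| + (x \in lv)) >= \sum_(x in Q) (1 + (x \in branching p M)))%N.
    apply: leq_sum => x xQ; rewrite !inE in xQ *; rewrite xQ /=.
    by case: #|kids p M x| => [|[|k]] //=; lia.
  rewrite !big_split /= sum1_card.
  have cnt (A : {set X}) : A \subset Q -> (\sum_(x in Q) (x \in A) = #|A|)%N.
    move=> AQ; rewrite -sum1_card [LHS]big_mkcond [RHS]big_mkcond; apply: eq_bigr => x _.
    by case: (boolP (x \in A)) => [/(subsetP AQ) ->|_] //; case: ifP.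
  rewrite !cnt //; first by lia.
  by apply/subsetP => x; rewrite inE => /andP[].
apply: leq_trans (leq_mul le2 (leqnn M)) _.
rewrite -sum_nat_const.
apply: (@leq_trans (\sum_(x in lv) #|past p x|)).
  by apply: leq_sum => x; rewrite !inE => /andP[].
have tI : trivIset [set past p x | x in lv].
  apply/trivIsetP => A B /imsetP[x xl ->] /imsetP[y yl ->] NE.
  rewrite -setI_eq0; apply/set0Pn => -[z]; rewrite !inE => /andP[zx zy].
  suff E : x = y by rewrite E eqxx in NE.
  have key u v : u \in lv -> v \in lv -> connect (st p) u v -> u = v.
    rewrite !inE => /andP[ub _] /andP[_ /eqP v0] uv; apply/eqP/negPn/negP => NE'.
    have [w uw wv] := connect_last uv NE'.
    have : w \in kids p M v by rewrite inE wv andbT (Qup u) // inE.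
    by move/card0_eq: v0 => ->.
  by case/orP: (connect_total zx zy) => [/key->|/key->].
have inj : {in lv &, injective (past p)}.
  move=> x y _ _ E; apply: (tree_anti tp).
    by have := past_refl p x; rewrite E inE.
  by have := past_refl p y; rewrite -E inE.
have := eqP tI; rewrite /cover big_imset //= => ->.
exact: max_card.
Qed.

End Trees.

(** * Rerouting a tree inside a set to create a branching *)

Section Funnel.
Variables (X D : finType) (nb : X -> D -> option X) (rev : D -> D).
Hypothesis nb_rev : forall x i y, nb x i = Some y -> nb y (rev i) = Some x.
Local Notation st := (st nb).
Local Notation tree := (tree nb).
Local Notation past := (past nb).
Local Notation fireP p := (fireP nb p).

(** Connectedness in the form that rerouting consumes: pointers inside [B] that lead to any chosen
    [v], with a rank [r] that excludes cycles. *)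
Definition conn (B : {set X}) := forall v, v \in B ->
  exists (tw : X -> D) (r : X -> nat), forall x, x \in B -> x != v ->
    exists2 y, nb x (tw x) = Some y & (y \in B) && (r y < r x)%N.

Lemma card_kids (p : {ffun X -> D}) e : (#|[set c | st p c e]| <= #|D|)%N.
Proof.
have inj : {in [set c | st p c e] &, injective (fun c => rev (p c))}.
  move=> c c'; rewrite !inE => /eqP/nb_rev E /eqP/nb_rev E' EE.
  by move: E; rewrite EE E' => -[].
by rewrite -(card_in_imset inj) max_card.
Qed.

Section Reroute.
Variables (p : {ffun X -> D}) (B : {set X}) (v : X) (tw : X -> D) (r : X -> nat).
Hypothesis tp : tree p.
Hypothesis vB : v \in B.
Hypothesis v_exit : forall y, y \in B -> connect (st p) v y -> y = v.
Hypothesis twP : forall x, x \in B -> x != v ->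
  exists2 y, nb x (tw x) = Some y & (y \in B) && (r y < r x)%N.

Definition reroute : {ffun X -> D} :=
  [ffun x => if (x \in B) && (x != v) then tw x else p x].
Local Notation q := reroute.

Lemma reroute_out x : x \notin B -> q x = p x.
Proof. by rewrite ffunE => /negbTE ->. Qed.

Lemma reroute_v : q v = p v.
Proof. by rewrite ffunE eqxx andbF. Qed.

(** By [v_exit] the path that starts at [v] does not meet [B] again, so it keeps its pointers and
    burns; then [B] burns by increasing [r], and then the rest. *)
Lemma reroute_tree : tree q.
Proof.
set C := cl (fireP q) set0 set0.
have F1 : [set y | connect (st p) v y] :&: ~: C = set0.
  apply: (@escape _ _ p _ (fun x => #|past p x|)) => x; rewrite !inE => /andP[vx xC].
  have [|y xy yC] := not_cl_next xC; first by rewrite inE.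
  have pxy : st p x y.
    move: xy; rewrite stE; have [xB|xB] := boolP (x \in B); last by rewrite reroute_out.
    by rewrite (v_exit xB vx) reroute_v.
  exists y; rewrite !inE yC (connect_trans vx) ?connect1 //= past_proper ?connect1 //.
  by apply/eqP => E; have := tree_acyc tp pxy; rewrite E connect0.
have vC : v \in C.
  by move/setP/(_ v): F1; rewrite !inE connect0 /= => /negbFE.
have F2 : B :&: ~: C = set0.
  apply/eqP/set0Pn => -[x0 x0F].
  case: (arg_minnP (fun x => r x) x0F) => x /setIP[xB]; rewrite inE => xC mn.
  have xv : x != v by apply: contra xC => /eqP ->.
  have [y xy /andP[yB]] := twP xB xv; rewrite ltnNge => /negP; apply.
  apply: mn; apply/setIP; split=> //; rewrite inE; apply: contra xC => yC; apply: cl_closed; first by rewrite inE.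
  by rewrite firePE inE ffunE xB xv xy.
rewrite treeE -/C -[C]setCK; apply/eqP; rewrite -setC0; congr (~: _).
apply: (@escape _ _ p _ (fun x => #|past p x|)) => x; rewrite inE => xC.
have xB : x \notin B.
  by move/setP/(_ x): F2; rewrite !inE xC andbT => ->.
have [|y xy yC] := not_cl_next xC; first by rewrite inE.
have pxy : st p x y by move: xy; rewrite stE reroute_out.
exists y; rewrite inE yC /= past_proper ?connect1 //.
by apply/eqP => E; have := tree_acyc tp pxy; rewrite E connect0.
Qed.

Lemma reroute_to_v x : x \in B -> connect (st q) x v.
Proof.
have [n] := ubnP (r x); elim: n x => // n IH x; rewrite ltnS => rx xB.
have [->//|xv] := eqVneq x v.
have [y xy /andP[yB ry]] := twP xB xv.
apply: (connect_trans (connect1 _)) (IH y (leq_trans ry rx) yB).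
by rewrite stE ffunE xB xv xy.
Qed.

Lemma reroute_stay x y : x \in B -> connect (st q) x y ->
  (y \in B) || connect (st q) v y.
Proof.
move=> xB /connectP[s + ->]; elim: s x xB => [|z s IH] x xB /=; first by rewrite xB.
case/andP => xz zs; have [E|xv] := eqVneq x v.
  apply/orP; right; rewrite -E; apply/connectP; exists (z :: s) => //=.
  by rewrite xz.
apply: IH zs; have [w xw /andP[wB _]] := twP xB xv.
by move: xz; rewrite stE ffunE xB xv xw /= => /eqP[<-].
Qed.

End Reroute.

(** Incomparable [w] and [w'] receive their large pasts through different sites of [B]. Sending all
    pointers of [B] to one exit [v] leaves the parts of these pasts outside of [B] intact and makes
    them meet inside [B], at a site with two large children. *)
Lemma funnel (p : {ffun X -> D}) (B : {set X}) (M : nat) w w' :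
  tree p -> (0 < M)%N -> conn B -> w \in B -> w' \in B ->
  (#|B| * (#|D| * M).+1 < #|past p w|)%N -> (#|B| * (#|D| * M).+1 < #|past p w'|)%N ->
  ~~ connect (st p) w w' -> ~~ connect (st p) w' w ->
  exists q : {ffun X -> D}, [/\ tree q, {in ~: B, q =1 p} &
    exists2 b, b \in B & b \in branching nb q M].
Proof.
move=> tp M0 cB wB w'B bw bw' nww' nw'w.
(* [so] allows only steps that start outside of [B], so [ext c] is a part of the past of [c] that
   rerouting does not touch. *)
pose so : rel X := fun x y => st p x y && (x \notin B).
pose ext c : {set X} := [set x | connect so x c].
pose entry e c := [&& e \in B, c \notin B, st p c e & (M <= #|ext c|)%N].
have so_st x y : connect so x y -> connect (st p) x y.
  move/connectP=> [s + ->]; elim: s x => //= z s IH x /andP[/andP[xz _] zs].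
  by apply: connect_trans (connect1 xz) (IH _ zs).
have first x y : x \notin B -> y \in B -> connect (st p) x y ->
    exists e c, [/\ e \in B, c \notin B, st p c e, connect so x c & connect (st p) e y].
  move=> + yB /connectP[s + E]; elim: s x E => /= [x <-|z s IH x E xB].
    by rewrite yB.
  case/andP => xz zs; have [zB|zB] := boolP (z \in B).
    exists z, x; split=> //.
    by apply/connectP; exists s.
  have [e [c [eB cB' ce zc ey]]] := IH _ E zB zs; exists e, c; split=> //.
  by apply: connect_trans zc; apply: connect1; rewrite /so xz xB.
have big_entry u : u \in B -> (#|B| * (#|D| * M).+1 < #|past p u|)%N ->
    exists e c, entry e c /\ connect (st p) e u.
  move=> uB; rewrite ltnNge => /negP bu.
  case: (boolP [exists e, exists c, entry e c && connect (st p) e u]) => [/existsP[e]/existsP[c]/andP[? ?]|].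
    by exists e, c.
  rewrite negb_exists => /forallP none; case: bu.
  (* Without an entry, each of the at most [#|B| * #|D|] outer parts has fewer than [M] sites, too
     few to fill the past of [u]. *)
  pose cover := B :|: \bigcup_(e in B | connect (st p) e u) \bigcup_(c in [set c | st p c e] :\: B) ext c.
  have : past p u \subset cover.
    apply/subsetP => x; rewrite inE => xu; rewrite inE.
    have [//|xB] := boolP (x \in B).
    have [e [c [eB cB' ce xc eu]]] := first _ _ xB uB xu.
    apply/bigcupP; exists e; first by rewrite eB.
    by apply/bigcupP; exists c; rewrite !inE ?cB'.
  move/subset_leq_card/leq_trans; apply.
  apply: leq_trans (leq_card_setU _ _) _; rewrite mulnS leq_add2l.
  apply: leq_trans (_ : (\sum_(e in B) #|D| * M <= _)%N); last by rewrite sum_nat_const.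
  have bc (I : finType) (P : pred I) (F : I -> {set X}) (k : I -> nat) :
      (forall i, P i -> (#|F i| <= k i)%N) -> (#|\bigcup_(i | P i) F i| <= \sum_(i | P i) k i)%N.
    move=> Fk; elim/big_rec2: _ => [|i m A Pi Am]; first by rewrite cards0.
    by apply: leq_trans (leq_card_setU _ _) _; apply: leq_add; rewrite ?Fk.
  apply: leq_trans (bc _ _ _ (fun=> #|D| * M)%N _) _.
    move=> e /andP[eB eu].
    apply: leq_trans (bc _ _ _ (fun=> M) _) _.
      move=> c; rewrite !inE => /andP[cB' ce].
      move: (none e); rewrite negb_exists => /forallP/(_ c).
      by rewrite /entry eB cB' ce eu /= andbT -ltnNge => /ltnW.
    rewrite sum_nat_const leq_mul2r; apply/orP; right.
    by apply: leq_trans (card_kids p e); apply: subset_leq_card; apply: subsetDl.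
  by rewrite [leqLHS]big_mkcondr; apply: leq_sum => e _; case: ifP.
have [e1 [c1 [en1 e1w]]] := big_entry _ wB bw.
have [e2 [c2 [en2 e2w]]] := big_entry _ w'B bw'.
have e12 : e1 != e2.
  apply/eqP => E; move: e2w; rewrite -E => e1w'.
  by have := connect_total e1w e1w'; rewrite (negbTE nww') (negbTE nw'w).
(* A site of [B] with largest past is the last site of [B] on its path. *)
have [v vB mx] := arg_maxnP (fun x => #|past p x|) wB.
have v_exit y : y \in B -> connect (st p) v y -> y = v.
  move=> yB vy; apply/eqP/negPn/negP => NE.
  have : (#|past p y| <= #|past p v|)%N := mx _ yB.
  by rewrite leqNgt past_proper // eq_sym.
have [tw [r twP]] := cB v vB.
pose q := reroute p B v tw.
have tq : tree q by apply: reroute_tree twP.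
have qout : {in ~: B, q =1 p} by move=> x; rewrite inE => /reroute_out ->.
exists q; split=> //.
have so_q x y : connect so x y -> connect (st q) x y.
  move/connectP=> [s + ->]; elim: s x => //= z s IH x /andP[/andP[xz xB] zs].
  apply: connect_trans (IH _ zs); apply: connect1.
  by rewrite stE qout ?inE.
have bigc e c : entry e c -> [/\ e \in B, c \notin B, st q c e & c \in big nb q M].
  case/and4P => eB cB' ce cM; split=> //; first by rewrite stE qout ?inE.
  rewrite inE; apply: leq_trans cM _; apply: subset_leq_card.
  by apply/subsetP => x; rewrite !inE => /so_q.
have [e1B c1B ce1 c1M] := bigc _ _ en1.
have [e2B c2B ce2 c2M] := bigc _ _ en2.
have tov := reroute_to_v p twP.
pose both y := connect (st q) e1 y && connect (st q) e2 y.
have bv : both v by rewrite /both !tov.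
(* A common ancestor of [e1] and [e2] with smallest past is the point where their paths meet. *)
case: (arg_minnP (fun y => #|past q y|) bv) => b /andP[e1b e2b] mn.
have bB : b \in B.
  case/orP: (reroute_stay twP e1B e1b) => // vb.
  have [->//|NE] := eqVneq b v.
  have : (#|past q b| <= #|past q v|)%N := mn _ bv.
  rewrite leqNgt => /negP[]; apply: past_proper => //.
  by rewrite eq_sym.
exists b => //; rewrite inE.
have child e c : e \in B -> c \notin B -> st q c e -> c \in big nb q M -> connect (st q) e b ->
    exists2 k, k \in kids nb q M b & (k = c /\ e = b) \/ connect (st q) e k.
  move=> eB cB' ce cM eb; have [E|NE] := eqVneq e b.
    by exists c; [rewrite inE cM -E ce|left].
  have [k ek kb] := connect_last eb NE; exists k; last by right.
  rewrite inE kb andbT inE; move: cM; rewrite inE => /leq_trans; apply.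
  by apply: subset_leq_card; apply: past_sub; apply: connect_trans ek; apply: connect1.
have [k1 k1b H1] := child _ _ e1B c1B ce1 c1M e1b.
have [k2 k2b H2] := child _ _ e2B c2B ce2 c2M e2b.
have stk k : k \in kids nb q M b -> st q k b by rewrite inE => /andP[].
have notin e c : e \in B -> c \notin B -> st q c b -> connect (st q) e c -> False.
  move=> eB cB' cb ec; case/orP: (reroute_stay twP eB ec); first exact/negP.
  move=> vc; have /negP := tree_acyc tq cb; apply.
  by apply: connect_trans vc; apply: tov.
suff NE : k1 != k2.
  rewrite (cardsD1 k1) k1b; apply: (@leq_add 1 1) => //.
  by apply/card_gt0P; exists k2; rewrite in_setD1 eq_sym NE k2b.
(* If the two children coincide, either [e1 = e2], or an entry outside of [B] is reached from [B],
   hence from [v], which closes a cycle, or the paths already met at that child. *)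
apply/eqP => E; case: H1 => [[E1 E1']|c1'].
  case: H2 => [[E2 E2']|c2']; first by rewrite E1' E2' eqxx in e12.
  by apply: (notin e2 c1 e2B c1B); rewrite -E1; [exact: stk|rewrite E].
case: H2 => [[E2 E2']|c2'].
  by apply: (notin e1 c2 e1B c2B); rewrite -E2; [exact: stk|rewrite -E].
have k1both : both k1 by rewrite /both c1' E.
have : (#|past q b| <= #|past q k1|)%N := mn _ k1both.
rewrite leqNgt past_proper //; first exact/connect1/stk.
by apply/eqP => E'; have := tree_acyc tq (stk _ k1b); rewrite E' connect0.
Qed.

End Funnel.

(** * Harmonicity along a branch *)

Section Harmonic.
Variables (X D : finType) (nb : X -> D -> option X) (rev : D -> D) (R : realFieldType).
Hypothesis nb_rev : forall x i y, nb x i = Some y -> nb y (rev i) = Some x.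
Hypothesis revK : involutive rev.
Local Notation st := (st nb).
Local Notation tree := (tree nb).
Local Notation past := (past nb).
Local Notation anc := (anc nb).
Local Notation fireP p := (fireP nb p).

Definition upd (p : {ffun X -> D}) w i : {ffun X -> D} :=
  [ffun x => if x == w then i else p x].

Lemma upd_st p w i x y : x != w -> st (upd p w i) x y = st p x y.
Proof. by move=> /negbTE xw; rewrite !stE ffunE xw. Qed.

Lemma upd_connect p w i x y : ~~ connect (st p) x w ->
  connect (st (upd p w i)) x y = connect (st p) x y.
Proof.
move=> nxw; have agree : {in anc p x, p =1 upd p w i}.
  by move=> z; rewrite inE ffunE; case: eqP => // -> xw; rewrite xw in nxw.
have agree' : {in anc p x, upd p w i =1 p} by move=> z /agree.
have cl1 u v : u \in anc p x -> st p u v -> v \in anc p x.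
  by rewrite !inE => xu uv; apply: connect_trans xu (connect1 uv).
apply/idP/idP; last by apply: (connect_agree agree cl1); rewrite inE connect0.
apply: (connect_agree agree'); last by rewrite inE connect0.
by move=> u v uA; rewrite stE agree' //; apply: cl1.
Qed.

Lemma upd_tree p w i : tree p ->
  (if nb w i is Some u then ~~ connect (st p) u w else true) -> tree (upd p w i).
Proof.
move=> tp Hu; set q := upd p w i; set C := cl (fireP q) set0 set0.
have next x : x \notin C -> x != w -> exists2 y, st p x y & (y \notin C) && (#|past p x| < #|past p y|)%N.
  move=> xC xw; have [|y xy yC] := not_cl_next xC; first by rewrite inE.
  have pxy : st p x y by rewrite -(@upd_st p w i).
  exists y; rewrite // yC past_proper ?connect1 //.
  by apply/eqP => E; have := tree_acyc tp pxy; rewrite E connect0.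
have wC : w \in C.
  apply: cl_closed; first by rewrite inE.
  rewrite firePE inE ffunE eqxx; case E: (nb w i) Hu => [u|] // nuw.
  suff : anc p u :&: ~: C = set0 by move/setP/(_ u); rewrite !inE connect0 /= => /negbFE.
  apply: (@escape _ _ p _ (fun x => #|past p x|)) => x; rewrite !inE => /andP[ux xC].
  have [|y xy /andP[yC lt]] := next _ xC.
    by apply: contra nuw => /eqP <-.
  by exists y; rewrite !inE yC lt (connect_trans ux) ?connect1.
rewrite treeE -/C -[C]setCK; apply/eqP; rewrite -setC0; congr (~: _).
apply: (@escape _ _ p _ (fun x => #|past p x|)) => x; rewrite inE => xC.
have [|y xy /andP[yC lt]] := next _ xC; first by apply: contra xC => /eqP ->.
by exists y; rewrite inE yC lt.
Qed.

Section Class.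
Variables (p0 : {ffun X -> D}) (y : X).
Hypothesis tp0 : tree p0.
Let A := anc p0 y.

Definition tclass : {set {ffun X -> D}} :=
  [set p | tree p && [forall x in A, p x == p0 x]].

Lemma tclass_anc p x : p \in tclass -> (connect (st p) y x) = (x \in A).
Proof.
rewrite inE => /andP[tp /forall_inP Ha].
have agree : {in A, p0 =1 p} by move=> z /Ha/eqP.
have agree' : {in A, p =1 p0} by move=> z /Ha/eqP.
have cl1 u v : u \in A -> st p0 u v -> v \in A.
  by rewrite !inE => xu uv; apply: connect_trans xu (connect1 uv).
rewrite [RHS]inE; apply/idP/idP; last by apply: (connect_agree agree cl1); rewrite inE connect0.
apply: (connect_agree agree'); last by rewrite inE connect0.
by move=> u v uA; rewrite stE agree' //; apply: cl1.
Qed.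

Definition hcount w : nat := #|[set p in tclass | connect (st p) w y]|.

Definition swap w (z : {ffun X -> D} * D) : {ffun X -> D} * D :=
  if (z.1 \in tclass) && (if nb w z.2 is Some u then ~~ connect (st z.1) u w else true)
  then (upd z.1 w z.2, z.1 w) else z.

Lemma upd_tclass p w i : w \notin A -> p \in tclass ->
  (if nb w i is Some u then ~~ connect (st p) u w else true) -> upd p w i \in tclass.
Proof.
move=> wA; rewrite inE => /andP[tp Ha] ok.
rewrite inE upd_tree //=; apply/forall_inP => x xA; rewrite ffunE.
by case: (eqVneq x w) => [E|_]; [rewrite -E xA in wA|apply: (forall_inP Ha)].
Qed.

Lemma swapK w : w \notin A -> involutive (swap w).
Proof.
move=> wA [p i]; rewrite {2}/swap /=; case: ifP => [/andP[pC ok]|].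
  rewrite /swap /= ifT.
    congr (_, _); last by rewrite ffunE eqxx.
    by apply/ffunP => x; rewrite !ffunE; case: eqP => // ->.
  rewrite upd_tclass //=; case E: (nb w (p w)) => [u|] //.
  have nuw : ~~ connect (st p) u w.
    by apply: tree_acyc; [move: pC; rewrite inE => /andP[]|rewrite stE E].
  by rewrite upd_connect.
by rewrite /swap /= => ->.
Qed.

(** [swap] moves the pointer of [w] to the given direction and keeps the old one, an involution on
    pairs. It turns the question whether [w] is below [y] into the same question for the neighbour.
    If the new pointer would close a cycle nothing moves, but then the neighbour [u] is below [w],
    and both or neither are below [y], as [w] is no ancestor of [y]. *)
Lemma harmonic w : w \notin A ->
  (#|D| * hcount w = \sum_i oapp hcount 0 (nb w i))%N.
Proof.
move=> wA.
pose f (z : {ffun X -> D} * D) := ((z.1 \in tclass) && connect (st z.1) w y : nat).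
pose g (z : {ffun X -> D} * D) :=
  ((z.1 \in tclass) && oapp (fun u => connect (st z.1) u y) false (nb w z.2) : nat).
have -> : (#|D| * hcount w)%N = (\sum_z f z)%N.
  rewrite -(pair_big predT predT (fun p i => f (p, i))) /= exchange_big /=.
  rewrite -(sum1_card D) big_distrl /=; apply: eq_bigr => i _; rewrite mul1n.
  rewrite /hcount -sum1_card big_mkcond; apply: eq_bigr => p _; rewrite inE /f /=.
  by case: ifP.
have -> : (\sum_i oapp hcount 0 (nb w i) = \sum_z g z)%N.
  rewrite -(pair_big predT predT (fun p i => g (p, i))) /= exchange_big /=; apply: eq_bigr => i _; rewrite /g /=.
  case: (nb w i) => [u|] /=; last by rewrite big1 // => p; rewrite andbF.
  rewrite /hcount -sum1_card big_mkcond; apply: eq_bigr => p _; rewrite inE.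
  by case: ifP.
have wy : w != y by apply: contra wA => /eqP ->; rewrite inE connect0.
rewrite (reindex_inj (inv_inj (swapK wA))) /=; apply: eq_bigr => -[p i] _.
rewrite /f /g /swap /=; case: (boolP (p \in tclass)) => [pC|npC] /=; last by rewrite (negbTE npC).
have tp : tree p by move: pC; rewrite inE => /andP[].
case: ifPn => [ok|].
  rewrite upd_tclass //= ?pC /=; congr nat_of_bool; case E: (nb w i) ok => [u|] /= ok.
    rewrite -(@upd_connect p w i u y ok); apply/idP/idP => [wu|uy].
      have [z] := connect_step wu wy; rewrite stE ffunE eqxx E => /eqP[<-].
      by rewrite upd_connect.
    apply: connect_trans (uy); apply: connect1.
    by rewrite stE ffunE eqxx E.
  apply/negP => wu; have [z] := connect_step wu wy.
  by rewrite stE ffunE eqxx E.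
case E: (nb w i) => [u|] // /negPn uw /=; rewrite ?pC /=; congr nat_of_bool.
apply/idP/idP => [wy'|uy]; first exact: connect_trans uw wy'.
case/orP: (connect_total uw uy) => // yw.
by rewrite tclass_anc // (negbTE wA) in yw.
Qed.

Lemma hcount_y : hcount y = #|tclass|.
Proof. by apply: eq_card => p; rewrite inE connect0 andbT. Qed.

Lemma hcount_anc w : w \in A -> w != y -> hcount w = 0%N.
Proof.
move=> wA wy; apply/eqP; rewrite cards_eq0; apply/eqP/setP => p; rewrite !inE.
apply/negP => /andP[pC wy'].
have tp : tree p by case/andP: pC.
have yw : connect (st p) y w by rewrite tclass_anc // inE.
by move/eqP: wy; apply; apply: tree_anti yw.
Qed.

Lemma tclass_self : p0 \in tclass.
Proof. by rewrite inE tp0; apply/forall_inP. Qed.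

Definition hprob w : R := (hcount w)%:R / #|tclass|%:R.

Lemma tclass_gt0 : 0 < #|tclass|%:R :> R.
Proof. by rewrite ltr0n; apply/card_gt0P; exists p0; apply: tclass_self. Qed.

Lemma hprob_ge0 w : 0 <= hprob w.
Proof. by rewrite divr_ge0 ?ler0n. Qed.

Lemma hprob_y : hprob y = 1.
Proof. by rewrite /hprob hcount_y divff // gt_eqF // tclass_gt0. Qed.

Lemma hprob_anc w : w \in A -> w != y -> hprob w = 0.
Proof. by move=> wA wy; rewrite /hprob hcount_anc // mul0r. Qed.

Lemma hprob_harmonic w : w \notin A ->
  #|D|%:R * hprob w = \sum_i oapp hprob 0 (nb w i).
Proof.
move=> wA; rewrite /hprob mulrA -natrM harmonic // natr_sum mulr_suml.
by apply: eq_bigr => i _; case: (nb w i) => [u|] //=; rewrite mul0r.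
Qed.

Variable Pos : {set D}.
Hypothesis revPos : forall i, (rev i \in Pos) = (i \notin Pos).

(** Summation by parts, with value 0 at the sink: the energy is at most the sum of [h] times its
    Laplacian. Off the path of [y] the function is harmonic; on the path it vanishes except at [y],
    where the term is at most the degree. *)
Lemma hprob_energy :
  \sum_(x : X) \sum_(i in Pos) oapp (fun u => (hprob u - hprob x) ^+ 2) 0 (nb x i) <= #|D|%:R.
Proof.
pose h := hprob; pose hn x i := oapp h 0 (nb x i).
apply: (@le_trans _ _ (\sum_x \sum_i h x * (h x - hn x i))); last first.
  rewrite (bigD1 y) //= [X in _ + X]big1 ?addr0; last first.
    move=> x xy; have [xA|xA] := boolP (x \in A).
      by rewrite big1 // => i _; rewrite /h hprob_anc // mul0r.
    rewrite -mulr_sumr sumrB sumr_const -hprob_harmonic //.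
    by rewrite mulr_natl cardT -cardE subrr mulr0.
  rewrite -sumr_const; apply: ler_sum => i _; rewrite /h hprob_y mul1r /hn.
  by case: (nb y i) => [u|] /=; rewrite lerBlDr lerDl ?hprob_ge0.
have -> : \sum_x \sum_(i in Pos) oapp (fun u => (hprob u - hprob x) ^+ 2) 0 (nb x i) =
  \sum_x \sum_i oapp (fun u => h x * (h x - h u)) 0 (nb x i).
  rewrite pair_big /= pair_big /=.
  (* [io] reverses an edge and so pairs the directions outside of [Pos] with those in [Pos]; exits
     to the sink are its fixed points. *)
  pose io (z : X * D) := if nb z.1 z.2 is Some u then (u, rev z.2) else z.
  have ioK : involutive io.
    move=> [x i]; rewrite /io /=; case E: (nb x i) => [u|] /=; last by rewrite E.
    by rewrite (nb_rev E) revK.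
  pose F (z : X * D) := oapp (fun u => h z.1 * (h z.1 - h u)) 0 (nb z.1 z.2).
  transitivity (\sum_(z | z.2 \in Pos) F z + \sum_(z | z.2 \notin Pos) F z); last first.
    by rewrite [RHS](bigID (fun z : X * D => z.2 \in Pos)).
  have -> : \sum_(z | z.2 \notin Pos) F z =
     \sum_(z | z.2 \in Pos) oapp (fun u => h u * (h u - h z.1)) 0 (nb z.1 z.2).
    rewrite (bigID (fun z => nb z.1 z.2 == None)) /= big1 ?add0r; last first.
      by move=> z /andP[_ /eqP E]; rewrite /F E.
    rewrite [RHS](bigID (fun z => nb z.1 z.2 == None)) /= [X in _ = X + _]big1 ?add0r; last first.
      by move=> z /andP[_ /eqP E]; rewrite E.
    rewrite (reindex_inj (inv_inj ioK)) /=; apply: eq_big => -[x i]; rewrite /io /F /=.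
      case E: (nb x i) => [u|] /=; last by rewrite E !andbF.
      by rewrite (nb_rev E) /= revPos negbK.
    by case E: (nb x i) => [u|] /=; rewrite ?E ?(nb_rev E) //= andbF.
  rewrite -big_split /=; apply: eq_big => [[x i]|[x i] _] //=.
  by rewrite /F /=; case: (nb x i) => [u|] /=; rewrite ?addr0 // /h; ring.
apply: ler_sum => x _; apply: ler_sum => i _; rewrite /hn.
by case: (nb x i) => [u|] //=; rewrite subr0 mulr_ge0 ?hprob_ge0.
Qed.

End Class.
End Harmonic.

(** * A Poincare inequality on tiles *)

Lemma sqr_sum_le (F : realFieldType) (I : finType) (P : pred I) (a : I -> F) :
  (\sum_(i | P i) a i) ^+ 2 <= (\sum_(i | P i) 1) * \sum_(i | P i) a i ^+ 2.
Proof.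
have : 0 <= \sum_(i | P i) \sum_(j | P j) (a i - a j) ^+ 2.
  by apply: sumr_ge0 => i _; apply: sumr_ge0 => j _; apply: sqr_ge0.
have -> : \sum_(i | P i) \sum_(j | P j) (a i - a j) ^+ 2 =
   2 * ((\sum_(i | P i) 1) * (\sum_(i | P i) a i ^+ 2) - (\sum_(i | P i) a i) ^+ 2).
  have E i : \sum_(j | P j) (a i - a j) ^+ 2 = a i ^+ 2 * (\sum_(j | P j) 1)
       - 2 * a i * (\sum_(j | P j) a j) + \sum_(j | P j) a j ^+ 2.
    rewrite !mulr_sumr -sumrB -big_split /=; apply: eq_bigr => j _; ring.
  under eq_bigr do rewrite E.
  rewrite big_split /= sumrB -!mulr_suml -mulr_sumr.
  set S1 := \sum_(i | P i) 1; set S := \sum_(i | P i) a i; set Q := \sum_(i | P i) a i ^+ 2.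
  have -> : \sum_(i | P i) Q = S1 * Q by rewrite mulr_suml; apply: eq_bigr => i _; rewrite mul1r.
  by ring.
by rewrite pmulr_rge0 ?subr_ge0 // ltr0n.
Qed.

Section Box.
Variables (d n : nat) (F : realFieldType).
Local Notation X := {ffun 'I_d -> 'I_n.+1}.
Local Notation D := ('I_d * bool)%type.
Implicit Types (x y z a w : X) (i k : 'I_d).

Definition setc x i (c : 'I_n.+1) : X := [ffun k => if k == i then c else x k].

Definition nbox x (e : D) : option X :=
  if e.2 then (if (x e.1 < n)%N then Some (setc x e.1 (inord (x e.1).+1)) else None)
  else (if (0 < x e.1)%N then Some (setc x e.1 (inord (x e.1).-1)) else None).

Definition revbox (e : D) : D := (e.1, ~~ e.2).
Definition posbox : {set D} := [set e | e.2].

Lemma revboxK : involutive revbox. Proof. by case=> i b; rewrite /revbox /= negbK. Qed.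

Lemma revbox_pos e : (revbox e \in posbox) = (e \notin posbox).
Proof. by rewrite !inE. Qed.

Lemma setc_id x i : setc x i (x i) = x.
Proof. by apply/ffunP => k; rewrite ffunE; case: eqP => [->|]. Qed.

Lemma setc_setc x i c c' : setc (setc x i c) i c' = setc x i c'.
Proof. by apply/ffunP => k; rewrite !ffunE; case: eqP. Qed.

Lemma setc_at x i c : setc x i c i = c. Proof. by rewrite ffunE eqxx. Qed.

Lemma nbox_rev x e y : nbox x e = Some y -> nbox y (revbox e) = Some x.
Proof.
case: e => i [] /=; rewrite /nbox /=; case: ifP => // lt [<-]; rewrite setc_at inordK //=.
- by rewrite setc_setc inord_val setc_id.
- rewrite ifT; last by have := ltn_ord (x i); lia.
  by rewrite setc_setc prednK // inord_val setc_id.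
- by have := ltn_ord (x i); lia.
Qed.

Section Tile.
Variable b : nat.
Hypotheses (b0 : (0 < b)%N) (bn : (b %| n.+1)%N).

(** The aligned cube of side [b] that contains [y]; as [b] divides the side of the box, all these
    cubes are complete. *)
Definition tile y : {set X} := [set x : X | [forall i, x i %/ b == y i %/ b]%N].

Definition blk (c : 'I_n.+1) : {set 'I_n.+1} := [set c' : 'I_n.+1 | c' %/ b == c %/ b]%N.

Lemma tileP y x : reflect (forall i, (x i %/ b = y i %/ b)%N) (x \in tile y).
Proof. by rewrite inE; apply: (iffP forallP) => H i; apply/eqP. Qed.

Lemma card_blk c : #|blk c| = b.
Proof.
pose q := (c %/ b)%N.
have lt (k : 'I_b) : (q * b + k < n.+1)%N.
  have lq : (q < n.+1 %/ b)%N.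
    by rewrite ltn_divRL // /q; apply: leq_ltn_trans (leq_trunc_div _ _) (ltn_ord c).
  by rewrite -(divnK bn); have := ltn_ord k; nia.
rewrite -[RHS]card_ord -[RHS](@card_imset _ _ (fun k : 'I_b => Ordinal (lt k))); last first.
  by move=> k k' /(congr1 val) /= /addnI /val_inj.
apply: eq_card => c'; rewrite inE; apply/eqP/imsetP => [E|[k _ ->]].
  by exists (Ordinal (ltn_pmod c' b0)) => //; apply: val_inj; rewrite /= /q -E -divn_eq.
by rewrite /= divnMDl // divn_small ?addn0.
Qed.

Lemma card_tile y : #|tile y| = (b ^ d)%N.
Proof.
rewrite [LHS](card_ffun_forall (fun (i : 'I_d) (c : 'I_n.+1) => c %/ b == y i %/ b)%N).
rewrite (eq_bigr (fun=> b)); first by rewrite prod_nat_const card_ord.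
by move=> i _; rewrite -[RHS](card_blk (y i)); apply: eq_card => c; rewrite inE.
Qed.

Lemma setc_tile y a i c : a \in tile y -> c \in blk (y i) -> setc a i c \in tile y.
Proof.
move=> /tileP aT; rewrite inE => /eqP cb; apply/tileP => k; rewrite ffunE.
by case: eqP => [->|].
Qed.

Lemma tile_refl y : y \in tile y. Proof. exact/tileP. Qed.

Lemma tile_eq y z : z \in tile y -> tile z = tile y.
Proof.
move=> /tileP E; apply/setP => x; apply/tileP/tileP => H i; first by rewrite H E.
by rewrite H -E.
Qed.

(** The pointers move a coordinate that differs from that of [v] by one unit towards it; [i0] is
    only the default of the choice. *)
Lemma conn_tile (i0 : 'I_d) y : conn nbox (tile y).
Proof.
pose ii (v x : X) := odflt i0 [pick i | x i != v i].
pose tw (v x : X) : D := (ii v x, (x (ii v x) < v (ii v x))%N).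
pose r (v x : X) := (\sum_i `|(x i)%:Z - (v i)%:Z|%N)%N.
suff main (v x : X) : v \in tile y -> x \in tile y -> x != v ->
    exists2 z, nbox x (tw v x) = Some z & (z \in tile y) && (r v z < r v x)%N.
  by move=> v vT; exists (tw v), (r v) => x; apply: main.
move=> /tileP vT /tileP xT xv.
have iiP : x (ii v x) != v (ii v x).
  rewrite /ii; case: pickP => [//|E]; move: xv; apply: contraNneq => _ /=.
  by apply/eqP/ffunP => k; apply/eqP/negPn; rewrite E.
set i := ii v x in iiP.
have neq : (x i != v i :> nat) by apply: contra iiP => /eqP/val_inj ->.
have key (c : 'I_n.+1) : (`|c%:Z - (v i)%:Z| < `|(x i)%:Z - (v i)%:Z|)%N -> (c %/ b = y i %/ b)%N ->
    (setc x i c \in tile y) && (r v (setc x i c) < r v x)%N.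
  move=> lt E; apply/andP; split.
    by apply/tileP => k; rewrite ffunE; case: eqP => [->|].
  rewrite /r (bigD1 i) //= [X in (_ < X)%N](bigD1 i) //= setc_at -addSn.
  apply: leq_add => //; apply: leq_sum => k ki; by rewrite ffunE (negbTE ki).
have ltx := ltn_ord (x i); have ltv := ltn_ord (v i).
rewrite /nbox /tw /= -/i; case: (ltnP (x i) (v i)) => cmp.
  rewrite ifT; last by lia.
  exists (setc x i (inord (x i).+1)) => //; apply: key; rewrite inordK; try lia.
  have h1 : (x i %/ b <= (x i).+1 %/ b)%N by apply: leq_div2r.
  have h2 : ((x i).+1 %/ b <= v i %/ b)%N by apply: leq_div2r.
  by move: h1 h2; rewrite xT vT; lia.
rewrite ifT; last by lia.
exists (setc x i (inord (x i).-1)) => //; apply: key; rewrite inordK; try lia.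
have h1 : ((x i).-1 %/ b <= x i %/ b)%N by apply: leq_div2r; lia.
have h2 : (v i %/ b <= (x i).-1 %/ b)%N by apply: leq_div2r; lia.
by move: h1 h2; rewrite xT vT; lia.
Qed.

End Tile.

Lemma card_slab b b' y i : (0 < b)%N -> (0 < b')%N -> (b %| n.+1)%N -> (b' %| n.+1)%N ->
  (#|[set x : X in tile b y | x i %/ b' == y i %/ b']%N| <= b' * b ^ d.-1)%N.
Proof.
move=> b0 b'0 bn b'n.
pose C (k : 'I_d) (c : 'I_n.+1) := if k == i then (c %/ b' == y k %/ b')%N else (c %/ b == y k %/ b)%N.
apply: (@leq_trans #|[set x : X | [forall k, C k (x k)]]|).
  apply: subset_leq_card; apply/subsetP => x; rewrite !inE => /andP[/forallP xT xi].
  by apply/forallP => k; rewrite /C; case: eqP => [->|_].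
rewrite card_ffun_forall (bigD1 i) //=; apply: leq_mul.
  rewrite -(card_blk b'0 b'n (y i)); apply: subset_leq_card; apply/subsetP => c.
  by rewrite inE unfold_in /C eqxx.
rewrite (eq_bigr (fun=> b)).
  by rewrite prod_nat_const cardC1 card_ord.
move=> k ki; rewrite -(card_blk b0 bn (y k)); apply: eq_card => c.
by rewrite inE unfold_in /C (negbTE ki).
Qed.

(* These points walk from a to w by changing one coordinate after the other. *)
Definition hyb (m : nat) a w : X := [ffun k : 'I_d => if (k < m)%N then w k else a k].

Lemma hyb0 a w : hyb 0 a w = a.
Proof. by apply/ffunP => k; rewrite ffunE. Qed.

Lemma hybd a w : hyb d a w = w.
Proof. by apply/ffunP => k; rewrite ffunE ltn_ord. Qed.

Lemma hybS (i : 'I_d) a w : hyb i.+1 a w = setc (hyb i a w) i (w i).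
Proof.
apply/ffunP => k; rewrite !ffunE ltnS leq_eqVlt.
by case: (eqVneq k i) => [->|ki] /=; rewrite ?eqxx // -[(k == i :> nat)]/(k == i) (negbTE ki).
Qed.

Lemma hybI (i : 'I_d) a w : hyb i a w = setc (hyb i a w) i (a i).
Proof.
apply/ffunP => k; rewrite !ffunE; case: (eqVneq k i) => [->|//].
by rewrite ltnn.
Qed.

(** Exchanging the first [m] coordinates thus permutes the pairs [(a, w)], which is how the walks
    through a given point are counted. *)
Lemma hyb_swap m a w : hyb m (hyb m a w) (hyb m w a) = a.
Proof. by apply/ffunP => k; rewrite !ffunE; case: (k < m)%N. Qed.

Section Poincare.
Variables (b b' : nat) (y : X) (h : X -> F).
Hypotheses (d2 : (1 < d)%N) (b0 : (0 < b)%N) (bn : (b %| n.+1)%N).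
Let B := tile b y.

Definition grad z i : F := oapp (fun u => (h u - h z) ^+ 2) 0 (nbox z (i, true)).

Lemma grad_ge0 z i : 0 <= grad z i.
Proof. by rewrite /grad; case: (nbox _ _) => [u|] //=; rewrite sqr_ge0. Qed.

Lemma line_poincare z i (u v : 'I_n.+1) : u \in blk b (y i) -> v \in blk b (y i) ->
  (h (setc z i v) - h (setc z i u)) ^+ 2 <= b%:R * \sum_(c in blk b (y i)) grad (setc z i c) i.
Proof.
wlog uv : u v / (u <= v)%N => [H|] ub vb.
  case: (leqP u v) => [/H|/ltnW /H]; first exact.
  by rewrite -[X in X ^+ 2]opprB sqrrN; apply.
pose f (c : nat) := h (setc z i (inord c)).
have -> : h (setc z i v) - h (setc z i u) = \sum_(c < n.+1 | (u <= c < v)%N) (f c.+1 - f c).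
  transitivity (\sum_(u <= c < v) (f c.+1 - f c)).
    by rewrite telescope_sumr // /f !inord_val.
  rewrite (big_nat_widen _ _ n.+1) 1?ltnW // big_geq_mkord /=.
  by apply: eq_bigl => c; rewrite andbC.
apply: le_trans (sqr_sum_le _ _) _.
have sub (c : 'I_n.+1) : (u <= c < v)%N -> c \in blk b (y i) /\ (c < n)%N.
  move=> /andP[uc cv]; split; last by have := ltn_ord v; lia.
  move: ub vb; rewrite !inE => /eqP ub /eqP vb.
  have h1 : (u %/ b <= c %/ b)%N by apply: leq_div2r.
  have h2 : (c %/ b <= v %/ b)%N by apply: leq_div2r; apply: ltnW.
  by apply/eqP; lia.
apply: ler_pM; first by rewrite sumr_ge0.
- by apply: sumr_ge0 => c _; apply: sqr_ge0.
- rewrite sumr_const ler_nat -(card_blk b0 bn (y i)).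
  by apply: subset_leq_card; apply/subsetP => c /sub[].
rewrite [leRHS](bigID (fun c : 'I_n.+1 => (u <= c < v)%N)) /=.
apply: le_trans (_ : \sum_(c in blk b (y i) | (u <= c < v)%N) grad (setc z i c) i <= _); last first.
  by rewrite lerDl sumr_ge0 // => c _; apply: grad_ge0.
rewrite le_eqVlt; apply/orP; left; apply/eqP; apply: eq_big => c.
  by case: (boolP (u <= c < v)%N) => [/sub[->]|]; rewrite ?andbF.
move=> /sub[_ cn]; rewrite /grad /nbox /= setc_at cn /= setc_setc /f.
by rewrite inord_val.
Qed.

(** Asking this of every coordinate, and not only that [x] lies off the inner tile, keeps the
    coordinatewise walks between two such points off the inner tile. *)
Definition far : {set X} := [set x : X in B | [forall k, x k %/ b' != y k %/ b']%N].

Lemma far_tile x : x \in far -> x \in B. Proof. by rewrite inE => /andP[]. Qed.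
Lemma far_neq x k : x \in far -> (x k %/ b' != y k %/ b')%N.
Proof. by rewrite inE => /andP[_ /forallP]. Qed.

Lemma hyb_tile m a w : a \in B -> w \in B -> hyb m a w \in B.
Proof.
by move=> /tileP aB /tileP wB; apply/tileP => k; rewrite ffunE; case: ifP.
Qed.

(** Join [a] to [w] by the coordinatewise walk. Its segments avoid the inner tile, and for each
    direction a permutation of the pairs [(a, w)] shows that all points of [B] are used equally
    often. *)
Lemma poincare :
  \sum_(a in far) \sum_(w in far) (h w - h a) ^+ 2 <=
  d%:R * b%:R ^+ 2 * #|B|%:R * \sum_(z in B :\: tile b' y) \sum_i grad z i.
Proof.
pose g i z : F := if z \in B :\: tile b' y then grad z i else 0.
have g0 i z : 0 <= g i z by rewrite /g; case: ifP => // _; apply: grad_ge0.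
have step a w (i : 'I_d) : a \in far -> w \in far ->
    (h (hyb i.+1 a w) - h (hyb i a w)) ^+ 2 <=
    b%:R * \sum_(c in blk b (y i)) g i (setc (hyb i a w) i c).
  move=> aA wA; have aB := far_tile aA; have wB := far_tile wA.
  rewrite hybS [in X in _ - X](hybI i a w).
  apply: le_trans (line_poincare _ _ _) _.
  - by move/tileP: aB => /(_ i) E; rewrite inE E.
  - by move/tileP: wB => /(_ i) E; rewrite inE E.
  rewrite ler_wpM2l ?ler0n // le_eqVlt; apply/orP; left; apply/eqP.
  apply: eq_bigr => c cb.
  have zB : setc (hyb i a w) i c \in B by apply: setc_tile => //; apply: hyb_tile.
  rewrite /g ifT // in_setD zB andbT.
  (* While coordinate [i] moves, another coordinate [k], available in dimension at least 2, is that
     of [a] or of [w] and stays far from [y]. *)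
  have [k ki] : exists k : 'I_d, k != i.
    have [E|NE] := eqVneq (i : nat) 0%N.
      by exists (Ordinal d2); apply/eqP => /(congr1 val) /=; rewrite E.
    by exists (Ordinal (ltnW d2)); apply: contra NE => /eqP <-.
  apply/negP => /tileP/(_ k); rewrite !ffunE (negbTE ki); apply/eqP.
  by case: ifP => _; apply: far_neq.
have tel a w : h w - h a = \sum_(i < d) (h (hyb i.+1 a w) - h (hyb i a w)).
  by rewrite -(big_mkord xpredT (fun i : nat => h (hyb i.+1 a w) - h (hyb i a w))) telescope_sumr // hybd hyb0.
have sw (i : 'I_d) : \sum_(a in B) \sum_(w in B) \sum_(c in blk b (y i)) g i (setc (hyb i a w) i c) =
   #|B|%:R * (b%:R * \sum_(z in B) g i z).
  rewrite pair_big /=.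
  pose sg (z : X * X) := (hyb i z.1 z.2, hyb i z.2 z.1).
  have sgK : involutive sg by case=> a w; rewrite /sg /= !hyb_swap.
  rewrite (reindex_inj (inv_inj sgK)) /=.
  rewrite (eq_big (fun z : X * X => (z.1 \in B) && (z.2 \in B))
     (fun z : X * X => \sum_(c in blk b (y i)) g i (setc z.1 i c))); last first.
  - by case=> a w _; rewrite /sg /= hyb_swap.
  - case=> a w; rewrite /sg /=; apply/andP/andP => -[h1 h2].
      by split; [rewrite -(hyb_swap i a w)|rewrite -(hyb_swap i w a)]; apply: hyb_tile.
    by split; apply: hyb_tile.
  rewrite -(pair_big (mem B) (mem B) (fun a w => \sum_(c in blk b (y i)) g i (setc a i c))) /=.
  under eq_bigr do rewrite sumr_const -mulr_natl.
  rewrite -mulr_sumr; congr (_ * _).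
  rewrite pair_big /=.
  (* Exchanging coordinate [i] with the summation index replaces the moving point by a free point of
     [B]; the index then contributes the factor [b]. *)
  pose sh (z : X * 'I_n.+1) := (setc z.1 i z.2, z.1 i).
  have shK : involutive sh by case=> a c; rewrite /sh /= setc_setc setc_at setc_id.
  rewrite (reindex_inj (inv_inj shK)) /=.
  rewrite (eq_big (fun z : X * 'I_n.+1 => (z.1 \in B) && (z.2 \in blk b (y i)))
     (fun z : X * 'I_n.+1 => g i z.1)); last first.
  - by case=> a c _; rewrite /sh /= setc_setc setc_id.
  - case=> a c; rewrite /sh /=; apply/andP/andP => -[h1 h2]; last first.
      by rewrite setc_tile //; split=> //; move/tileP: h1 => /(_ i) E; rewrite inE E.
    split; last by move/tileP: h1 => /(_ i); rewrite setc_at inE => ->.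
    by rewrite -(setc_id a i) -(setc_setc a i c); apply: setc_tile.
  rewrite -(pair_big (mem B) (mem (blk b (y i))) (fun z _ => g i z)) /=.
  by rewrite mulr_sumr; apply: eq_bigr => z _; rewrite sumr_const card_blk // mulr_natl.
apply: (@le_trans _ _ (\sum_(a in far) \sum_(w in far)
   (d%:R * \sum_(i < d) b%:R * \sum_(c in blk b (y i)) g i (setc (hyb i a w) i c)))).
  apply: ler_sum => a aA; apply: ler_sum => w wA; rewrite tel.
  apply: le_trans (sqr_sum_le _ _) _.
  rewrite sumr_const card_ord ler_wpM2l ?ler0n //.
  by apply: ler_sum => i _; apply: step.
apply: (@le_trans _ _ (\sum_(a in B) \sum_(w in B)
   (d%:R * \sum_(i < d) b%:R * \sum_(c in blk b (y i)) g i (setc (hyb i a w) i c)))).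
  have nn a w : 0 <= d%:R * \sum_(i < d) b%:R * \sum_(c in blk b (y i)) g i (setc (hyb i a w) i c).
    rewrite mulr_ge0 ?ler0n // sumr_ge0 // => i _; rewrite mulr_ge0 ?ler0n //.
    by rewrite sumr_ge0.
  have sub (f : X -> F) : (forall x, 0 <= f x) -> \sum_(x in far) f x <= \sum_(x in B) f x.
    move=> f0; rewrite [leLHS]big_mkcond [leRHS]big_mkcond; apply: ler_sum => x _.
    by case: (boolP (x \in far)) => [/far_tile ->|_] //; case: ifP.
  apply: le_trans (sub _ _) _; first by move=> x; apply: sumr_ge0.
  by apply: ler_sum => a _; apply: sub.
under eq_bigr do rewrite -mulr_sumr; rewrite -mulr_sumr.
rewrite -!mulrA ler_wpM2l ?ler0n //.
under eq_bigr do rewrite exchange_big /=.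
rewrite exchange_big /=.
under eq_bigr => i _ do under eq_bigr do rewrite -mulr_sumr.
under eq_bigr => i _ do rewrite -mulr_sumr sw.
rewrite exchange_big /= !mulr_sumr le_eqVlt; apply/orP; left; apply/eqP; apply: eq_bigr => i _.
have -> : \sum_(z in B) g i z = \sum_(z in B :\: tile b' y) grad z i.
  rewrite /g -big_mkcondr /=; apply: eq_bigl => z; rewrite !inE.
  by case: [forall _, _]; rewrite ?andbF ?andbT //=; rewrite andbC andbA andbb andbC.
by ring.
Qed.

End Poincare.
End Box.

(** * Large pasts are rare in a box *)

Section ClassAverage.
Variables (X D : finType) (nb : X -> D -> option X) (R : realFieldType).
Local Notation tree := (tree nb).
Local Notation tclass := (tclass nb).

Lemma tclass_eq p0 p y : tree p0 -> p \in tclass p0 y -> tclass p y = tclass p0 y.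
Proof.
move=> tp0 pC; apply/setP => q; rewrite !inE; congr (_ && _).
have E x : (x \in anc nb p y) = (x \in anc nb p0 y).
  by rewrite [LHS]inE; apply: tclass_anc.
have ag x : x \in anc nb p0 y -> p x = p0 x.
  by move=> xA; move: pC; rewrite inE => /andP[_ /forall_inP/(_ x xA)/eqP].
apply/forall_inP/forall_inP => H x xA; first by rewrite -ag // H ?E.
by rewrite ag -?E // H -?E.
Qed.

(** The classes partition the trees; spreading each value of [G] evenly over its class turns the sum
    over trees into sums over classes. *)
Lemma tclass_average (y : X) (G : {ffun X -> D} -> R) (c : R) :
  (forall p0, tree p0 -> \sum_(p in tclass p0 y) G p <= c * #|tclass p0 y|%:R) ->
  \sum_(p | tree p) G p <= c * #|[set p | tree p]|%:R.
Proof.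
move=> H.
have pos p : tree p -> 0 < #|tclass p y|%:R :> R by move=> tp; apply: tclass_gt0.
have -> : \sum_(p | tree p) G p =
    \sum_(p | tree p) \sum_(p0 | tree p0 && (p0 \in tclass p y)) G p / #|tclass p y|%:R.
  apply: eq_bigr => p tp.
  rewrite (eq_bigl (fun p0 => p0 \in tclass p y)); last first.
    by move=> p0; apply/andP/idP => [[]//|h]; split=> //; move: h; rewrite inE => /andP[].
  by rewrite sumr_const -[RHS]mulr_natr divfK // gt_eqF ?pos.
rewrite (exchange_big_dep tree) /=; last by move=> p p0 _ /andP[].
rewrite mulr_natr cardsE -sumr_const; apply: ler_sum => p0 tp0.
have sym p : tree p -> (p0 \in tclass p y) = (p \in tclass p0 y).
  move=> tp; apply/idP/idP => h; first by rewrite (tclass_eq tp h) tclass_self.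
  by rewrite (tclass_eq tp0 h) tclass_self.
rewrite (eq_bigl (fun p => p \in tclass p0 y)); last first.
  move=> p; apply/andP/idP => [[tp]|h]; first by rewrite tp0 sym.
  have tp : tree p by move: h; rewrite inE => /andP[].
  by rewrite tp0 sym.
rewrite (eq_bigr (fun p => G p / #|tclass p0 y|%:R)); last first.
  by move=> p h; rewrite (tclass_eq tp0 h).
by rewrite -mulr_suml ler_pdivrMr ?pos ?H.
Qed.

End ClassAverage.

Section Average.
Variables (d n : nat).
Hypothesis d2 : (1 < d)%N.
Local Notation F := rat.
Local Notation X := {ffun 'I_d -> 'I_n.+1}.
Local Notation D := ('I_d * bool)%type.
Local Notation nb := (@nbox d n).
Local Notation tree := (tree nb).
Local Notation past := (past nb).
Local Notation anc := (anc nb).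
Local Notation big := (big nb).
Local Notation tau := (#|[set p : {ffun X -> D} | tree p]|%:R : F).

Let i0 : 'I_d := Ordinal (ltnW d2).
Let cardD : #|{: D}| = (d * 2)%N. Proof. by rewrite card_prod card_ord card_bool. Qed.

(* the number of chains a -> y -> b of the tree order with a, b in B *)
Definition spread p (B : {set X}) y := (#|past p y :&: B| * #|anc p y :&: B|)%N.

(** [Q :&: B] is totally ordered, so every triple of its sites is a chain in at least one of its 6
    orders. *)
Lemma chain_triples p (Q B : {set X}) :
  (forall x y, x \in Q :&: B -> y \in Q :&: B -> connect (st nb p) x y || connect (st nb p) y x) ->
  (#|Q :&: B| ^ 3 <= 6 * \sum_(y in B) spread p B y)%N.
Proof.
set C := Q :&: B => tot.
pose le x y := connect (st nb p) x y : bool.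
pose ch (x y z : X) := le x y && le y z : nat.
have tr x y z : le x y -> le y z -> le x z by apply: connect_trans.
have cube : (#|C| ^ 3 = \sum_(x in C) \sum_(y in C) \sum_(z in C) 1)%N.
  by under eq_bigr do under eq_bigr do rewrite sum1_card; rewrite !sum_nat_const; ring.
have T : (\sum_(x in C) \sum_(y in C) \sum_(z in C) ch x y z <= \sum_(y in B) spread p B y)%N.
  rewrite exchange_big /=.
  apply: (@leq_trans (\sum_(y in C) spread p B y)); last first.
    rewrite [leqLHS]big_mkcond [leqRHS]big_mkcond; apply: leq_sum => y _.
    by case: (boolP (y \in C)) => [/setIP[_ ->]|_] //; case: ifP.
  apply: leq_sum => y yC.
  have -> : (\sum_(x in C) \sum_(z in C) ch x y z =
     (\sum_(x in C) le x y) * (\sum_(z in C) le y z))%N.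
    rewrite big_distrlr /=; apply: eq_bigr => x _; apply: eq_bigr => z _.
    by rewrite /ch mulnb.
  have cnt (A : {set X}) (P : pred X) : (\sum_(x in C) P x <= #|[set x | P x] :&: B|)%N.
    rewrite -sum1_card [leqLHS]big_mkcond [leqRHS]big_mkcond; apply: leq_sum => x _.
    by rewrite !inE; case: (x \in Q); case: (x \in B); case: (P x).
  by apply: leq_mul; apply: cnt.
apply: leq_trans (_ : 6 * (\sum_(x in C) \sum_(y in C) \sum_(z in C) ch x y z) <= _)%N; last first.
  by rewrite leq_mul2l T orbT.
rewrite cube.
have E1 : (\sum_(x in C) \sum_(y in C) \sum_(z in C) ch x z y = \sum_(x in C) \sum_(y in C) \sum_(z in C) ch x y z)%N.
  by apply: eq_bigr => x _; rewrite exchange_big.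
have E2 : (\sum_(x in C) \sum_(y in C) \sum_(z in C) ch y x z = \sum_(x in C) \sum_(y in C) \sum_(z in C) ch x y z)%N.
  by rewrite exchange_big.
have E3 : (\sum_(x in C) \sum_(y in C) \sum_(z in C) ch y z x = \sum_(x in C) \sum_(y in C) \sum_(z in C) ch x y z)%N.
  rewrite exchange_big /=; apply: eq_bigr => x _; by rewrite exchange_big.
have E4 : (\sum_(x in C) \sum_(y in C) \sum_(z in C) ch z x y = \sum_(x in C) \sum_(y in C) \sum_(z in C) ch x y z)%N.
  by rewrite -E2; apply: eq_bigr => x _; rewrite exchange_big.
have E5 : (\sum_(x in C) \sum_(y in C) \sum_(z in C) ch z y x = \sum_(x in C) \sum_(y in C) \sum_(z in C) ch x y z)%N.
  by rewrite -E3; apply: eq_bigr => x _; rewrite exchange_big.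
have pt x y z : x \in C -> y \in C -> z \in C ->
    (1 <= ch x y z + ch x z y + ch y x z + ch y z x + ch z x y + ch z y x)%N.
  move=> xC yC zC; have := tot _ _ xC yC; have := tot _ _ xC zC; have := tot _ _ yC zC.
  rewrite -!/(le _ _) /ch; move: (le x y) (le y x) (le x z) (le z x) (le y z) (le z y).
  by do 6!case.
apply: leq_trans (_ : \sum_(x in C) \sum_(y in C) \sum_(z in C)
    (ch x y z + ch x z y + ch y x z + ch y z x + ch z x y + ch z y x) <= _)%N.
  by do 3![apply: leq_sum => ? ?]; apply: pt.
under eq_bigr do under eq_bigr do rewrite !big_split /=.
under eq_bigr do rewrite !big_split /=.
by rewrite !big_split /= E1 E2 E3 E4 E5 5!mulSn mul1n !addnA.
Qed.

Definition bad b L (p : {ffun X -> D}) x :=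
  [exists u in tile b x, exists w in tile b x,
    [&& u \in big p L, w \in big p L, ~~ connect (st nb p) u w & ~~ connect (st nb p) w u]].

Lemma card_agree_off (B : {set X}) (q : {ffun X -> D}) :
  #|[set p : {ffun X -> D} | [forall x in ~: B, q x == p x]]| = (#|{: D}| ^ #|B|)%N.
Proof.
rewrite (_ : [set _ | _] = [set p : {ffun X -> D} | [forall x, (x \in ~: B) ==> (q x == p x)]]); last first.
  by apply/setP => p; rewrite !inE.
rewrite (card_ffun_forall (fun x i => (x \in ~: B) ==> (q x == i))).
rewrite (bigID (mem B)) /= [X in (_ * X)%N]big1 ?muln1.
  rewrite (eq_bigr (fun=> #|{: D}|)) ?prod_nat_const // => x xB.
  by apply: eq_card => i; rewrite -topredE /= in_setC xB.
move=> x xB; rewrite -(card1 (q x)); apply: eq_card => i.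
by rewrite -topredE /= in_setC xB inE eq_sym.
Qed.

(** [funnel] charges a bad tile to a tree with a branching in that tile and the same pointers
    outside of it. At most [#|D| ^ v] trees share an image, a branching lies in the tile of [v]
    sites, and there are at most [#|X| / M] branchings. *)
Lemma bad_count b L M : (0 < b)%N -> (b %| n.+1)%N -> (0 < M)%N ->
  (b ^ d * (#|{: D}| * M).+1 < L)%N ->
  ((\sum_(p | tree p) \sum_x bad b L p x) * M <=
   #|{: D}| ^ (b ^ d) * (b ^ d) * (#|[set p : {ffun X -> D} | tree p]| * #|X|))%N.
Proof.
move=> b0 bn M0 Lbig; set v := (b ^ d)%N; set E := (#|{: D}| ^ v)%N.
have cv (x : X) : #|tile b x| = v by rewrite (card_tile b0 bn).
pose br q x := [exists z in tile b x, z \in branching nb q M].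
have one x : (\sum_(p | tree p) bad b L p x <= E * \sum_(q | tree q) br q x)%N.
  pose ag (p q : {ffun X -> D}) := [forall y in ~: tile b x, q y == p y].
  apply: (@leq_trans (\sum_(p | tree p) \sum_(q | tree q) (br q x && ag p q))).
    apply: leq_sum => p tp; case: (boolP (bad b L p x)) => // /exists_inP[u uT /exists_inP[w wT]].
    case/and4P; rewrite !inE => ub wb nuw nwu.
    have [||q [tq qp [z zT zb]]] := funnel (@nbox_rev d n) tp M0 (@conn_tile d n b b0 bn i0 x) uT wT _ _ nuw nwu.
    - by rewrite cv; apply: leq_trans Lbig ub.
    - by rewrite cv; apply: leq_trans Lbig wb.
    rewrite (bigD1 q) //= (_ : br q x && ag p q) //; apply/andP; split.
      by apply/exists_inP; exists z.
    by apply/forall_inP => y /qp ->.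
  rewrite exchange_big /= big_distrr /=; apply: leq_sum => q tq.
  case: (boolP (br q x)) => _ /=; last by rewrite big1.
  rewrite muln1 -[E](_ : #|[set p : {ffun X -> D} | ag p q]| = E); last first.
    by rewrite card_agree_off cv.
  rewrite -sum1_card [leqLHS]big_mkcond [leqRHS]big_mkcond; apply: leq_sum => p _.
  by rewrite inE; case: (ag p q); case: (tree p).
have two q : tree q -> ((\sum_x br q x) * M <= v * #|X|)%N.
  move=> tq; apply: leq_trans (_ : (v * #|branching nb q M|) * M <= _)%N; last first.
    by rewrite -mulnA leq_mul2l card_branching // orbT.
  rewrite leq_mul2r; apply/orP; right.
  apply: (@leq_trans (\sum_x \sum_(z in branching nb q M) (z \in tile b x))).
    apply: leq_sum => x _; case: (boolP (br q x)) => // /exists_inP[z zT zb].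
    by rewrite (bigD1 z) //= zT.
  rewrite exchange_big /= mulnC -sum_nat_const; apply: leq_sum => z _.
  rewrite -(cv z) -sum1_card [leqRHS]big_mkcond; apply: leq_sum => x _.
  case: (boolP (z \in tile b x)) => // zx.
  by rewrite (tile_eq zx) (tile_refl b x).
rewrite exchange_big /=.
apply: leq_trans (_ : (E * \sum_(q | tree q) \sum_x br q x) * M <= _)%N.
  rewrite leq_mul2r; apply/orP; right.
  rewrite [X in (_ <= _ * X)%N]exchange_big big_distrr /=.
  by apply: leq_sum => x _; apply: one.
rewrite -!mulnA leq_mul2l; apply/orP; right; rewrite big_distrl /= mulnCA cardsE -sum_nat_const.
by apply: leq_sum => q tq; apply: two.
Qed.

(** The cube of the number of large sites in a tile, given by [chain_triples], is bounded below by
    its tangent at [delta * v]: a linear bound can be summed over sites and trees. *)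
Lemma spread_lower b L p (delta : F) : (0 < b)%N -> (b %| n.+1)%N -> 0 <= delta ->
  ((b ^ d) ^ 2)%:R * (3 * delta ^+ 2 * #|big p L|%:R - 2 * delta ^+ 3 * #|X|%:R
     - \sum_x (bad b L p x)%:R) <= 6 * \sum_y (spread p (tile b y) y)%:R :> F.
Proof.
move=> b0 bn d0; set v := (b ^ d)%N.
have v0 : 0 < v%:R :> F by rewrite ltr0n expn_gt0 b0.
have cv (x : X) : #|tile b x| = v by rewrite (card_tile b0 bn).
pose q x := #|big p L :&: tile b x|.
have h1 x : (q x)%:R ^+ 3 - v%:R ^+ 3 * (bad b L p x)%:R <=
    6 * \sum_(y in tile b x) (spread p (tile b y) y)%:R :> F.
  have -> : \sum_(y in tile b x) (spread p (tile b y) y)%:R =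
      (\sum_(y in tile b x) spread p (tile b x) y)%:R :> F.
    by rewrite natr_sum; apply: eq_bigr => y /tile_eq ->.
  case: (boolP (bad b L p x)) => [_|nb].
    rewrite mulr1; apply: le_trans (_ : 0 <= _); last by rewrite mulr_ge0 ?ler0n.
    rewrite subr_le0 -!natrX ler_nat leq_exp2r // -(cv x).
    by apply: subset_leq_card; apply: subsetIr.
  rewrite mulr0 subr0 -natrX -natrM ler_nat; apply: chain_triples => u w.
  rewrite !inE => /andP[uQ uT] /andP[wQ wT]; apply/negPn/negP; rewrite negb_or => nuw.
  move: nb; apply/negP/negPn; apply/exists_inP; exists u; first by rewrite inE.
  by apply/exists_inP; exists w; rewrite !inE // uQ wQ.
have h2 x : 3 * (delta * v%:R) ^+ 2 * (q x)%:R - 2 * (delta * v%:R) ^+ 3 <= (q x)%:R ^+ 3 :> F.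
  set l := delta * v%:R; set t := (q x)%:R; rewrite -subr_ge0.
  have -> : t ^+ 3 - (3 * l ^+ 2 * t - 2 * l ^+ 3) = (t - l) ^+ 2 * (t + 2 * l) by ring.
  by rewrite mulr_ge0 ?sqr_ge0 // addr_ge0 ?ler0n // !mulr_ge0.
have swp (f : X -> F) : \sum_x \sum_(y in tile b x) f y = v%:R * \sum_y f y.
  rewrite mulr_sumr.
  under eq_bigr do rewrite big_mkcond; rewrite exchange_big /=; apply: eq_bigr => y _.
  rewrite -(cv y) -[RHS]/(_ * f y) mulr_natl -sumr_const [RHS]big_mkcond; apply: eq_bigr => x _.
  have -> : (x \in tile b y) = (y \in tile b x); last by [].
  by apply/idP/idP => /tile_eq ->; rewrite tile_refl.
have sq : \sum_x (q x)%:R = v%:R * #|big p L|%:R :> F.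
  rewrite -[#|big p L|]sum1_card [in RHS]natr_sum [in RHS]big_mkcond.
  rewrite -(swp (fun x => if x \in big p L then 1%:R else 0)); apply: eq_bigr => x _.
  rewrite /q -sum1_card natr_sum big_mkcond [RHS]big_mkcond; apply: eq_bigr => y _.
  by rewrite in_setI; case: (y \in big p L); case: (y \in tile b x).
rewrite -(ler_pM2l v0) [leRHS]mulrCA -(swp (fun y => (spread p (tile b y) y)%:R)).
apply: (@le_trans _ _ (6 * \sum_x \sum_(y in tile b x) (spread p (tile b y) y)%:R)) => //.
apply: (@le_trans _ _ (\sum_x (3 * (delta * v%:R) ^+ 2 * (q x)%:R - 2 * (delta * v%:R) ^+ 3
    - v%:R ^+ 3 * (bad b L p x)%:R))); last first.
  rewrite mulr_sumr; apply: ler_sum => x _; apply: le_trans (h1 x).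
  by rewrite lerB // h2.
have S2 : \sum_(x : X) 2 * (delta * v%:R) ^+ 3 = 2 * (delta * v%:R) ^+ 3 * #|X|%:R.
  by rewrite sumr_const -[LHS]mulr_natr.
rewrite !sumrB S2 -!mulr_sumr sq natrX.
by rewrite le_eqVlt; apply/orP; left; apply/eqP; ring.
Qed.

Lemma card_far b b' (y : X) : (0 < b)%N -> (0 < b')%N -> (b %| n.+1)%N -> (b' %| n.+1)%N ->
  (#|tile b y :\: far b b' y| <= d * (b' * b ^ d.-1))%N.
Proof.
move=> b0 b'0 bn b'n.
apply: (@leq_trans (\sum_(i < d) #|[set x : X in tile b y | x i %/ b' == y i %/ b']%N|)).
  apply: (@leq_trans #|\bigcup_(i < d) [set x : X in tile b y | x i %/ b' == y i %/ b']%N|).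
    apply: subset_leq_card; apply/subsetP => x; rewrite !inE => /andP[nf xT].
    move: nf; rewrite xT /= negb_forall => /existsP[i]; rewrite negbK => xi.
    by apply/bigcupP; exists i => //; rewrite !inE xT.
  elim/big_rec2: _ => [|i m A _ Am]; first by rewrite cards0.
  by apply: leq_trans (leq_card_setU _ _) _; rewrite leq_add2l.
apply: (@leq_trans (\sum_(i < d) b' * b ^ d.-1)); last by rewrite sum_nat_const card_ord.
by apply: leq_sum => i _; apply: card_slab.
Qed.

(** On the ancestors of [y] other than [y] the function [h] vanishes, so the Poincare inequality
    bounds the number of far ancestors times the sum of [h ^ 2]. The first term with [eta] pays for
    passing from [h ^ 2] to [h], the last term for the sites of the tile that are not far. *)
Lemma scale_upper b b' p0 (y : X) (eta : F) : tree p0 -> 0 < eta ->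
  (0 < b)%N -> (0 < b')%N -> (b %| n.+1)%N -> (b' %| n.+1)%N ->
  \sum_(p in tclass nb p0 y) (spread p (tile b y) y)%:R <=
  #|tclass nb p0 y|%:R * ((b ^ d)%:R ^+ 2 * eta / 2 +
     d%:R * (b ^ d)%:R ^+ 2 / (2 * eta) *
       \sum_(z in tile b y :\: tile b' y) \sum_i grad (hprob nb F p0 y) z i +
     2 * (b ^ d)%:R * (d * (b' * b ^ d.-1))%:R) :> F.
Proof.
move=> tp0 eta0 b0 b'0 bn b'n; set h := hprob nb F p0 y; set v := (b ^ d)%N.
set C := tclass nb p0 y.
set B := tile b y; set W := far b b' y; set A := anc p0 y.
set s := (d * (b' * b ^ d.-1))%N; set e := \sum_(z in B :\: _) _.
have cB : #|B| = v by rewrite (card_tile b0 bn).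
have WB : W \subset B by apply/subsetP => x /far_tile.
have slab : (#|B :\: W| <= s)%N by apply: card_far.
have split (S : {set X}) : (#|S :&: B| <= #|S :&: W| + s)%N.
  rewrite -(cardsID W); apply: leq_add.
    by apply: subset_leq_card; rewrite -setIA setIS // subsetIr.
  by apply: leq_trans slab; apply: subset_leq_card; rewrite setDE -setIA -setDE subsetIr.
have leB (S : {set X}) : (#|S :&: B| <= v)%N by rewrite -cB subset_leq_card ?subsetIr.
have leW (S : {set X}) : (#|S :&: W| <= v)%N.
  by apply: leq_trans (leB S); apply: subset_leq_card; apply: setIS.
have C0 : 0 < #|C|%:R :> F by apply: tclass_gt0.
have yW : y \notin W.
  by apply/negP => /(far_neq i0); rewrite eqxx.
have sumW : \sum_(p in C) #|past p y :&: W|%:R = #|C|%:R * \sum_(w in W) h w.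
  rewrite mulr_sumr.
  under eq_bigr do rewrite -sum1_card natr_sum big_mkcond.
  rewrite exchange_big [RHS]big_mkcond /=; apply: eq_bigr => w _.
  case: (boolP (w \in W)) => wW; last first.
    by rewrite big1 // => p _; rewrite in_setI (negbTE wW) andbF.
  rewrite /h /hprob mulrC divfK ?gt_eqF // /hcount -sum1_card natr_sum big_mkcond [RHS]big_mkcond.
  apply: eq_bigr => p _; rewrite in_setI wW andbT in_set.
  rewrite [w \in _]in_set -/C; case: (p \in C) => //=.
have poin : #|A :&: W|%:R * \sum_(w in W) h w ^+ 2 <= d%:R * b%:R ^+ 2 * v%:R * e.
  have P := poincare b' y h d2 b0 bn; rewrite -/B cB -/W -/e in P.
  apply: le_trans _ P; rewrite mulr_natl -sumr_const.
  apply: (@le_trans _ _ (\sum_(a in A :&: W) \sum_(w in W) (h w - h a) ^+ 2)).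
    apply: ler_sum => a /setIP[aA aW]; apply: ler_sum => w _.
    rewrite [h a]hprob_anc ?subr0 //; by apply: contraNneq yW => <-.
  rewrite [leLHS]big_mkcond [leRHS]big_mkcond; apply: ler_sum => a _.
  rewrite in_setI; case: (a \in W); rewrite ?andbT ?andbF //; case: ifP => // _.
  by apply: sumr_ge0 => w _; apply: sqr_ge0.
have e0 : 0 <= e by apply: sumr_ge0 => z _; apply: sumr_ge0 => i _; apply: grad_ge0.
(* The square of the side is at most the volume because the dimension is at least 2. *)
have bv : b%:R ^+ 2 <= v%:R :> F by rewrite -natrX ler_nat leq_pexp2l.
have main : #|A :&: W|%:R * \sum_(w in W) h w <=
     v%:R ^+ 2 * eta / 2 + d%:R * v%:R ^+ 2 / (2 * eta) * e.
  apply: (@le_trans _ _ (#|A :&: W|%:R * (v%:R * eta / 2 + (2 * eta)^-1 * \sum_(w in W) h w ^+ 2))).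
    rewrite ler_wpM2l ?ler0n //.
    apply: (@le_trans _ _ (\sum_(w in W) (eta / 2 + (2 * eta)^-1 * h w ^+ 2))).
      apply: ler_sum => w _; rewrite -subr_ge0.
      have -> : eta / 2 + (2 * eta)^-1 * h w ^+ 2 - h w = (2 * eta)^-1 * (h w - eta) ^+ 2.
        by field; rewrite gt_eqF.
      by rewrite mulr_ge0 ?sqr_ge0 // invr_ge0 mulr_ge0 // ltW.
    rewrite big_split /=; apply: lerD; last by rewrite mulr_sumr.
    rewrite sumr_const -[X in X <= _]mulr_natl -mulrA ler_wpM2r //.
      by rewrite divr_ge0 // ltW.
    by rewrite ler_nat -cB; apply: subset_leq_card.
  rewrite mulrDr; apply: lerD.
    rewrite expr2 -!mulrA ler_wpM2r //.
      by rewrite !mulr_ge0 ?ler0n // ?ltW // invr_ge0.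
    by rewrite ler_nat.
  rewrite mulrCA; apply: (@le_trans _ _ ((2 * eta)^-1 * (d%:R * v%:R ^+ 2 * e))).
    rewrite ler_wpM2l //; first by rewrite invr_ge0 mulr_ge0 // ltW.
    apply: le_trans poin _; rewrite ler_wpM2r // -mulrA ler_wpM2l ?ler0n // expr2.
    by rewrite ler_wpM2r ?ler0n.
  by rewrite le_eqVlt; apply/orP; left; apply/eqP; ring.
have sp p : p \in C -> (spread p B y)%:R <=
    #|past p y :&: W|%:R * #|A :&: W|%:R + 2 * v%:R * s%:R :> F.
  move=> pC; have -> : spread p B y = (#|past p y :&: B| * #|A :&: B|)%N.
    congr (_ * #|pred_of_set (_ :&: _)|)%N; apply/setP => x.
    by rewrite [LHS]inE; apply: tclass_anc.
  rewrite -!natrM -natrD ler_nat.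
  apply: leq_trans (leq_mul (split _) (leqnn _)) _.
  rewrite mulnDl mul2n -addnn mulnDl addnA; apply: leq_add; last first.
    by rewrite mulnC leq_mul2r leB orbT.
  apply: leq_trans (leq_mul (leqnn _) (split _)) _.
  by rewrite mulnDr leq_add2l leq_mul2r leW orbT.
apply: le_trans (ler_sum _ (fun p => sp p)) _.
rewrite big_split /= -mulr_suml sumW sumr_const -[X in _ + X]mulr_natl.
rewrite -[X in X + _ <= _]mulrA -mulrDr ler_wpM2l ?ler0n // lerD2r mulrC.
exact: main.
Qed.

Lemma tile_sub (b c : nat) (y : X) : tile b y \subset tile (b * c) y.
Proof. by apply/subsetP => x /tileP xT; apply/tileP => i; rewrite !divnMA xT. Qed.

(** The annuli are disjoint, as their telescoping indicators show, so all scales together share one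
    energy. *)
Lemma energy_scales K J p0 (y : X) : tree p0 ->
  \sum_(j < J) \sum_(z in tile (K ^ j.+1) y :\: tile (K ^ j) y) \sum_i
     grad (hprob nb F p0 y) z i <= (d * 2)%:R.
Proof.
move=> tp0; set h := hprob nb F p0 y.
apply: (@le_trans _ _ (\sum_z \sum_i grad h z i)).
  under eq_bigr do rewrite big_mkcond.
  rewrite exchange_big /=; apply: ler_sum => z _; set g := \sum_i grad h z i.
  have g0 : 0 <= g by apply: sumr_ge0 => i _; apply: grad_ge0.
  pose t j : F := (z \in tile (K ^ j) y)%:R.
  rewrite (eq_bigr (fun j : 'I_J => (t j.+1 - t j) * g)); last first.
    move=> j _; rewrite in_setD /t.
    have := subsetP (tile_sub (K ^ j) K y) z; rewrite -expnSr.
    case: (z \in tile (K ^ j) y) => [->|_] //=; first by rewrite subrr mul0r.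
    by case: ifP => _; rewrite subr0 ?mul1r ?mul0r.
  rewrite -mulr_suml -(big_mkord xpredT (fun j => t j.+1 - t j)) telescope_sumr //.
  rewrite -[leRHS]mul1r ler_wpM2r // lerBlDr /t.
  by case: (_ \in _); case: (_ \in _).
have := hprob_energy F (@nbox_rev d n) (@revboxK d) y tp0 (@revbox_pos d).
rewrite cardD; apply: le_trans; rewrite le_eqVlt; apply/orP; left; apply/eqP.
apply: eq_bigr => z _; rewrite (eq_bigl (fun e : D => true && e.2)); last by move=> e; rewrite inE.
rewrite -(pair_big xpredT id (fun i b => oapp (fun u => (h u - h z) ^+ 2) 0 (nb z (i, b)))) /=.
by apply: eq_bigr => i _; rewrite big_mkcond big_bool /= addr0.
Qed.

(** The energy term [d ^ 2 / eta] does not grow with the number [J] of scales, while a small [eta]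
    and a large [K] control the terms of order [J]. *)
Lemma total_upper K J (eta : F) : (0 < K)%N -> (K ^ J %| n.+1)%N -> 0 < eta ->
  \sum_(p | tree p) \sum_y \sum_(j < J)
     (spread p (tile (K ^ j.+1) y) y)%:R / ((K ^ j.+1) ^ d)%:R ^+ 2 <=
  (J%:R * eta / 2 + d%:R ^+ 2 / eta + 2 * J%:R * d%:R / K%:R) * (tau * #|X|%:R).
Proof.
move=> K0 Kn eta0; rewrite exchange_big /=.
set c := _ / 2 + _ + _.
rewrite [leRHS]mulrA [leRHS]mulr_natr -[leRHS]sumr_const; apply: ler_sum => y _.
apply: (tclass_average (y := y)) => p0 tp0.
have Kj j : (0 < K ^ j)%N by rewrite expn_gt0 K0.
have Kd j : (j <= J)%N -> (K ^ j %| n.+1)%N.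
  by move=> jJ; apply: dvdn_trans Kn; apply: dvdn_exp2l.
pose e (j : 'I_J) := \sum_(z in tile (K ^ j.+1) y :\: tile (K ^ j) y) \sum_i
     grad (hprob nb F p0 y) z i.
have sc (j : 'I_J) : \sum_(p in tclass nb p0 y)
      (spread p (tile (K ^ j.+1) y) y)%:R / ((K ^ j.+1) ^ d)%:R ^+ 2 <=
      #|tclass nb p0 y|%:R * (eta / 2 + d%:R / (2 * eta) * e j + 2 * d%:R / K%:R).
  rewrite -mulr_suml ler_pdivrMr; last by rewrite exprn_gt0 // ltr0n expn_gt0 Kj.
  apply: le_trans (scale_upper y tp0 eta0 (Kj j.+1) (Kj j) (Kd j.+1 _) (Kd j _)) _ => //.
    by apply: ltnW.
  rewrite -/(e j) le_eqVlt; apply/orP; left; apply/eqP.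
  set v := ((K ^ j.+1) ^ d)%N.
  have -> : (d * (K ^ j * (K ^ j.+1) ^ d.-1))%:R = d%:R * v%:R / K%:R :> F.
    have -> : v = (K * (K ^ j * (K ^ j.+1) ^ d.-1))%N.
      rewrite mulnA -expnS /v -[in LHS](prednK (ltnW d2)) [in LHS]expnS.
      by [].
    by rewrite !natrM; field; rewrite pnatr_eq0 -lt0n K0.
  by field; rewrite (gt_eqF eta0) pnatr_eq0 -lt0n K0.
rewrite exchange_big /=; apply: le_trans (ler_sum _ (fun j _ => sc j)) _.
rewrite -mulr_sumr mulrC ler_wpM2r ?ler0n // !big_split /= !sumr_const card_ord -mulr_sumr.
rewrite -[(eta / 2) *+ J]mulr_natl -[(2 * d%:R / K%:R) *+ J]mulr_natl /c.
have H : d%:R / (2 * eta) * \sum_j e j <= d%:R ^+ 2 / eta.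
  apply: (@le_trans _ _ (d%:R / (2 * eta) * (d * 2)%:R)).
    rewrite ler_wpM2l ?energy_scales // divr_ge0 ?ler0n // mulr_ge0 // ltW //.
  by rewrite natrM le_eqVlt; apply/orP; left; apply/eqP; field; rewrite gt_eqF.
have -> : 2 * J%:R * d%:R / K%:R = J%:R * (2 * d%:R / K%:R) :> F by field; rewrite pnatr_eq0 -lt0n K0.
by rewrite mulrA; lra.
Qed.

End Average.

(** If the bound failed, every scale would carry at least [3/4 * delta ^ 3] after normalisation: the
    tangent bound leaves [3 - 2 = 1], and bad tiles cost [1/4]. Over many scales this contradicts
    [total_upper]. *)
Theorem few_big_pasts d q : (1 < d)%N -> (0 < q)%N ->
  exists b L, (0 < b)%N /\ forall n, (b %| n.+1)%N ->
  (q * \sum_(p | tree (@nbox d n) p) #|big (@nbox d n) p L| <=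
   #|[set p | tree (@nbox d n) p]| * n.+1 ^ d)%N.
Proof.
move=> d2 q0.
(* With [delta = 1/q] and [eta = delta ^ 3 / 12], the [eta] term and the [K] term are
   [J * delta ^ 3 / 4] each. The remaining [J * delta ^ 3 / 4] exceeds [6 * d ^ 2 / eta] for this
   [J]. [M] keeps the bad tiles below [delta ^ 3 / 4], and [L] meets the size condition of
   [funnel]. *)
pose J := (288 * d ^ 2 * q ^ 6).+1; pose K := (48 * d * q ^ 3)%N.
pose v := ((K ^ J) ^ d)%N; pose D := ('I_d * bool)%type.
pose M := (4 * q ^ 3 * (#|{: D}| ^ v * v))%N.
pose L := (v * (#|{: D}| * M).+1).+1.
have d0 : (0 < d)%N := ltnW d2.
have K0 : (0 < K)%N by rewrite muln_gt0 muln_gt0 d0 expn_gt0 q0.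
have D0 : (0 < #|{: D}|)%N by rewrite card_prod card_ord card_bool muln_gt0 d0.
have v0 : (0 < v)%N by rewrite expn_gt0 expn_gt0 K0.
have M0 : (0 < M)%N by rewrite muln_gt0 muln_gt0 muln_gt0 v0 !expn_gt0 q0 D0.
exists (K ^ J)%N, L; split; first by rewrite expn_gt0 K0.
move=> n Kn; rewrite leqNgt; apply/negP => contra.
pose delta : rat := q%:R^-1; pose eta : rat := delta ^+ 3 / 12.
set T := [set p | tree (@nbox d n) p] in contra *.
set N := (n.+1 ^ d)%N in contra *.
set S := (\sum_(p | _) _)%N in contra.
have q0' : 0 < q%:R :> rat by rewrite ltr0n.
have delta0 : 0 < delta by rewrite invr_gt0.
have eta0 : 0 < eta by rewrite divr_gt0 // exprn_gt0.
have Sbig : delta * (#|T|%:R * N%:R) < S%:R :> rat.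
  by rewrite /delta mulrC ltr_pdivrMr // -!natrM ltr_nat [X in (_ < X)%N]mulnC.
have TX0 : 0 < #|T|%:R * N%:R :> rat.
  rewrite -natrM ltr0n muln_gt0; apply/andP; split.
    rewrite lt0n; apply/negP => /eqP T0; move: contra; rewrite T0 mul0n /S big1 ?muln0 // => p tp.
    by have := card0_eq T0 p; rewrite inE tp.
  by rewrite expn_gt0.
have Kj j : (0 < K ^ j)%N by rewrite expn_gt0 K0.
have Kd j : (j <= J)%N -> (K ^ j %| n.+1)%N.
  by move=> jJ; apply: dvdn_trans Kn; apply: dvdn_exp2l.
have up := total_upper d2 K0 Kn eta0; rewrite card_ffun !card_ord -/T -/N in up.
have low (j : 'I_J) : 3 * delta ^+ 2 * S%:R - 2 * delta ^+ 3 * (#|T|%:R * N%:R)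
      - delta ^+ 3 / 4 * (#|T|%:R * N%:R) <=
   6 * \sum_(p | tree (@nbox d n) p) \sum_y
     (spread p (tile (K ^ j.+1) y) y)%:R / ((K ^ j.+1) ^ d)%:R ^+ 2.
  pose vj := ((K ^ j.+1) ^ d)%N.
  have vjv : (vj <= v)%N by rewrite /vj /v leq_exp2r // leq_pexp2l.
  have vj0 : (0 < vj)%N by rewrite expn_gt0 Kj.
  have Lbig : (vj * (#|{: D}| * M).+1 < L)%N by rewrite ltnS leq_mul2r vjv orbT.
  have bc := bad_count d2 (Kj j.+1) (Kd j.+1 (ltn_ord j)) M0 Lbig.
  rewrite card_ffun !card_ord -/T -/N in bc.
  have bc' : (\sum_(p | tree (@nbox d n) p) \sum_x bad (K ^ j.+1) L p x)%:R <=
      delta ^+ 3 / 4 * (#|T|%:R * N%:R) :> rat.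
    have M0' : 0 < M%:R :> rat by rewrite ltr0n.
    rewrite -(ler_pM2r M0') -[X in X <= _]natrM.
    apply: (@le_trans _ _ ((#|{: D}| ^ v * v * (#|T| * N))%:R)).
      rewrite ler_nat; apply: leq_trans bc _; rewrite leq_mul2r; apply/orP; right.
      by apply: leq_mul => //; rewrite leq_pexp2l.
    rewrite /M /delta !natrM le_eqVlt; apply/orP; left; apply/eqP.
    by field; rewrite gt_eqF.
  have step p : 3 * delta ^+ 2 * #|big (@nbox d n) p L|%:R - 2 * delta ^+ 3 * N%:R
       - \sum_x (bad (K ^ j.+1) L p x)%:R <=
     6 * \sum_y (spread p (tile (K ^ j.+1) y) y)%:R / vj%:R ^+ 2 :> rat.
    have vj2 : 0 < vj%:R ^+ 2 :> rat by rewrite exprn_gt0 // ltr0n.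
    rewrite -mulr_suml mulrA ler_pdivlMr // mulrC -natrX.
    have := spread_lower L p (Kj _) (Kd _ (ltn_ord j)) (ltW delta0).
    by rewrite card_ffun !card_ord.
  rewrite mulr_sumr; apply: le_trans (ler_sum _ (fun p _ => step p)).
  rewrite !sumrB -mulr_sumr -natr_sum -/S.
  have -> : \sum_(p | tree (@nbox d n) p) 2 * delta ^+ 3 * N%:R =
      2 * delta ^+ 3 * (#|T|%:R * N%:R).
    by rewrite sumr_const -cardsE -[LHS]mulr_natr -/T; ring.
  apply: lerB => //; rewrite natr_sum in bc'; apply: le_trans bc'.
  by apply: ler_sum => p _; rewrite natr_sum.
have lows : J%:R * (3 / 4 * delta ^+ 3 * (#|T|%:R * N%:R)) <=
   6 * ((J%:R * eta / 2 + d%:R ^+ 2 / eta + 2 * J%:R * d%:R / K%:R) * (#|T|%:R * N%:R)).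
  apply: le_trans (_ : 6 * (\sum_(p | tree (@nbox d n) p) \sum_y \sum_(j < J)
     (spread p (tile (K ^ j.+1) y) y)%:R / ((K ^ j.+1) ^ d)%:R ^+ 2) <= _); last first.
    by rewrite ler_wpM2l.
  have -> : \sum_(p | tree (@nbox d n) p) \sum_y \sum_(j < J)
     (spread p (tile (K ^ j.+1) y) y)%:R / ((K ^ j.+1) ^ d)%:R ^+ 2 =
     \sum_(j < J) \sum_(p | tree (@nbox d n) p) \sum_y
     (spread p (tile (K ^ j.+1) y) y)%:R / ((K ^ j.+1) ^ d)%:R ^+ 2 :> rat.
    under eq_bigr do rewrite exchange_big /=; by rewrite exchange_big.
  rewrite mulr_natl -{1}(card_ord J) -sumr_const mulr_sumr; apply: ler_sum => j _.
  apply: le_trans (low j).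
  have : 3 * delta ^+ 2 * (delta * (#|T|%:R * N%:R)) <= 3 * delta ^+ 2 * S%:R.
    by rewrite ler_wpM2l ?ltW // mulr_gt0 // exprn_gt0.
  move: (#|T|%:R * N%:R) S%:R => A B; rewrite -subr_ge0 => H; rewrite -subr_ge0.
  by apply: le_trans H _; rewrite le_eqVlt; apply/orP; left; apply/eqP; field.
move: lows; rewrite [X in _ <= X]mulrA [X in X <= _]mulrA ler_pM2r //.
have dr0 : 0 < d%:R :> rat by rewrite ltr0n.
have EK : 2 * J%:R * d%:R / K%:R = J%:R * delta ^+ 3 / 24.
  rewrite /K /delta !natrM; field.
  by rewrite !gt_eqF.
have Ee : d%:R ^+ 2 / eta = 12 * d%:R ^+ 2 * q%:R ^+ 3.
  by rewrite /eta /delta; field; rewrite gt_eqF.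
rewrite EK Ee /eta => H.
have : J%:R * delta ^+ 3 <= 288 * d%:R ^+ 2 * q%:R ^+ 3 :> rat by lra.
have EJ : J%:R * delta ^+ 3 = 288 * d%:R ^+ 2 * q%:R ^+ 3 + delta ^+ 3.
  by rewrite /J -natr1 !natrM /delta; field; rewrite gt_eqF.
have : 0 < delta ^+ 3 by rewrite exprn_gt0.
by rewrite EJ; lra.
Qed.

(** * Exchanging heights and pointers *)

Section Expectation.
Variable R : realFieldType.

Definition Ex (T : finType) (phi : T -> R) : R := (\sum_t phi t) / #|T|%:R.

Lemma eq_Ex (T : finType) (f g : T -> R) : f =1 g -> Ex f = Ex g.
Proof. by move=> E; rewrite /Ex; congr (_ / _); apply: eq_bigr. Qed.

Lemma Ex_ge0 (T : finType) (f : T -> R) : (forall t, 0 <= f t) -> 0 <= Ex f.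
Proof. by move=> f0; rewrite divr_ge0 ?ler0n // sumr_ge0. Qed.

Lemma le_Ex (T : finType) (f g : T -> R) : (forall t, f t <= g t) -> Ex f <= Ex g.
Proof. by move=> fg; rewrite ler_wpM2r ?invr_ge0 ?ler0n // ler_sum. Qed.

Lemma ExD (T : finType) (f g : T -> R) : Ex (fun t => f t + g t) = Ex f + Ex g.
Proof. by rewrite /Ex big_split mulrDl. Qed.

Lemma ExB (T : finType) (f g : T -> R) : Ex (fun t => f t - g t) = Ex f - Ex g.
Proof. by rewrite /Ex sumrB mulrBl. Qed.

Lemma ExZ (T : finType) (c : R) (f : T -> R) : Ex (fun t => c * f t) = c * Ex f.
Proof. by rewrite /Ex -mulr_sumr mulrA. Qed.

Lemma Ex_sum (T I : finType) (P : pred I) (f : I -> T -> R) :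
  Ex (fun t => \sum_(i | P i) f i t) = \sum_(i | P i) Ex (f i).
Proof. by rewrite /Ex exchange_big mulr_suml. Qed.

Lemma Ex_norm (T : finType) (f : T -> R) : `|Ex f| <= Ex (fun t => `|f t|).
Proof.
rewrite /Ex normrM [X in _ * X]ger0_norm ?invr_ge0 ?ler0n // ler_wpM2r ?invr_ge0 ?ler0n //.
exact: ler_norm_sum.
Qed.

Variables (X T : finType).
Implicit Types (S : {set X}) (f g : {ffun X -> T}) (phi psi : {ffun X -> T} -> R).

Definition dep (U : Type) S (phi : {ffun X -> T} -> U) :=
  forall f g, {in S, f =1 g} -> phi f = phi g.

Lemma depS (U : Type) S S' (phi : {ffun X -> T} -> U) : S \subset S' -> dep S phi -> dep S' phi.
Proof. by move=> SS dp f g fg; apply: dp => x /(subsetP SS)/fg. Qed.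

Lemma depM S phi psi : dep S phi -> dep S psi -> dep S (fun f => phi f * psi f).
Proof. by move=> d1 d2 f g fg; rewrite (d1 _ _ fg) (d2 _ _ fg). Qed.

Lemma dep_comp (U V : Type) S (phi : {ffun X -> T} -> U) (k : U -> V) :
  dep S phi -> dep S (fun f => k (phi f)).
Proof. by move=> d1 f g fg; rewrite (d1 _ _ fg). Qed.

Lemma Ex_indep S S' phi psi : dep S phi -> dep S' psi -> [disjoint S & S'] ->
  Ex (fun f => phi f * psi f) = Ex phi * Ex psi.
Proof.
move=> dphi dpsi dis.
pose mix f g : {ffun X -> T} := [ffun x => if x \in S then f x else g x].
have E : (\sum_f phi f * psi f) * #|{ffun X -> T}|%:R = (\sum_f phi f) * (\sum_f psi f).
  rewrite big_distrlr /= pair_big /= mulr_natr -sumr_const exchange_big /= pair_big /=.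
  pose sg (z : {ffun X -> T} * {ffun X -> T}) := (mix z.1 z.2, mix z.2 z.1).
  have sgK : involutive sg.
    move=> [f g]; rewrite /sg /mix /=.
    by congr (_, _); apply/ffunP => x; rewrite !ffunE; case: (x \in S).
  rewrite (reindex_inj (inv_inj sgK)) /=; apply: eq_big => [[f g]|[f g] _] //=.
  rewrite [RHS]mulrC [LHS]mulrC; congr (_ * _).
    by apply: dpsi => x xS; rewrite ffunE (disjointFl dis).
  by apply: dphi => x xS; rewrite ffunE xS.
rewrite /Ex; have [E0|N0] := eqVneq (#|{ffun X -> T}|%:R : R) 0.
  by rewrite E0 !invr0 !mulr0.
by rewrite mulrACA -E -!mulrA; congr (_ * _); field.
Qed.

End Expectation.

Section Decomposition.
Variables (X : finType) (fire : X -> {set X} -> bool).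
Hypothesis mo : fire_mono fire.
Implicit Types (I U W L : {set X}).

Definition outer I U := cl fire U I == ~: U.
Definition inner L U :=
  [forall x in U :\: L, ~~ fire x (~: U)] && (cl fire set0 (~: U) == setT).
Definition middle W U U' :=
  [forall x in (U :\: U') :\: W, ~~ fire x (~: U)] && (cl fire U' (~: U) == ~: U').

Lemma hold_split L W I U U' : L \subset W -> W \subset U -> U' \subset U -> L \subset U' ->
  I \subset ~: U ->
  [&& cl fire W I == ~: U, cl fire L I == ~: U' & cl fire set0 I == setT] =
  [&& outer I U, middle W U U' & inner L U'].
Proof.
move=> LW WU UU LU IU.
apply/and3P/and3P => [[/eqP e1 /eqP e2 /eqP e3]|[/eqP o /andP[/forall_inP m1 /eqP m2] /andP[/forall_inP i1 /eqP i2]]].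
  have ncl Hd V x : cl fire Hd I = ~: V -> x \in V -> x \notin Hd -> ~~ fire x (~: V).
    move=> E xV xH; apply/negP => xf; have : x \in cl fire Hd I.
      by apply: cl_closed => //; rewrite E.
    by rewrite E inE xV.
  split.
  - by apply/eqP; apply: cl_holdE e1.
  - apply/andP; split; last first.
      by apply/eqP; apply: (cl_holdE mo LU); rewrite -e1 cl_cl.
    by apply/forall_inP => x; rewrite !inE => /and3P[xW _ xU]; apply: ncl e1 xU xW.
  - apply/andP; split; last by rewrite -e2 cl_cl ?e3 ?sub0set.
    by apply/forall_inP => x; rewrite inE => /andP[xL xU]; apply: ncl e2 xU xL.
have c1 : cl fire W I = ~: U.
  apply/eqP; rewrite eqEsubset -{2}o cl_mono // andbT; apply: cl_min => // x xW xf.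
  rewrite inE; apply/negP => xU; have [xU'|xU'] := boolP (x \in U').
    have /i1/negP : x \in U' :\: L.
      by rewrite inE xU' andbT; apply: contra xW; apply: (subsetP LW).
    by apply; apply: mo xf; rewrite setCS.
  by have /m1/negP : x \in (U :\: U') :\: W by rewrite !inE xU xU' xW.
have c2 : cl fire L I = ~: U'.
  apply/eqP; rewrite eqEsubset; apply/andP; split.
    apply: cl_min => //; first by apply: subset_trans IU _; rewrite setCS.
    move=> x xL xf; rewrite inE; apply/negP => xU.
    by have /i1/negP : x \in U' :\: L by rewrite inE xL.
  by rewrite -(cl_cl I mo LW) c1 -m2 cl_mono.
by rewrite c1 c2 -(cl_cl I mo (sub0set L)) c2 i2.
Qed.

Lemma cl_disj W I U : [disjoint W & I] -> cl fire W I = ~: U -> W \subset U /\ I \subset ~: U.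
Proof.
move=> dis E; split; last by rewrite -E cl_sub.
apply/subsetP => x xW; rewrite -[_ \in U]negbK -in_setC -E; apply/negP => xc.
case/orP: (cl_fired mo xc) => [xI|]; last by rewrite xW.
by rewrite (disjointFr dis xW) in xI.
Qed.

End Decomposition.

Lemma natr_andb (R : pzSemiRingType) (a b : bool) : (a && b)%:R = a%:R * b%:R :> R.
Proof. by case: a; rewrite ?mul1r ?mul0r. Qed.

Section Transfer.
Variables (X D : finType) (nb : X -> D -> option X) (m : nat) (R : realFieldType).
Hypothesis card_D : #|D| = m.
Local Notation H := 'I_m.
Local Notation fireP p := (fireP nb p).
Local Notation fireH h := (fireH nb h).
Local Notation tree := (tree nb).
Implicit Types (I U W L Z : {set X}) (fire : X -> {set X} -> bool) (h : {ffun X -> H}) (p q : {ffun X -> D}).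

Lemma fireH_mono h : fire_mono (fireH h). Proof. exact: fireK_mono. Qed.
Lemma firep_mono p : fire_mono (fireP p). Proof. exact: fireP_mono. Qed.

Definition full (fire : X -> {set X} -> bool) I := cl fire set0 I == setT.
Definition held (fire : X -> {set X} -> bool) I W := ~: cl fire W I.

(** The mean of [A] given that [U] is the set left unburnt when [L] is held back; for [A] living on
    [L] inside [U], only heights in [U] matter. *)
Definition local_prob L (A : {ffun X -> H} -> R) U :=
  Ex (fun h => (inner (fireH h) L U)%:R * A h) / Ex (fun h => (inner (fireH h) L U)%:R).

Lemma dep_clH (S : {set X}) I U : (forall x, x \notin U -> x \notin I -> x \in S) ->
  dep S (fun h => cl (fireH h) U I).
Proof.
move=> sub f g fg; apply: eq_cl => x C xU xI.
by rewrite !fireHE fg // sub.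
Qed.

Lemma dep_clP (S : {set X}) I U : (forall x, x \notin U -> x \notin I -> x \in S) ->
  dep S (fun p => cl (fireP p) U I).
Proof.
move=> sub f g fg; apply: eq_cl => x C xU xI.
by rewrite !firePE fg // sub.
Qed.

Lemma dep_outer I U : dep (~: U) (fun h => (outer (fireH h) I U)%:R : R).
Proof.
by apply: (dep_comp (fun C => (C == ~: U)%:R)); apply: dep_clH => x; rewrite inE.
Qed.

Lemma dep_inner L U : dep U (fun h => (inner (fireH h) L U)%:R : R).
Proof.
move=> f g fg; congr (nat_of_bool _)%:R; congr (_ && _).
  apply: eq_forallb_in => x; rewrite inE => /andP[_ xU].
  by rewrite !fireHE fg.
by rewrite (@dep_clH U (~: U) set0 _ f g fg) // => x _; rewrite inE negbK.
Qed.

Lemma dep_middle W U U' : dep (U :\: U') (fun h => (middle (fireH h) W U U')%:R : R).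
Proof.
move=> f g fg; congr (nat_of_bool _)%:R; congr (_ && _).
  apply: eq_forallb_in => x; rewrite inE => /andP[_ xU].
  by rewrite !fireHE fg.
rewrite (@dep_clH (U :\: U') (~: U) U' _ f g fg) // => x x1; rewrite !inE negbK => ->.
by rewrite x1.
Qed.

Definition event (fire : X -> {set X} -> bool) I W L U U' :=
  [&& cl fire W I == ~: U, cl fire L I == ~: U' & cl fire set0 I == setT].

Lemma sum_event fire I W L (F : {set X} -> {set X} -> R) :
  \sum_U \sum_U' (event fire I W L U U')%:R * F U U' =
  (full fire I)%:R * F (held fire I W) (held fire I L).
Proof.
rewrite (bigD1 (held fire I W)) //= [X in _ + X]big1 ?addr0; last first.
  move=> U NE; rewrite big1 // => U' _; rewrite /event.
  case: eqP => [E|_] /=; last by rewrite mul0r.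
  by rewrite /held E setCK eqxx in NE.
rewrite (bigD1 (held fire I L)) //= [X in _ + X]big1 ?addr0; last first.
  move=> U' NE; rewrite /event andbCA; case: eqP => [E|_] /=; last by rewrite mul0r.
  by rewrite /held E setCK eqxx in NE.
by rewrite /event /held !setCK !eqxx.
Qed.

Lemma equi_event I W L (F : {set X} -> {set X} -> R) : L \subset W ->
  Ex (fun h => (full (fireH h) I)%:R * F (held (fireH h) I W) (held (fireH h) I L)) =
  Ex (fun p => (full (fireP p) I)%:R * F (held (fireP p) I W) (held (fireP p) I L)).
Proof.
move=> LW; rewrite /Ex; congr (_ / _%:R); last by rewrite !card_ffun card_ord card_D.
pose G (C1 C2 C3 : {set X}) : R := (C3 == setT)%:R * F (~: C1) (~: C2).
have E fire : fire_mono fire ->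
    (full fire I)%:R * F (held fire I W) (held fire I L) =
    G (cl fire W I) (cl fire L (cl fire W I)) (cl fire set0 (cl fire L (cl fire W I))).
  by move=> mo; rewrite (cl_cl I mo LW) (cl_cl I mo (sub0set L)).
rewrite (eq_bigr _ (fun h _ => E _ (@fireH_mono h))) (eq_bigr _ (fun p _ => E _ (@firep_mono p))).
exact: equidistribution.
Qed.

(** By [hold_split] the event is a product of independent factors; [A] alters only the inner one and
    [B] only the outer one. *)
Lemma Ex_event_factor I W L U U' (A B : {ffun X -> H} -> R) (beta : R) :
  L \subset W -> W \subset U -> U' \subset U -> L \subset U' -> I \subset ~: U ->
  dep L A -> dep (~: U) B ->
  Ex (fun h => (outer (fireH h) I U)%:R * B h) = beta * Ex (fun h => (outer (fireH h) I U)%:R) ->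
  Ex (fun h => (event (fireH h) I W L U U')%:R * (A h * B h)) =
  Ex (fun h => (event (fireH h) I W L U U')%:R) * (beta * local_prob L A U').
Proof.
move=> LW WU UU LU IU dA dB EB.
pose a h : R := (outer (fireH h) I U)%:R; pose b h : R := (middle (fireH h) W U U')%:R.
pose c h : R := (inner (fireH h) L U')%:R.
have ev h : (event (fireH h) I W L U U')%:R = a h * (b h * c h) :> R.
  rewrite /event (hold_split (@fireH_mono h) LW WU UU LU IU) /a /b /c.
  by case: (outer _ _ _); case: (middle _ _ _ _); case: (inner _ _ _); rewrite /= ?mulr1 ?mulr0 ?mul0r.
have fac (A' B' : {ffun X -> H} -> R) : dep U' A' -> dep (~: U) B' ->
    Ex (fun h => (a h * B' h) * (b h * (c h * A' h))) =
    Ex (fun h => a h * B' h) * (Ex b * Ex (fun h => c h * A' h)).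
  move=> dA' dB'.
  rewrite (@Ex_indep _ _ _ (~: U) U).
  - rewrite (@Ex_indep _ _ _ (U :\: U') U' b (fun h => c h * A' h)) //; first exact: (@dep_middle W U U').
      by apply: depM => //; exact: (@dep_inner L U').
    by rewrite -setI_eq0; apply/eqP/setP => x; rewrite !inE; case: (x \in U'); rewrite ?andbF.
  - by apply: depM => //; exact: (@dep_outer I U).
  - apply: depM; first by apply: depS (@dep_middle W U U'); apply: subsetDl.
    by apply: depM; [apply: depS (@dep_inner L U')|apply: depS dA'].
  - by rewrite -setI_eq0 setIC setICr.
rewrite (@eq_Ex _ _ _ (fun h => (a h * B h) * (b h * (c h * A h)))); last first.
  by move=> h; rewrite ev; ring.
rewrite fac //; last exact: depS dA.
rewrite (@eq_Ex _ _ (fun h => (event (fireH h) I W L U U')%:R)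
   (fun h => (a h * (fun=> 1) h) * (b h * (c h * (fun=> 1) h)))); last first.
  by move=> h; rewrite ev !mulr1.
rewrite fac // EB -/a.
have E1 (f : {ffun X -> H} -> R) : Ex (fun h => f h * 1) = Ex f by apply: eq_Ex => h; rewrite mulr1.
rewrite !E1 /local_prob -/c.
(* If the inner factor is null, the quotient in [local_prob] has value 0 by convention, and the left
   side vanishes as well. *)
have [c0|c0] := eqVneq (Ex c) 0; last by field.
rewrite c0 !mulr0 mul0r.
suff -> : Ex (fun h => c h * A h) = 0 by rewrite !mulr0.
have cz h : c h = 0.
  have : 0 <= c h by rewrite ler0n.
  rewrite le_eqVlt => /orP[/eqP <-//|cpos].
  move/eqP: c0; rewrite /Ex mulf_eq0 => /orP[|].
    rewrite psumr_eq0; last by move=> *; rewrite ler0n.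
    by move/allP/(_ h (mem_index_enum h))/eqP.
  by rewrite invr_eq0 pnatr_eq0 => /eqP/card0_eq/(_ h).
by rewrite /Ex big1 ?mul0r // => h _; rewrite cz mul0r.
Qed.

(* All dependence on the heights has been pushed into a function beta of the
   sites reached through W and a function local_prob of those reached through
   L; both sets have the same law under the pointer rule. *)
Lemma transfer I W L (A B : {ffun X -> H} -> R) (beta : {set X} -> R) (G : pred {set X}) :
  L \subset W -> [disjoint W & I] -> dep L A -> (forall U, G U -> dep (~: U) B) ->
  (forall U, G U -> Ex (fun h => (outer (fireH h) I U)%:R * B h) =
     beta U * Ex (fun h => (outer (fireH h) I U)%:R)) ->
  Ex (fun h => (full (fireH h) I && G (held (fireH h) I W))%:R * (A h * B h)) =
  Ex (fun p => (full (fireP p) I)%:R * ((G (held (fireP p) I W))%:R *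
     (beta (held (fireP p) I W) * local_prob L A (held (fireP p) I L)))).
Proof.
move=> LW dis dA dB EB.
rewrite -(equi_event I (fun U U' => (G U)%:R * (beta U * local_prob L A U')) LW).
rewrite (@eq_Ex _ _ _ (fun h => \sum_U \sum_U' (event (fireH h) I W L U U')%:R * ((G U)%:R * (A h * B h)))); last first.
  by move=> h /=; rewrite natr_andb -mulrA (sum_event _ _ _ _ (fun U U' => (G U)%:R * (A h * B h))).
rewrite [in RHS](@eq_Ex _ _ _ (fun h => \sum_U \sum_U' (event (fireH h) I W L U U')%:R *
   ((G U)%:R * (beta U * local_prob L A U')))); last first.
  by move=> h /=; rewrite (sum_event _ _ _ _ (fun U U' => (G U)%:R * (beta U * local_prob L A U'))).
rewrite !Ex_sum; apply: eq_bigr => U _; rewrite !Ex_sum; apply: eq_bigr => U' _.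
case: (boolP (G U)) => GU; last first.
  by apply: eq_Ex => h; rewrite !mul0r !mulr0.
case: (boolP [exists h : {ffun X -> H}, event (fireH h) I W L U U']) => [/existsP[h0]|none]; last first.
  apply: eq_Ex => h; move: none; rewrite negb_exists => /forallP/(_ h)/negbTE ->.
  by rewrite !mul0r.
case/and3P => /eqP e1 /eqP e2 _.
have mo := @fireH_mono h0.
have [WU IU] := cl_disj mo dis e1.
have [LU _] := cl_disj mo (disjointWl LW dis) e2.
have UU : U' \subset U by rewrite -setCS -e1 -e2 cl_mono.
under eq_Ex do rewrite mul1r.
rewrite (Ex_event_factor LW WU UU LU IU dA (dB _ GU) (EB _ GU)).
by rewrite mulrC -ExZ; apply: eq_Ex => h; rewrite mul1r mulrC.
Qed.

Lemma local_transfer I L (A : {ffun X -> H} -> R) : [disjoint L & I] -> dep L A ->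
  Ex (fun h => (full (fireH h) I)%:R * A h) =
  Ex (fun p => (full (fireP p) I)%:R * local_prob L A (held (fireP p) I L)).
Proof.
move=> dis dA.
have := @transfer I L L A (fun=> 1) (fun=> 1) xpredT (subxx _) dis dA.
have E1 (f : {ffun X -> H} -> R) : Ex (fun h => f h * 1) = Ex f by apply: eq_Ex => h; rewrite mulr1.
move=> T; rewrite (@eq_Ex _ _ _ (fun h => (full (fireH h) I && true)%:R * (A h * 1))); last first.
  by move=> h; rewrite andbT mulr1.
rewrite T //; last by move=> U _; rewrite E1 mul1r.
by apply: eq_Ex => p; rewrite !mul1r.
Qed.

Lemma full_transfer I : Ex (fun h => (full (fireH h) I)%:R : R) = Ex (fun p => (full (fireP p) I)%:R).
Proof.
have := @equi_event I set0 set0 (fun _ _ => 1) (subxx _).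
by under eq_Ex do rewrite mulr1; move=> ->; apply: eq_Ex => p; rewrite mulr1.
Qed.

Section Ancestors.
Variables (W Z : {set X}).
Hypothesis WZ : ~: W \subset Z.
Let U := ~: Z.

Definition trunk p := [set z | [exists x in ~: W, connect (st nb p) x z]].

Lemma trunk_closed p x y : x \in trunk p -> st nb p x y -> y \in trunk p.
Proof.
rewrite !inE => /exists_inP[w wW wx] xy; apply/exists_inP; exists w => //.
exact: connect_trans wx (connect1 xy).
Qed.

(** Stated through some tree [q] that agrees with [p] on [Z], this is a condition on the pointers in
    [Z] alone. *)
Definition trunk_part p :=
  [exists q : {ffun X -> D}, [&& [forall x in Z, q x == p x], tree q & trunk q == Z]].

(** The trunk is closed under pointers, so a tree with trunk [Z] is a choice of pointers on [Z]
    together with a forest rooted at [Z] and the sink on the complement. *)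
Lemma trunk_split p : tree p && (trunk p == Z) = trunk_part p && full (fireP p) (~: U).
Proof.
have mo := @firep_mono.
apply/andP/andP => [[tp /eqP Zp]|[/existsP[q /and3P[/forall_inP qp tq /eqP Zq]] fU]].
  split.
    by apply/existsP; exists p; rewrite tp Zp eqxx /= andbT; apply/forall_inP.
  rewrite /full eqEsubset subsetT -(eqP tp) cl_mono //; exact: sub0set.
have agree : {in Z, q =1 p} by move=> x /qp/eqP.
have agree' : {in Z, p =1 q} by move=> x /agree.
have cq x y : x \in Z -> st nb q x y -> y \in Z by rewrite -Zq; apply: trunk_closed.
have cp x y : x \in Z -> st nb p x y -> y \in Z.
  by move=> xZ; rewrite stE -agree //; apply: cq.
have EZ : cl (fireP q) U set0 = ~: U.
  rewrite -[LHS]setCK (tree_clC _ tq); congr (~: _); apply/setP => x; rewrite inE.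
  apply/exists_inP/idP => [[y yU xy]|xU]; last by exists x; rewrite ?connect0.
  rewrite inE; apply/negP => xZ; move: yU; rewrite inE => /negP; apply.
  move: xZ xy => + /connectP[s + ->]; elim: s x => //= y' s IH x xZ /andP[xy' ys].
  by apply: IH ys; apply: cq xy'.
have EZp : cl (fireP p) U set0 = ~: U.
  rewrite -EZ; apply: (@dep_clP Z) => // x; by rewrite inE negbK.
have tp : tree p.
  by rewrite treeE -(cl_cl set0 (mo p) (sub0set U)) EZp.
split=> //; rewrite -Zq; apply/eqP/setP => z; rewrite !inE.
apply/exists_inP/exists_inP => -[x xW xz]; exists x => //.
  by apply: (connect_agree agree' cp) xz; apply: (subsetP WZ).
by apply: (connect_agree agree cq) xz; apply: (subsetP WZ).
Qed.

Lemma dep_trunk_part : dep Z (fun p => (trunk_part p)%:R : R).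
Proof.
move=> f g fg; congr (nat_of_bool _)%:R; apply: eq_existsb => q.
congr (_ && _); apply: eq_forallb_in => x xZ; by rewrite fg.
Qed.

(* Given the ancestors Z of the outside of W and their pointers, the remaining
   pointers form a uniform spanning tree of the volume ~: Z. *)
Lemma local_law L (A : {ffun X -> H} -> R) (beta : {set X} -> R) :
  L \subset U -> dep L A ->
  Ex (fun p => (tree p && (trunk p == Z))%:R *
      (beta (held (fireP p) set0 W) * local_prob L A (held (fireP p) set0 L))) *
    Ex (fun h => (full (fireH h) (~: U))%:R) =
  Ex (fun p => (tree p && (trunk p == Z))%:R * beta (held (fireP p) set0 W)) *
    Ex (fun h => (full (fireH h) (~: U))%:R * A h).
Proof.
move=> LU dA.
have UW : U \subset W by rewrite -setCS setCK.
have dis : [disjoint L & ~: U] by rewrite disjoints_subset setCK.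
have dB : dep Z (fun p => beta (held (fireP p) set0 W)).
  apply: (dep_comp (fun C => beta (~: C))); apply: dep_clP => x xW _.
  by apply: (subsetP WZ); rewrite inE.
rewrite (@eq_Ex _ _ (fun p => (tree p && (trunk p == Z))%:R *
      (beta (held (fireP p) set0 W) * local_prob L A (held (fireP p) set0 L)))
  (fun p => ((trunk_part p)%:R * beta (held (fireP p) set0 W)) *
     ((full (fireP p) (~: U))%:R * local_prob L A (held (fireP p) (~: U) L)))); last first.
  move=> p; rewrite trunk_split natr_andb.
  case: (boolP (trunk_part p)) => tpp; last by rewrite !mul0r.
  case: (boolP (full (fireP p) (~: U))) => fp; last by rewrite !mul0r !mulr0 mul0r.
  rewrite !mul1r; congr (_ * local_prob _ _ (~: _)).
  have /andP[tp /eqP Zp] : tree p && (trunk p == Z) by rewrite trunk_split tpp.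
  have mo := @firep_mono p.
  apply/eqP; rewrite eqEsubset; apply/andP; split; first by rewrite cl_mono ?sub0set.
  have EU : cl (fireP p) U set0 = ~: U.
    rewrite -[LHS]setCK (tree_clC _ tp); congr (~: _); apply/setP => x; rewrite inE.
    apply/exists_inP/idP => [[y yU xy]|xU]; last by exists x; rewrite ?connect0.
    rewrite inE; apply/negP => xZ; move: yU; rewrite inE => /negP; apply.
    move: xZ xy => + /connectP[s + ->]; elim: s x => //= y' s IH x xZ /andP[xy' ys].
    by apply: IH ys; move: xZ xy'; rewrite -Zp; apply: trunk_closed.
  by rewrite -EU cl_cl.
rewrite (@eq_Ex _ _ (fun p => (tree p && (trunk p == Z))%:R * beta (held (fireP p) set0 W))
  (fun p => ((trunk_part p)%:R * beta (held (fireP p) set0 W)) * (full (fireP p) (~: U))%:R)); last first.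
  by move=> p; rewrite trunk_split natr_andb; ring.
have d1 : dep Z (fun p => (trunk_part p)%:R * beta (held (fireP p) set0 W)).
  by apply: depM => //; apply: dep_trunk_part.
have d2 : dep U (fun p => (full (fireP p) (~: U))%:R : R).
  apply: (dep_comp (fun C => (C == setT)%:R)); apply: dep_clP => x _.
  by rewrite inE negbK.
have d3 : dep U (fun p => local_prob L A (held (fireP p) (~: U) L)).
  apply: (dep_comp (fun C => local_prob L A (~: C))); apply: dep_clP => x _.
  by rewrite inE negbK.
have disj : [disjoint Z & U] by rewrite -setI_eq0 setICr.
rewrite (Ex_indep d1 (depM d2 d3) disj) (Ex_indep d1 d2 disj).
by rewrite -local_transfer // full_transfer; ring.
Qed.

End Ancestors.
End Transfer.

Lemma Ex_eq0 (R : realFieldType) (T : finType) (f : T -> R) : (forall t, 0 <= f t) ->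
  Ex f = 0 -> forall t, f t = 0.
Proof.
move=> f0 /eqP; rewrite /Ex mulf_eq0 invr_eq0 pnatr_eq0 => /orP[|/eqP/card0_eq Z t].
  by rewrite psumr_eq0 // => /allP H t; apply/eqP/(H t)/mem_index_enum.
by have := Z t.
Qed.

Lemma Ex_ratio (R : realFieldType) (T : finType) (f g : T -> R) : (forall t, 0 <= f t) ->
  Ex (fun t => f t * g t) = (Ex (fun t => f t * g t) / Ex f) * Ex f.
Proof.
move=> f0; have [Z|N] := eqVneq (Ex f) 0; last by rewrite divfK.
rewrite Z mulr0; rewrite /Ex big1 ?mul0r // => t _; by rewrite (Ex_eq0 f0 Z) mul0r.
Qed.

Lemma Ex_ratio_01 (R : realFieldType) (T : finType) (f g : T -> R) : (forall t, 0 <= f t) ->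
  (forall t, 0 <= g t <= 1) -> 0 <= Ex (fun t => f t * g t) / Ex f <= 1.
Proof.
move=> f0 g01; have E0 : 0 <= Ex f by apply: Ex_ge0.
apply/andP; split.
  by rewrite divr_ge0 // Ex_ge0 // => t; rewrite mulr_ge0 //; case/andP: (g01 t).
have [Z|N] := eqVneq (Ex f) 0; first by rewrite Z invr0 mulr0.
rewrite ler_pdivrMr ?lt0r ?N // mul1r; apply: le_Ex => t.
by rewrite ler_piMr //; case/andP: (g01 t).
Qed.

Lemma dist_unit (R : realFieldType) (e a b : R) : 0 <= e -> 0 <= a <= 1 -> 0 <= b <= 1 ->
  - (e + 1) <= b - a <= e + 1.
Proof. by move=> e0 /andP[? ?] /andP[? ?]; apply/andP; split; lra. Qed.

(** * Decoupling a local and a distant observable in one volume *)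

Section Mixing.
Variables (X D : finType) (nb : X -> D -> option X) (m : nat) (R : realFieldType).
Hypothesis card_D : #|D| = m.
Hypothesis m_gt0 : (0 < m)%N.
Local Notation H := 'I_m.
Local Notation fireP p := (fireP nb p).
Local Notation fireH h := (fireH nb h).
Local Notation tree := (tree nb).
Implicit Types (U L Z : {set X}) (h : {ffun X -> H}) (p q : {ffun X -> D}).

Let treeF p : tree p = full (fireP p) set0. Proof. by []. Qed.

Variables (L W0 W W2 : {set X}) (A B : {ffun X -> H} -> R) (nu eps : R).
Hypotheses (LW0 : L \subset W0) (W0W : W0 \subset W).
Hypotheses (dA : dep L A) (dB : dep (~: W2) B).
Hypotheses (A01 : forall h, 0 <= A h <= 1) (B01 : forall h, 0 <= B h <= 1).
Hypotheses (nu01 : 0 <= nu <= 1) (eps0 : 0 <= eps).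
Hypothesis near : forall U, W0 \subset U ->
  `|Ex (fun h => (full (fireH h) (~: U))%:R * A h) -
    nu * Ex (fun h => (full (fireH h) (~: U))%:R)| <=
  eps * Ex (fun h => (full (fireH h) (~: U))%:R).
Local Notation F := (Ex (fun p => (tree p)%:R : R)).
Hypothesis oe0 : Ex (fun p => (tree p && ~~ (held (fireP p) set0 W0 \subset W))%:R) <= eps * F.
Hypothesis oe1 : Ex (fun p => (tree p && ~~ (held (fireP p) set0 W \subset W2))%:R) <= eps * F.

Let G U := U \subset W2.
Let ou U h : R := (outer (fireH h) set0 U)%:R.
Let beta U := Ex (fun h => ou U h * B h) / Ex (ou U).
Let phi U := local_prob nb L A U.
Let gamma U : R := (G U)%:R * beta U.

Let LW : L \subset W. Proof. exact: subset_trans LW0 W0W. Qed.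

Let beta01 U : 0 <= beta U <= 1.
Proof. by apply: Ex_ratio_01 => // h; rewrite ler0n. Qed.

Let phi01 U : 0 <= phi U <= 1.
Proof. by apply: Ex_ratio_01 => // h; rewrite ler0n. Qed.

Let gamma01 U : 0 <= gamma U <= 1.
Proof. by rewrite /gamma; case: (G U); rewrite ?mul1r ?mul0r ?beta01 ?lexx ?ler01. Qed.

(** On [G] the held set stays in [W2], so [B] only sees heights outside of it and [transfer]
    applies. *)
Let good_AB : Ex (fun h => (full (fireH h) set0 && G (held (fireH h) set0 W))%:R * (A h * B h)) =
  Ex (fun p => (tree p)%:R * (gamma (held (fireP p) set0 W) * phi (held (fireP p) set0 L))).
Proof.
rewrite (transfer card_D (beta := beta) LW) //.
- by apply: eq_Ex => p; rewrite /gamma -!mulrA.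
- by rewrite -setI_eq0 setI0.
- by move=> U GU; apply: depS dB; rewrite setCS.
- by move=> U GU; apply: Ex_ratio => h; rewrite ler0n.
Qed.

Let good_B : Ex (fun h => (full (fireH h) set0 && G (held (fireH h) set0 W))%:R * B h) =
  Ex (fun p => (tree p)%:R * gamma (held (fireP p) set0 W)).
Proof.
rewrite (@eq_Ex _ _ _ (fun h => (full (fireH h) set0 && G (held (fireH h) set0 W))%:R *
   ((fun=> 1) h * B h))); last by move=> h; rewrite mul1r.
rewrite (transfer card_D (beta := beta) (sub0set W)) //.
- apply: eq_Ex => p; rewrite /gamma treeF; case: (boolP (full (fireP p) set0)) => [tp|_]; last first.
    by rewrite !mul0r.
  rewrite !mul1r; congr (_ * _).
  have -> : held (fireP p) set0 set0 = set0 by rewrite /held (eqP tp) setCT.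
  have inn h : inner (fireH h) set0 set0.
    rewrite /inner setC0; apply/andP; split; first by apply/forall_inP => x; rewrite inE in_set0 andbF.
    by rewrite eqEsubset subsetT cl_sub.
  have E1 : Ex (fun h => (inner (fireH h) set0 set0)%:R : R) = 1.
    rewrite /Ex (eq_bigr (fun=> 1)); last by move=> h _; rewrite inn.
    rewrite sumr_const divff // pnatr_eq0 -lt0n card_ffun card_ord.
    by rewrite expn_gt0 m_gt0.
  rewrite /local_prob (@eq_Ex _ _ _ (fun h => (inner (fireH h) set0 set0)%:R)); last by move=> h; rewrite mulr1.
  by rewrite E1 divr1 mulr1.
- by rewrite -setI_eq0 setI0.
- by move=> U GU; apply: depS dB; rewrite setCS.
- by move=> U GU; apply: Ex_ratio => h; rewrite ler0n.
Qed.

Let bad_le (Q : {ffun X -> H} -> R) : (forall h, 0 <= Q h <= 1) ->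
  0 <= Ex (fun h => (full (fireH h) set0)%:R * Q h) -
   Ex (fun h => (full (fireH h) set0 && G (held (fireH h) set0 W))%:R * Q h) <= eps * F.
Proof.
move=> Q01; rewrite -ExB; apply/andP; split.
  apply: Ex_ge0 => h; rewrite natr_andb; case/andP: (Q01 h) => q0 _.
  by case: full; case: (G _); rewrite ?mul1r ?mul0r ?subrr ?subr0.
apply: le_trans oe1.
have E := @equi_event X D nb m R card_D set0 W L (fun U _ => (~~ G U)%:R) LW.
rewrite (@eq_Ex _ _ (fun p => _) (fun p => (full (fireP p) set0)%:R * (~~ G (held (fireP p) set0 W))%:R)); last first.
  by move=> p; rewrite natr_andb.
rewrite -E; apply: le_Ex => h; rewrite natr_andb; case/andP: (Q01 h) => q0 q1.
by case: full; case: (G _); rewrite /= ?mul1r ?mul0r ?subrr ?subr0.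
Qed.

(** A trunk [Z] that avoids [W0] leaves a volume containing [W0], where [near] gives the law of [A].
    If [Z] meets [W0], some site outside of [W] is in the past of [W0]; this case is kept as an
    error term. *)
Let slice Z : ~: W \subset Z ->
  `|Ex (fun p => (tree p && (trunk nb W p == Z))%:R *
       (gamma (held (fireP p) set0 W) * phi (held (fireP p) set0 L))) -
    nu * Ex (fun p => (tree p && (trunk nb W p == Z))%:R * gamma (held (fireP p) set0 W))| <=
  eps * Ex (fun p => (tree p && (trunk nb W p == Z))%:R) +
  Ex (fun p => (tree p && (trunk nb W p == Z) && ~~ [disjoint Z & W0])%:R).
Proof.
move=> WZ; case: (boolP [disjoint Z & W0]) => dis; last first.
  rewrite -ExZ -ExB; apply: le_trans (Ex_norm _) _; rewrite -ExZ -ExD; apply: le_Ex => p.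
  rewrite andbT; case: (tree p && _); last by rewrite !mul0r !mulr0 subr0 normr0 addr0.
  rewrite !mul1r mulr1.
  have /andP[g0 g1] := gamma01 (held (fireP p) set0 W).
  have /andP[f0 f1] := phi01 (held (fireP p) set0 L).
  have /andP[n0 n1] := nu01.
  set g := gamma _ in g0 g1 *; set f := phi _ in f0 f1 *.
  have : 0 <= g * f <= 1 by rewrite mulr_ge0 // mulr_ile1.
  have : 0 <= nu * g <= 1 by rewrite mulr_ge0 // mulr_ile1.
  move=> h1 h2; rewrite ler_norml (_ : true%:R = 1 :> R) //; exact: dist_unit eps0 h1 h2.
set U := ~: Z.
have W0U : W0 \subset U by rewrite -disjoints_subset disjoint_sym.
have LU : L \subset U := subset_trans LW0 W0U.
have law := @local_law X D nb m R card_D W Z WZ L A gamma LU dA.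
set S1 := Ex _ in law *; set FU := Ex _ in law; set S2 := Ex _ in law *; set S3 := Ex _ in law.
have FU0 : 0 <= FU by apply: Ex_ge0 => h; rewrite ler0n.
have S20 : 0 <= S2.
  by apply: Ex_ge0 => p; rewrite mulr_ge0 ?ler0n //; case/andP: (gamma01 (held (fireP p) set0 W)).
have S2le : S2 <= Ex (fun p => (tree p && (trunk nb W p == Z))%:R).
  apply: le_Ex => p; rewrite ler_piMr ?ler0n //.
  by case/andP: (gamma01 (held (fireP p) set0 W)).
rewrite (_ : Ex (fun p => (tree p && (trunk nb W p == Z) && ~~ true)%:R) = 0); last first.
  by rewrite /Ex big1 ?mul0r // => p _; rewrite andbF.
rewrite addr0; apply: le_trans (_ : eps * S2 <= _); last by rewrite ler_wpM2l.
(* The identity [law] is divided by the probability [FU] that the complement of [Z] burns; if [FU]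
   is 0, no tree has trunk [Z]. *)
have [FZ|FN] := eqVneq FU 0; last first.
  have Fp : 0 < FU by rewrite lt0r FN.
  rewrite -(ler_pM2r Fp) -{1}(gtr0_norm Fp) -normrM.
  have -> : (S1 - nu * S2) * FU = S2 * (S3 - nu * FU) by rewrite mulrBl law; ring.
  rewrite normrM (ger0_norm S20) (_ : eps * S2 * FU = S2 * (eps * FU)); last by ring.
  rewrite ler_wpM2l //.
  exact: near.
have zero p : tree p && (trunk nb W p == Z) = false.
  rewrite trunk_split //; have := FZ; rewrite /FU full_transfer // => FZ'.
  have := Ex_eq0 (fun q => ler0n R (full (fireP q) (~: U))) FZ' p => /eqP.
  by rewrite pnatr_eq0 eqb0 => /negbTE ->; rewrite andbF.
have -> : S1 = 0 by rewrite /S1 /Ex big1 ?mul0r // => p _; rewrite zero mul0r.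
have -> : S2 = 0 by rewrite /S2 /Ex big1 ?mul0r // => p _; rewrite zero mul0r.
by rewrite !mulr0 subrr normr0.
Qed.

Let sum_trunk (f : {ffun X -> D} -> R) :
  Ex (fun p => (tree p)%:R * f p) =
  \sum_(Z : {set X} | ~: W \subset Z) Ex (fun p => (tree p && (trunk nb W p == Z))%:R * f p).
Proof.
rewrite -Ex_sum; apply: eq_Ex => p.
rewrite (bigD1 (trunk nb W p)) /=; last first.
  by apply/subsetP => x xW; rewrite inE; apply/exists_inP; exists x; rewrite ?connect0.
rewrite eqxx andbT big1 ?addr0 // => Z /andP[_ NE].
by rewrite eq_sym (negbTE NE) andbF mul0r.
Qed.

Let tree_side :
  `|Ex (fun p => (tree p)%:R * (gamma (held (fireP p) set0 W) * phi (held (fireP p) set0 L))) -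
    nu * Ex (fun p => (tree p)%:R * gamma (held (fireP p) set0 W))| <= 2 * eps * F.
Proof.
rewrite !sum_trunk mulr_sumr -sumrB; apply: le_trans (ler_norm_sum _ _ _) _.
apply: le_trans (ler_sum _ (fun Z ZW => slice ZW)) _.
rewrite big_split /= -mulr_sumr.
have -> : \sum_(Z : {set X} | ~: W \subset Z) Ex (fun p => (tree p && (trunk nb W p == Z))%:R) = F :> R.
  rewrite (@eq_Ex _ _ (fun p => (tree p)%:R) (fun p => (tree p)%:R * 1)); last by move=> p; rewrite mulr1.
  by rewrite sum_trunk; apply: eq_bigr => Z _; apply: eq_Ex => p; rewrite mulr1.
rewrite -[2]/(1 + 1) mulrDl mul1r mulrDl lerD2l; apply: le_trans oe0.
rewrite -Ex_sum; apply: le_Ex => p.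
rewrite (bigD1 (trunk nb W p)) /=; last first.
  by apply/subsetP => x xW; rewrite inE; apply/exists_inP; exists x; rewrite ?connect0.
rewrite big1 ?addr0; last first.
  by move=> Z /andP[_ NE]; rewrite eq_sym (negbTE NE) andbF.
rewrite eqxx andbT; case: (boolP (tree p)) => //= tp; rewrite ler_nat.
case: (boolP [disjoint _ & _]) => //=; rewrite -setI_eq0 => /set0Pn[w].
rewrite !inE => /andP[/exists_inP[x xW xw] wW]; rewrite lt0b.
apply/subsetPn; exists x; last by rewrite inE in xW.
by rewrite /held tree_clC // inE; apply/exists_inP; exists w.
Qed.

Let Ftrans : Ex (fun h => (full (fireH h) set0)%:R : R) = F.
Proof. by rewrite full_transfer. Qed.

(** [tree_side] costs [2 * eps], one for [near] and one for the trunks that meet [W0]; restricting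
    to [G] costs [eps] for each of the two expectations. *)
Lemma mixing :
  `|Ex (fun h => (full (fireH h) set0)%:R * (A h * B h)) -
    nu * Ex (fun h => (full (fireH h) set0)%:R * B h)| <=
  4 * eps * Ex (fun h => (full (fireH h) set0)%:R).
Proof.
have AB01 h : 0 <= A h * B h <= 1.
  case/andP: (A01 h) => a0 a1; case/andP: (B01 h) => b0 b1.
  by rewrite mulr_ge0 // mulr_ile1.
have /andP[p1 p2] := bad_le AB01; have /andP[p3 p4] := bad_le B01.
rewrite good_AB in p1 p2; rewrite good_B in p3 p4.
have := tree_side; rewrite Ftrans.
set T1 := Ex _ in p1 p2 *; set T2 := Ex _ in p1 p2 *; set T3 := Ex _ in p3 p4 *.
set T4 := Ex _ in p3 p4 *; have /andP[n0 n1] := nu01.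
have q1 : nu * (T3 - T4) <= eps * F by apply: le_trans p4; rewrite ler_piMl.
have q0 : 0 <= nu * (T3 - T4) by rewrite mulr_ge0.
rewrite !ler_norml => /andP[t1 t2]; rewrite mulrBr in q0 q1.
by apply/andP; split; lra.
Qed.

End Mixing.

(** * Dhar's criterion *)

Section Lattice.
Variable d : nat.
Implicit Types (x y z : site d) (e : 'I_d * bool).

Definition nbr x e : site d :=
  [ffun k => if k == e.1 then x k + (if e.2 then 1 else -1) else x k].

Lemma dist1_nbr x e : dist1 (nbr x e) x = 1%N.
Proof.
rewrite /dist1 (bigD1 e.1) //= big1 ?addn0; last first.
  by move=> k /negbTE ke; rewrite ffunE ke subrr.
by rewrite ffunE eqxx addrAC subrr add0r; case: e.2.
Qed.

Lemma dist1_nbrP x y : dist1 x y = 1%N -> exists e, x = nbr y e.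
Proof.
move=> D1; have [i ni] : exists i, x i != y i.
  apply/existsP; rewrite -[[exists _, _]]negbK negb_exists; apply/negP => /forallP eqs.
  move: D1; rewrite /dist1 big1 // => k _; have := eqs k; rewrite negbK => /eqP ->.
  by rewrite subrr.
move: D1; rewrite /dist1 (bigD1 i) //= => D1.
have p : (0 < `|x i - y i|)%N by rewrite absz_gt0 subr_eq0.
set S := bigop _ _ _ in D1; have [E1 /eqP] : `|x i - y i|%N = 1%N /\ S = 0%N by lia.
rewrite sum_nat_eq0 => /forallP Z.
exists (i, 0 < x i - y i); apply/ffunP => k; rewrite ffunE /=.
case: eqP => [->|/eqP ki]; last first.
  by have := Z k; rewrite ki implyTb => /eqP/eqP; rewrite absz_eq0 subr_eq0 => /eqP.
by case: ifP; lia.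
Qed.

Lemma nbr_inj x : injective (nbr x).
Proof.
move=> [i a] [j b] /ffunP E; have := E i; rewrite !ffunE /= eqxx.
case: eqP => [<-|_]; last by case: a E => E; lia.
by case: a E; case: b => E; lia || move=> _.
Qed.

Lemma nbrK x e : nbr (nbr x e) (e.1, ~~ e.2) = x.
Proof.
apply/ffunP => k; rewrite !ffunE /=; case: eqP => // _.
by case: e.2 => /=; rewrite -addrA ?subrr ?addNr addr0.
Qed.

Lemma lapE x z : lap z x = \sum_(e : 'I_d * bool) ((x == z)%:Z - (nbr x e == z)%:Z).
Proof.
rewrite sumrB sumr_const card_prod card_ord card_bool /lap (eq_sym z x).
have [->|xz] := eqVneq x z.
  rewrite big1 ?subr0; first by lia.
  move=> e _; have [E|//] := eqVneq (nbr z e) z; have := dist1_nbr z e.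
  by rewrite E /dist1 big1 // => k _; rewrite subrr.
rewrite mul0rn add0r; have [/dist1_nbrP[e ze]|far] := eqVneq (dist1 z x) 1%N.
  rewrite (bigD1 e) //= ze eqxx big1 ?addr0 //.
  by move=> e' ne; have [/nbr_inj E|//] := eqVneq (nbr x e') (nbr x e); rewrite E eqxx in ne.
rewrite big1 ?oppr0 // => e _.
by have [E|//] := eqVneq (nbr x e) z; move: far; rewrite -E dist1_nbr.
Qed.

Lemma lap_sym x z : lap z x = lap x z.
Proof.
rewrite /lap (eq_sym z x); have -> // : dist1 z x = dist1 x z.
by apply: eq_bigr => i _; rewrite distnC.
Qed.

End Lattice.

Section Sandpile.
Variables (d : nat) (V : {fset site d}).
Hypothesis d_gt0 : (0 < d)%N.
Local Notation D := ('I_d * bool)%type.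
Local Notation X := (V : finType).
Implicit Types (x y z : V) (e : D) (F : {set V}) (xi : site d -> int).
Implicit Types (eta : {ffun V -> height d}).

Definition nbV x e : option V := insub (nbr (val x) e).

Lemma nbV_eq x y e : (nbV x e == Some y) = (nbr (val x) e == val y).
Proof.
rewrite /nbV; case: insubP => [u _ <-|nV] //=.
by symmetry; apply: contraNF nV => /eqP ->; apply: valP.
Qed.

Definition degF F x := #|[set e | oapp (mem F) false (nbV x e)]|.

Lemma degFE F x : (degF F x)%:Z = \sum_e (oapp (mem F) false (nbV x e))%:Z.
Proof.
rewrite /degF -natz -sum1dep_card natr_sum big_mkcond /=; apply: eq_bigr => e _.
by case: ifP.
Qed.

Lemma degF_self F x : oapp (mem F) false (Some x) -> F :\ x = set0 -> degF F x = 0%N.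
Proof.
move=> xF F0; apply/eqP; rewrite cards_eq0; apply/eqP/setP => e; rewrite !inE.
case E: (nbV x e) => [y|] //=; apply/negbTE/negP => yF.
have : y \in F :\ x.
  rewrite !inE yF andbT; apply/eqP => yx; move/eqP: E; rewrite nbV_eq yx => /eqP E.
  have := dist1_nbr (val x) e; rewrite E /dist1 big1 // => k _; by rewrite subrr.
by rewrite F0 inE.
Qed.

(** Absence of forbidden subconfigurations, stated for unstable configurations too, so that it can
    be followed through single topplings. *)
Definition allowed xi :=
  forall F, F != set0 -> exists2 x, x \in F & (degF F x)%:Z < xi (val x).

Lemma lap_le0 x z : x != z -> lap (val z) (val x) <= 0.
Proof. by rewrite /lap (inj_eq val_inj) eq_sym => /negbTE ->; case: ifP. Qed.

Lemma lap_diag (x : site d) : lap x x = (2 * d)%:Z.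
Proof. by rewrite /lap eqxx. Qed.

Lemma topple_in xi z x : topple V (val z) xi (val x) = xi (val x) - lap (val z) (val x).
Proof. by rewrite /topple (valP x). Qed.

(** If [z] is in [F], use [F :\ z]: an edge from [x] to [z] raises the degree in [F] by one, and [x]
    receives one grain along it. If [F] is only [z], legality leaves [z] a positive height. *)
Lemma allowed_topple xi xi' : legal_topple V xi xi' -> allowed xi -> allowed xi'.
Proof.
case=> z' zV [big ->]; set z : V := FSetSub zV; have -> : z' = val z by [].
have {}big : (2 * d)%:Z < xi (val z) by [].
move=> al F F0; case: (boolP (z \in F)) => zF; last first.
  have [x xF lt] := al F F0; exists x => //; rewrite topple_in.
  apply: lt_le_trans lt _; rewrite lerDl oppr_ge0 lap_le0 //.
  by apply: contraNneq zF => <-.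
have [E|NE] := eqVneq (F :\ z) set0.
  by exists z => //; rewrite topple_in lap_diag degF_self //; lia.
have [x] := al _ NE; rewrite !inE => /andP[xz xF] lt; exists x => //.
rewrite topple_in lapE (inj_eq val_inj) (negbTE xz).
have -> : (degF F x)%:Z = (degF (F :\ z) x)%:Z - \sum_e ((false)%:Z - (nbr (val x) e == val z)%:Z).
  rewrite !degFE -sumrB; apply: eq_bigr => e _; rewrite -nbV_eq.
  case: (nbV x e) => [y|] //=; rewrite !inE (inj_eq Some_inj).
  by have [->|_] := eqVneq y z; rewrite /= ?zF; lia.
by rewrite ltrD2r.
Qed.

Lemma allowed_topples xi xi' : clos_refl_trans _ (legal_topple V) xi xi' -> allowed xi -> allowed xi'.
Proof. by elim=> [? ? /allowed_topple|//|x y z _ h1 _ h2 /h1/h2]. Qed.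

Lemma allowed_le xi xi' : (forall x : V, xi (val x) <= xi' (val x)) -> allowed xi -> allowed xi'.
Proof.
move=> le al F F0; have [x xF lt] := al F F0; exists x => //.
exact: lt_le_trans lt (le x).
Qed.

Lemma emb_in eta x : emb eta (val x) = hval (eta x).
Proof. by rewrite /emb valK. Qed.

Lemma emb_out eta (u : site d) : u \notin V -> emb eta u = 0.
Proof. by move=> uV; rewrite /emb insubN. Qed.

Lemma hval_bound (h : height d) : 1 <= hval h <= (2 * d)%:Z.
Proof.
rewrite /hval /=; move: (ltn_ord h) d_gt0; move: (nat_of_ord h) => k kd d0.
by rewrite lez_nat; lia.
Qed.

Lemma emb_onto xi : (forall x : V, 1 <= xi (val x) <= (2 * d)%:Z) ->
  (forall u, u \notin V -> xi u = 0) -> exists eta, emb eta = xi.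
Proof.
move=> b0 out; exists [ffun x : V => inord (absz (xi (val x))).-1].
apply/funext => u; case: (boolP (u \in V)) => uV; last by rewrite emb_out ?out.
have -> : u = val (FSetSub uV : V) by [].
rewrite emb_in ffunE /hval; have := b0 (FSetSub uV); move: (xi _) => k.
move: d_gt0 => d0 kb; rewrite /= inordK; lia.
Qed.

Lemma allowed_full eta : allowed (emb eta) <-> cl (fireH nbV eta) set0 set0 == setT.
Proof.
have mo := @fireK_mono V D nbV (fun x => eta x : nat).
have eq1 F x : fireH nbV eta x (~: F) = ((degF F x)%:Z < emb eta (val x)).
  rewrite fireHE emb_in /hval; set O := opn nbV _ x.
  have <- : (#|O| + degF F x)%N = #|{: D}|.
    rewrite addnC -(cardsC [set e | oapp (mem F) false (nbV x e)]); congr (_ + _)%N.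
    by apply: eq_card => e; rewrite !inE; case: (nbV x e) => [y|] //=; rewrite inE.
  by rewrite addnC leq_add2r ltz_nat ltnS.
have := @cl_fullP V (fireH nbV eta) setT mo; rewrite setCT => P.
split=> [al|/P cf F F0].
  by apply/P => F _ F0; have [x xF lt] := al F F0; exists x => //; rewrite eq1.
by have [x xF] := cf F (subsetT _) F0; rewrite eq1 => lt; exists x.
Qed.

Lemma topples_lap xi zeta : clos_refl_trans _ (legal_topple V) xi zeta ->
  exists g : V -> int, forall x, xi (val x) - zeta (val x) =
    \sum_e (g x - oapp g 0 (nbV x e)).
Proof.
elim=> [u v [z' zV [_ ->]]|u|u v w _ [g Eg] _ [k Ek]].
- pose z : V := FSetSub zV; exists (fun x => (x == z)%:Z) => x.
  have -> : z' = val z by [].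
  rewrite topple_in lapE subKr; apply: eq_bigr => e _; congr (_ - _).
  by rewrite -nbV_eq; case: (nbV x e).
- exists (fun=> 0) => x; rewrite subrr big1 // => e _; by case: (nbV x e).
- exists (fun x => g x + k x) => x; rewrite -(subrK (v (val x)) (u (val x))) -addrA Eg Ek -big_split /=.
  by apply: eq_bigr => e _; case: (nbV x e) => [y|] /=; lia.
Qed.

(** On the set [F] where [g] is maximal, allowedness yields a site with [xi2] above its degree in
    [F]. If the maximum is positive, [xi1] exceeds [2 * d] there, contrary to stability. *)
Lemma lap_maximum xi1 xi2 (g : V -> int) : allowed xi2 -> stable_on V xi1 ->
  (forall x, xi1 (val x) - xi2 (val x) = \sum_e (g x - oapp g 0 (nbV x e))) ->
  forall x, g x <= 0.
Proof.
move=> al st E y0; rewrite leNgt; apply/negP => gy0.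
case: (@arg_maxP _ _ V y0 xpredT g isT) => xm _ xmax.
pose F := [set x | g x == g xm].
have F0 : F != set0 by apply/set0Pn; exists xm; rewrite inE.
have [x xF lt] := al F F0; have := st (val x) (valP x).
have : \sum_e (g x - oapp g 0 (nbV x e)) >= \sum_e (1 - (oapp (mem F) false (nbV x e))%:Z).
  apply: ler_sum => e _; move: xF; rewrite inE => /eqP ->.
  have gm : 0 < g xm by apply: lt_le_trans gy0 (xmax y0 isT).
  case: (nbV x e) => [y|] /=; last by lia.
  by rewrite inE; have := xmax y isT; case: eqP => [->|ne] /= le; lia.
rewrite -E sumrB -degFE sumr_const card_prod card_ord card_bool.
have -> : (1 : int) *+ (d * 2) = (2 * d)%:Z by lia.
move: (xi1 _) (xi2 _) (degF F x) lt => a b c; clear; lia.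
Qed.

Lemma lap_inj xi1 xi2 (g : V -> int) : allowed xi1 -> allowed xi2 ->
  stable_on V xi1 -> stable_on V xi2 ->
  (forall x, xi1 (val x) - xi2 (val x) = \sum_e (g x - oapp g 0 (nbV x e))) ->
  forall x, xi1 (val x) = xi2 (val x).
Proof.
move=> a1 a2 s1 s2 E x.
have l1 := lap_maximum a2 s1 E.
have l2 : forall x, - g x <= 0.
  apply: (lap_maximum a1 s2) => y; rewrite -[LHS]opprB E -sumrN; apply: eq_bigr => e _.
  by case: (nbV y e) => [u|] /=; lia.
have g0 y : g y = 0 by have := l1 y; have := l2 y; lia.
apply/eqP; rewrite -subr_eq0 E big1 // => e _; rewrite g0.
by case: (nbV x e) => [u|] //=; rewrite g0.
Qed.

Definition positive_on xi := forall x, 1 <= xi (val x).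

Lemma topple_positive xi xi' : legal_topple V xi xi' -> positive_on xi -> positive_on xi'.
Proof.
case=> z' zV [big ->] p x; pose z : V := FSetSub zV; have -> : z' = val z by [].
have {}big : (2 * d)%:Z < xi (val z) by [].
rewrite topple_in; have [->|xz] := eqVneq x z; first by rewrite lap_diag; lia.
by apply: le_trans (p x) _; rewrite lerDl oppr_ge0 lap_le0.
Qed.

Lemma topple_out xi xi' u : legal_topple V xi xi' -> u \notin V -> xi' u = xi u.
Proof. by case=> z zV [_ ->] /negbTE uV; rewrite /topple uV. Qed.

Section Potential.
Let i0 : 'I_d := Ordinal d_gt0.
(** [w] is nonnegative on [V] and its neighbours, and the sum of its drops to the neighbours is 2
    everywhere, so each toppling lowers the weighted mass [Phi] by at least 2. *)
Let A : int := \sum_(y : V) (`|val y i0| + 1) ^+ 2.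
Let w (u : site d) : int := A - (u i0) ^+ 2.
Let Phi xi : int := \sum_(y : V) xi (val y) * w (val y).

Let wA (x : V) (k : int) : `|k| <= `|val x i0| + 1 -> 0 <= A - k ^+ 2.
Proof.
move=> kx; rewrite subr_ge0 /A (bigD1 x) //= -[k ^+ 2]addr0 lerD //; last first.
  by apply: sumr_ge0 => y _; rewrite sqr_ge0.
by rewrite -(real_normK (num_real k)) lerXn2r ?nnegrE // addr_ge0.
Qed.

Let w_in (x : V) : 0 <= w (val x).
Proof. by apply: (wA (x := x)); rewrite lerDl. Qed.

Let w_nbr (x : V) e : 0 <= w (nbr (val x) e).
Proof.
apply: (wA (x := x)); rewrite ffunE; case: eqP => _; last by rewrite lerDl.
by apply: le_trans (ler_normD _ _) _; rewrite lerD2l; case: e.2.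
Qed.

Let w_lap (x : site d) : \sum_e (w x - w (nbr x e)) = 2.
Proof.
rewrite -(pair_bigA _ (fun i b => w x - w (nbr x (i, b)))) /= (bigD1 i0) //= [X in _ + X]big1 ?addr0.
  by rewrite big_bool /= /w !ffunE /= ?eqxx; ring.
move=> i ii0; rewrite big1 // => b _.
by rewrite /w ffunE /= eq_sym (negbTE ii0) subrr.
Qed.

Let Phi_topple xi xi' : legal_topple V xi xi' -> Phi xi' <= Phi xi - 2.
Proof.
case=> z' zV [big ->]; pose z : V := FSetSub zV; have -> : z' = val z by [].
have -> : Phi (topple V (val z) xi) = Phi xi - \sum_(y : V) lap (val z) (val y) * w (val y).
  by rewrite /Phi -sumrB; apply: eq_bigr => y _; rewrite topple_in mulrBl.
rewrite lerD2l lerN2 -(w_lap (val z)).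
under [X in _ <= X]eq_bigr do rewrite lap_sym lapE mulr_suml.
rewrite exchange_big; apply: ler_sum => e _ /=.
rewrite (eq_bigr (fun y : V => (val z == val y)%:Z * w (val y) - (nbr (val z) e == val y)%:Z * w (val y))); last first.
  by move=> y _; rewrite mulrBl.
rewrite sumrB lerB //.
  by rewrite (bigD1 z) //= eqxx mul1r lerDl sumr_ge0 // => y _; rewrite mulr_ge0 //; apply: w_in.
case: (boolP (nbr (val z) e \in V)) => nV; last first.
  rewrite big1 ?(w_nbr z e) // => y _; have [E|_] := eqVneq; last by rewrite mul0r.
  by rewrite E (valP y) in nV.
rewrite (bigD1 (FSetSub nV)) //= eqxx mul1r big1 ?addr0 // => y ne.
have [E|_] := eqVneq; last by rewrite mul0r.
by case/eqP: ne; apply: val_inj.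
Qed.

Lemma stabilization xi : positive_on xi -> exists2 zeta,
  stabilizes V xi zeta & positive_on zeta /\ forall u, u \notin V -> zeta u = xi u.
Proof.
have [n] := ubnP (absz (Phi xi)); elim: n xi => // n IH xi lt pos.
case: (pselect (stable_on V xi)) => [st|/existsNP[z]].
  by exists xi => //; split=> //; apply: rt_refl.
move=> /not_implyP[zV /negP]; rewrite -ltNge => big.
have lt1 : legal_topple V xi (topple V z xi) by exists z.
have pos' := topple_positive lt1 pos.
have P0 zz : positive_on zz -> 0 <= Phi zz.
  move=> p; apply: sumr_ge0 => y _; rewrite mulr_ge0 //.
  by apply: le_trans (p y).
have [|zeta [t s] [p o]] := IH (topple V z xi) _ pos'.
  by move: (Phi_topple lt1) (P0 _ pos) (P0 _ pos') lt; move: (Phi _) (Phi _) => a b; lia.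
exists zeta; first by split=> //; apply: rt_trans t; apply: rt_step.
by split=> // u uV; rewrite o // (topple_out lt1).
Qed.

End Potential.

(** A site of [F] with largest first coordinate has a neighbour outside of [F]. *)
Lemma max_allowed : allowed (fun=> (2 * d)%:Z).
Proof.
move=> F /set0Pn[x0 x0F]; pose i0 : 'I_d := Ordinal d_gt0.
case: (@arg_maxP _ _ V x0 (mem F) (fun x => val x i0) x0F) => x xF xmax; exists x => //.
rewrite ltz_nat mulnC -[X in (_ < _ * X)%N]card_bool -[X in (_ < X * _)%N]card_ord -card_prod -cardsT.
apply: proper_card; rewrite properT; apply/negP => /eqP/setP/(_ (i0, true)).
rewrite !inE; case E: (nbV _ _) => [y|] //= /xmax.
by move/eqP: E; rewrite nbV_eq => /eqP <-; rewrite ffunE eqxx /=; lia.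
Qed.

Lemma step_allowed eta eta' : chain_step eta eta' -> allowed (emb eta) -> allowed (emb eta').
Proof.
case=> x xV [st _] al; apply: allowed_topples st _.
by apply: allowed_le al => y; rewrite lerDl /delta.
Qed.

Lemma steps_allowed eta eta' : clos_refl_trans _ (@chain_step d V) eta eta' ->
  allowed (emb eta) -> allowed (emb eta').
Proof. by elim=> [? ? /step_allowed|//|x y z _ h1 _ h2 /h1/h2]. Qed.

Lemma add_positive eta u : positive_on (fun y : site d => emb eta y + delta u y).
Proof.
move=> x; rewrite emb_in; have /andP[h1 _] := hval_bound (eta x).
by rewrite -[1]addr0 lerD // /delta.
Qed.

Lemma step_total eta x : exists eta' : {ffun V -> height d},
  stabilizes V (fun y : site d => emb eta y + delta (val x) y) (emb eta').
Proof.
have [zeta [t s] [p o]] := stabilization (@add_positive eta (val x)).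
have [|u uV|eta' E] := @emb_onto zeta.
- by move=> y; rewrite p /=; apply: s; apply: valP.
- rewrite o // emb_out // /delta; case: eqP => // E.
  by rewrite E (valP x) in uV.
by exists eta'; rewrite E; split.
Qed.

Lemma emb_inj eta1 eta2 : (forall x, emb eta1 (val x) = emb eta2 (val x)) -> eta1 = eta2.
Proof.
move=> E; apply/ffunP => x; have := E x; rewrite !emb_in /hval => -[] k.
exact: val_inj.
Qed.

Lemma emb_stable eta : stable_on V (emb eta).
Proof.
move=> u uV; have -> : u = val (FSetSub uV : V) by [].
by rewrite emb_in; case/andP: (hval_bound (eta (FSetSub uV))).
Qed.

(** Two preimages of one configuration differ by the Laplacian of the difference of their toppling
    numbers, so [lap_inj] identifies them. *)
Lemma step_inj eta1 eta2 zeta u : allowed (emb eta1) -> allowed (emb eta2) ->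
  stabilizes V (fun y : site d => emb eta1 y + delta u y) zeta ->
  stabilizes V (fun y : site d => emb eta2 y + delta u y) zeta -> eta1 = eta2.
Proof.
move=> a1 a2 [/topples_lap[g Eg] _] [/topples_lap[k Ek] _]; apply: emb_inj.
apply: (lap_inj (g := fun x => g x - k x)) => //; try exact: emb_stable.
move=> x; transitivity ((emb eta1 (val x) + delta u (val x) - zeta (val x)) -
   (emb eta2 (val x) + delta u (val x) - zeta (val x))); first by ring.
rewrite Eg Ek -sumrB; apply: eq_bigr => e _.
by case: (nbV x e) => [y|] /=; ring.
Qed.

(** Adding at [u] permutes the finite set of allowed configurations, so iterating it leads back to
    the start. *)
Lemma step_back eta eta' : chain_step eta eta' -> allowed (emb eta) ->
  clos_refl_trans _ (@chain_step d V) eta' eta.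
Proof.
case=> u uV st al; pose x : V := FSetSub uV; have ux : u = val x by [].
have [f0 f0P] := choice (fun c => step_total c x).
(* [f] is the identity off the allowed configurations, to be injective everywhere, and is set to the
   given successor [eta'] at [eta], so that no uniqueness of the stabilisation is needed. *)
pose f c := if `[< allowed (emb c) >] then (if c == eta then eta' else f0 c) else c.
have fst c : allowed (emb c) -> stabilizes V (fun y : site d => emb c y + delta u y) (emb (f c)).
  by move=> /asboolT ae; rewrite /f ae; have [->|_] := eqVneq c eta.
have fal c : allowed (emb c) -> allowed (emb (f c)).
  by move=> ae; apply: (@step_allowed c) => //; exists u => //; apply: fst.
have finj : injective f.
  move=> c1 c2 E.
  have [a1|n1] := pselect (allowed (emb c1)); have [a2|n2] := pselect (allowed (emb c2)).
  - by apply: (step_inj a1 a2 (fst _ a1)); rewrite E; apply: fst.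
  - have E2 : f c2 = c2 by rewrite /f (asboolF n2).
    by case: (n2); rewrite -E2 -E; apply: fal.
  - have E1 : f c1 = c1 by rewrite /f (asboolF n1).
    by case: (n1); rewrite -E1 E; apply: fal.
  - by move: E; rewrite /f (asboolF n1) (asboolF n2).
have fe : f eta = eta' by rewrite /f (asboolT al) eqxx.
have : fconnect f eta' eta by rewrite fconnect_sym // -fe fconnect1.
move=> cn; rewrite -[X in clos_refl_trans _ _ _ X](iter_findex cn).
have al' : allowed (emb eta') by rewrite -fe; apply: fal.
elim: (findex f eta' eta) => [|n IH] /=; first exact: rt_refl.
apply: rt_trans IH _; apply: rt_step; exists u => //; apply: fst.
by elim: n => //= n IH; apply: fal.
Qed.

Lemma steps_back eta eta' : clos_refl_trans _ (@chain_step d V) eta eta' -> allowed (emb eta) ->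
  clos_refl_trans _ (@chain_step d V) eta' eta.
Proof.
elim=> [? ? /step_back|*|x y z xy h1 _ h2 ax]; [exact|exact: rt_refl|].
by apply: rt_trans (h2 _) (h1 ax); apply: steps_allowed ax.
Qed.

Lemma reach_max eta : exists2 eta', clos_refl_trans _ (@chain_step d V) eta eta' &
  forall x, emb eta' (val x) = (2 * d)%:Z.
Proof.
pose def (c : {ffun V -> height d}) := absz (\sum_(x : V) ((2 * d)%:Z - emb c (val x))).
have [n] := ubnP (def eta); elim: n eta => // n IH eta lt.
case: (pselect (forall x, emb eta (val x) = (2 * d)%:Z)) => [mx|/existsNP[x /eqP nx]].
  by exists eta => //; apply: rt_refl.
have bnd y := hval_bound (eta y).
have [|u uV|eta' E] := @emb_onto (fun y : site d => emb eta y + delta (val x) y).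
- move=> y; rewrite emb_in /delta (inj_eq val_inj); move: (bnd y) nx.
  by have [->|_] := eqVneq y x; rewrite ?emb_in ?addr0 //; move: (hval _) => k; lia.
- rewrite emb_out // /delta; case: eqP => // E.
  by rewrite E (valP x) in uV.
have st : chain_step eta eta'.
  exists (val x); first exact: valP.
  rewrite -E; split; first exact: rt_refl.
  exact: emb_stable.
have [|e t mx] := IH eta'; last by exists e => //; apply: rt_trans t; apply: rt_step.
have S0 (c : {ffun V -> height d}) : 0 <= \sum_(y : V) ((2 * d)%:Z - emb c (val y)).
  by apply: sumr_ge0 => y _; rewrite emb_in subr_ge0; case/andP: (hval_bound (c y)).
have Sd : \sum_(y : V) ((2 * d)%:Z - emb eta' (val y)) =
    \sum_(y : V) ((2 * d)%:Z - emb eta (val y)) - 1.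
  rewrite E (bigD1 x) //= [in RHS](bigD1 x) //= /delta eqxx.
  rewrite (eq_bigr (fun y : V => (2 * d)%:Z - emb eta (val y))); first by rewrite /= [_ + _%:Z]addrC (_ : Posz true = 1) //; ring.
  by move=> y yx; rewrite (inj_eq val_inj) (negbTE yx) addr0.
by move: (S0 eta) (S0 eta') lt; rewrite /def Sd; move: (bigop _ _ _) => k; lia.
Qed.

(** A recurrent configuration is reached back from the maximal one, which is allowed, and steps
    preserve allowedness. Conversely, steps from an allowed configuration can be undone. *)
Lemma RV_full : RV V = [set eta | cl (fireH nbV eta) set0 set0 == setT].
Proof.
apply/setP => eta; rewrite !inE; apply/asboolP/idP => [rec|/allowed_full al eta' tt].
  apply/allowed_full; have [e t mx] := reach_max eta.
  apply: steps_allowed (rec _ t) _; apply: allowed_le max_allowed => x.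
  by rewrite mx.
exact: steps_back tt al.
Qed.

End Sandpile.

(** * Sub-volumes and minimal height patterns *)

Section Restriction.
Variables (R : realFieldType) (X Y T : finType) (phi : X -> Y).
Hypotheses (injphi : injective phi) (T0 : (0 < #|T|)%N).

Definition pull (h : {ffun Y -> T}) : {ffun X -> T} := [ffun x => h (phi x)].

(** The fibres of the restriction all have the same size. *)
Lemma Ex_pull (G : {ffun X -> T} -> R) : Ex (fun h => G (pull h)) = Ex G.
Proof.
pose c := (\prod_y (if y \in phi @: setT then 1%N else #|T|))%N.
have fiber (g : {ffun X -> T}) : #|[set h : {ffun Y -> T} | pull h == g]| = c.
  have -> : [set h : {ffun Y -> T} | pull h == g] =
      [set h : {ffun Y -> T} | [forall y, [pred t | [forall x, (phi x == y) ==> (t == g x)]] (h y)]].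
    apply/setP => h; rewrite !inE; apply/eqP/forallP => [<- y|H].
      by apply/forallP => x; apply/implyP => /eqP <-; rewrite ffunE.
    apply/ffunP => x; rewrite ffunE; have /forallP/(_ x) := H (phi x).
    by rewrite eqxx => /eqP.
  rewrite (@card_ffun_forall _ _ (fun y => [pred t | [forall x, (phi x == y) ==> (t == g x)]])).
  apply: eq_bigr => y _; case: ifP => [/imsetP[x _ ->]|ny].
    rewrite -(card1 (g x)); apply: eq_card => t; rewrite !inE.
    apply/forallP/eqP => [/(_ x)|-> x']; first by rewrite eqxx => /eqP.
    by apply/implyP => /eqP/injphi ->.
  apply: eq_card => t; rewrite !inE; apply/forallP => x; apply/implyP => /eqP E.
  by rewrite -E imset_f ?inE in ny.
have sum (G' : {ffun X -> T} -> R) : \sum_(h : {ffun Y -> T}) G' (pull h) = c%:R * \sum_g G' g.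
  rewrite (partition_big pull xpredT) //= mulr_sumr; apply: eq_bigr => g _.
  rewrite (eq_bigr (fun=> G' g)); last by move=> h /eqP ->.
  by rewrite sumr_const mulr_natl -(fiber g); congr (_ *+ _); rewrite cardsE.
have := sum (fun=> 1); rewrite !sumr_const -[_ *+ _]/(_%:R) -[X in _ * X]/(_%:R) => E.
rewrite /Ex sum E invfM mulrACA divff ?mul1r //.
by rewrite pnatr_eq0 -lt0n prodn_gt0 // => y; case: ifP.
Qed.

End Restriction.

Section Embedding.
Variables (X Y D : finType) (nbX : X -> D -> option X) (nbY : Y -> D -> option Y).
Variables (phi : X -> Y) (m : nat) (R : realFieldType).
Hypotheses (injphi : injective phi).
(** [X] is a sub-volume of [Y]; its sink is the complement of the image together with the sink of
    [Y]. *)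
Definition embedding := forall x e, match nbX x e, nbY (phi x) e with
  | Some x', Some y => y = phi x' | Some _, None => False
  | None, Some y => y \notin phi @: setT | None, None => True end.
Hypothesis emb : embedding.
Local Notation I := (~: (phi @: [set: X])).
Implicit Types (B L U : {set Y}).

Lemma opn_emb x B : I \subset B -> opn nbY B (phi x) = opn nbX (phi @^-1: B) x.
Proof.
move=> IB; apply/setP => e; rewrite !inE; have := emb x e.
case: (nbX x e) => [x'|]; case: (nbY (phi x) e) => [y|] //; first by move=> ->; rewrite inE.
by move=> nI; apply: (subsetP IB); rewrite inE.
Qed.

Lemma fireH_emb (h : {ffun Y -> 'I_m}) x B : I \subset B ->
  fireH nbY h (phi x) B = fireH nbX (pull phi h) x (phi @^-1: B).
Proof. by move=> IB; rewrite !fireHE opn_emb // ffunE. Qed.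

Lemma fireP_emb (p : {ffun Y -> D}) x B : I \subset B ->
  fireP nbY p (phi x) B = fireP nbX (pull phi p) x (phi @^-1: B).
Proof. by move=> IB; rewrite !firePE opn_emb // ffunE. Qed.

Lemma preim_compl : phi @^-1: I = set0.
Proof. by apply/setP => x; rewrite !inE imset_f. Qed.

Lemma clH_emb (h : {ffun Y -> 'I_m}) L B : I \subset B ->
  phi @^-1: cl (fireH nbY h) L B = cl (fireH nbX (pull phi h)) (phi @^-1: L) (phi @^-1: B).
Proof.
move=> IB; apply: cl_iso => //; [exact: fireH_mono|exact: fireH_mono|].
by move=> x C; apply: fireH_emb.
Qed.

Lemma clP_emb (p : {ffun Y -> D}) L B : I \subset B ->
  phi @^-1: cl (fireP nbY p) L B = cl (fireP nbX (pull phi p)) (phi @^-1: L) (phi @^-1: B).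
Proof.
move=> IB; apply: cl_iso => //; [exact: firep_mono|exact: firep_mono|].
by move=> x C; apply: fireP_emb.
Qed.

Lemma preim_full B : I \subset B -> (B == setT) = (phi @^-1: B == setT).
Proof.
move=> IB; apply/eqP/eqP => [->|E]; first by rewrite preimsetT.
apply/setP => y; rewrite inE; case: (boolP (y \in phi @: setT)) => [/imsetP[x _ ->]|yI].
  by have := in_setT x; rewrite -E inE.
by apply: (subsetP IB); rewrite inE.
Qed.

Lemma fullH_emb (h : {ffun Y -> 'I_m}) :
  full (fireH nbY h) I = full (fireH nbX (pull phi h)) set0.
Proof. by rewrite /full preim_full ?cl_sub // clH_emb // preim_compl preimset0. Qed.

Lemma fullP_emb (p : {ffun Y -> D}) :
  full (fireP nbY p) I = full (fireP nbX (pull phi p)) set0.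
Proof. by rewrite /full preim_full ?cl_sub // clP_emb // preim_compl preimset0. Qed.

Lemma inner_emb (h : {ffun Y -> 'I_m}) (L : {set X}) :
  inner (fireH nbY h) (phi @: L) (phi @: setT) = inner (fireH nbX (pull phi h)) L setT.
Proof.
rewrite /inner setCT; congr (_ && _); last exact: fullH_emb.
have P x : fireH nbY h (phi x) I = fireH nbX (pull phi h) x set0.
  by rewrite fireH_emb // preim_compl.
apply/forall_inP/forall_inP => [H x|H y].
  rewrite inE => /andP[xL _]; rewrite -P; apply: H.
  by rewrite inE mem_imset // xL imset_f.
rewrite inE => /andP[yL /imsetP[x _ E]]; rewrite E P; apply: H.
by rewrite !inE -(mem_imset _ _ injphi) -E yL.
Qed.

End Embedding.

(** * A height pattern on a set that certifies burning without its help *)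

Section Minimal.
Variables (X D : finType) (nb : X -> D -> option X) (rev : D -> D) (Pos : {set D}) (m : nat).
Variables (rk : X -> int).
Hypothesis nb_rev : forall x e y, nb x e = Some y -> nb y (rev e) = Some x.
Hypothesis revPos : forall e, (rev e \in Pos) = (e \notin Pos).
Hypothesis rkP : forall x e y, nb x e = Some y -> e \notin Pos -> rk y < rk x.
Implicit Types (U F : {set X}) (h : {ffun X -> 'I_m}).

Definition toward U x : {set D} := [set e | oapp (mem U) false (nb x e)].

(* the least heights on U which are compatible with full burning *)
Definition minimal U h := [forall x in U, h x == #|Pos :&: toward U x| :> nat].

Lemma opn_toward U x : opn nb (~: U) x = ~: toward U x.
Proof. by apply/setP => e; rewrite !inE; case: (nb x e) => //= y; rewrite inE. Qed.

Lemma fire_toward h U x : fireH nb h x (~: U) = (#|toward U x| <= h x)%N.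
Proof.
rewrite fireHE opn_toward -[X in (X <= _)%N](cardsC (toward U x)).
by rewrite leq_add2r.
Qed.

(** A site of lowest rank in [F] has neighbours in [F] only along [Pos], and its height is the
    number of all its [Pos] neighbours in [U]. *)
Lemma minimal_burns h U : minimal U h -> cl (fireH nb h) U set0 = ~: U ->
  full (fireH nb h) set0.
Proof.
move=> /forall_inP mn E; have mo := @fireH_mono X D nb m h.
rewrite /full -(cl_cl set0 mo (sub0set U)) E; apply/cl_fullP => // F FU /set0Pn[x0 x0F].
case: (@arg_minP _ _ X x0 (mem F) rk x0F) => x xF xmin; exists x => //.
rewrite fire_toward (eqP (mn _ (subsetP FU _ xF))); apply: subset_leq_card.
apply/subsetP => e; rewrite !inE; case E1: (nb x e) => [y|] //= yF.
rewrite (subsetP FU _ yF) andbT; apply/negPn/negP => /(rkP E1).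
by rewrite ltNge => /negP; apply; apply: xmin.
Qed.

(** A site of [U] burns only once all its neighbours are burnt except those in [U] along [Pos],
    hence after its neighbours outside of [U]. So the outside gets no help from [U]. *)
Lemma minimal_outer h U : minimal U h -> full (fireH nb h) set0 ->
  cl (fireH nb h) U set0 = ~: U.
Proof.
move=> /forall_inP mn fl; have mo := @fireH_mono X D nb m h.
set C := cl (fireH nb h) U set0; pose F := ~: (C :|: U).
have CU : C \subset ~: U.
  apply/subsetP => x /(cl_fired mo); rewrite !inE /=.
  by case/andP.
suff F0 : F = set0.
  apply/eqP; rewrite eqEsubset CU; apply/subsetP => x xU.
  have : x \notin F by rewrite F0 inE.
  by rewrite !inE negbK -[x \in U]negbK -in_setC xU orbF.
(* [F] collects the outside sites that would need help from [U]. With [F] held back, the invariant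
   shows that a burnt site of [U] borders no site of [F], so releasing [F] burns nothing. *)
pose Inv (B : {set X}) := [/\ C \subset B, [disjoint B & F] & forall u e y, u \in B -> u \in U ->
  nb u e = Some y -> ((e \notin Pos) ==> (y \in B)) /\ (y \notin U -> y \in C)].
set B := cl (fireH nb h) F C.
have [_ dB inv] : Inv B.
  apply: cl_ind => [|A [CA dA IA]].
    split=> //; first by rewrite disjoints_subset setCK subsetUl.
    by move=> u e y /(subsetP CU); rewrite inE => /negP.
  have CA' := subset_trans CA (stp_sub (fireH nb h) F A).
  split=> //.
    rewrite disjoints_subset; apply/subsetP => x; rewrite inE => /orP[xA|].
      by rewrite inE (disjointFr dA xA).
    by rewrite !inE => /andP[].
  move=> u e y; rewrite inE => /orP[uA|]; last first.
    rewrite inE => /andP[uF uf] uU; have [uA|uA] := boolP (u \in A).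
      move=> E; have [i1 i2] := IA u e y uA uU E; split=> //.
      by apply/implyP => /(implyP i1); apply: (subsetP (stp_sub _ _ _)).
    have sub : Pos :&: toward U u \subset toward (~: A) u.
      apply/subsetP => e'; rewrite !inE; case E': (nb u e') => [y'|] /=; last by rewrite andbF.
      case/andP=> eP yU; rewrite inE; apply: contra uA => yA.
      have [/implyP i1 _] := IA y' (rev e') u yA yU (nb_rev E').
      by apply: i1; rewrite revPos negbK.
    have eqs : Pos :&: toward U u = toward (~: A) u.
      apply/eqP; rewrite eqEcard sub /=.
      by rewrite -[A]setCK fire_toward (eqP (mn _ uU)) in uf.
    move=> E; have inA : e \notin Pos :&: toward U u -> y \in A.
      by rewrite eqs inE E /= inE negbK.
    split.
      apply/implyP => eP; apply: (subsetP (stp_sub _ _ _)); apply: inA.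
      by rewrite inE (negbTE eP).
    move=> yU; have : y \in A by apply: inA; rewrite !inE E /= (negbTE yU) andbF.
    move=> yA; have : y \notin F by rewrite (disjointFr dA yA).
    by rewrite !inE negbK (negbTE yU) orbF.
  move=> uU E; have [i1 i2] := IA u e y uA uU E; split=> //.
  by apply/implyP => /(implyP i1); apply: (subsetP (stp_sub _ _ _)).
apply/eqP; rewrite -[_ == _]negbK; apply/negP => /set0Pn[w wF].
have : cl (fireH nb h) set0 set0 \subset B.
  apply: cl_min => [//||x _ xf]; first exact: sub0set.
  have [xF|xF] := boolP (x \in F); last exact: cl_closed.
  exfalso; move: (xF); rewrite !inE negb_or => /andP[xC xU].
  case/negP: xC; apply: cl_closed => //; apply: etrans xf.
  rewrite !fireHE; congr (_ <= _ + #|pred_of_set _|)%N; apply/setP => e; rewrite !inE.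
  case E: (nb x e) => [y|] //; apply/idP/idP => [|yB].
    exact: (subsetP (cl_sub _ _ _)).
  have [yU|yU] := boolP (y \in U).
    have [_ i2] := inv y (rev e) x yB yU (nb_rev E).
    by have := i2 xU; move: xF; rewrite !inE negb_or => /andP[/negbTE -> _].
  have : y \notin F by rewrite (disjointFr dB yB).
  by rewrite !inE negbK (negbTE yU) orbF.
rewrite (eqP fl) => /subsetP/(_ w (in_setT _)) wB.
by rewrite (disjointFr dB wB) in wF.
Qed.

End Minimal.

(** * Bounded pasts in large volumes *)

Lemma Ex_bool (R : realFieldType) (T : finType) (P : pred T) :
  Ex (fun t => (P t)%:R : R) = #|[set t | P t]|%:R / #|T|%:R.
Proof.
rewrite /Ex -natr_sum -sum1dep_card [in RHS]big_mkcond; congr (_%:R / _).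
Qed.

Section Volumes.
Variables (d : nat) (R : realType).
Hypothesis d_gt0 : (0 < d)%N.
Local Notation D := ('I_d * bool)%type.
Local Notation m := ((d.-1).*2.+2).
Local Notation H := 'I_m.
Implicit Types (V W L U X : {fset site d}) (v : site d).

Lemma card_dir : #|{: D}| = m.
Proof. by rewrite card_prod card_ord card_bool; move: d_gt0; lia. Qed.

Lemma fsub_image V X (VX : fsubset V X) : fsub X V = fincl VX @: setT.
Proof. by rewrite (fsubE VX); apply/setP => x; apply/imsetP/imsetP => -[y _ ->]; exists y. Qed.

Lemma fsub_image_in L V X (VX : fsubset V X) : fsubset L V ->
  fsub X L = fincl VX @: fsub V L.
Proof.
move=> LV; apply/setP => x; rewrite in_fsub; apply/idP/imsetP => [xL|[y]].
  have xV : val x \in V by apply: (fsubsetP LV).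
  by exists (FSetSub xV); rewrite ?in_fsub //; apply: val_inj.
by rewrite in_fsub => yL ->.
Qed.

Lemma fincl_emb V X (VX : fsubset V X) : embedding (@nbV d V) (@nbV d X) (fincl VX).
Proof.
move=> x e; rewrite /nbV; case: insubP => [x' x'V E|nV]; case: insubP => [y yX E'|nX] //.
- by apply: val_inj; rewrite /= E' /= -E.
- by case/negP: nX; apply: (fsubsetP VX).
- apply: contra nV => /imsetP[z _ Ez]; move: E'; rewrite Ez /= => <-; exact: valP.
Qed.

Lemma RV_card_gt0 V : 0 < Ex (fun h : {ffun V -> H} => (full (fireH (@nbV d V) h) set0)%:R : R).
Proof.
have [eta E] : exists eta : {ffun V -> height d}, full (fireH (@nbV d V) eta) set0.
  exists [ffun=> ord_max]; apply/allowed_full.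
  apply: allowed_le (max_allowed d_gt0) => x; rewrite emb_in ffunE /hval /=.
  by rewrite lez_nat; move: d_gt0; lia.
rewrite Ex_bool divr_gt0 // ltr0n; apply/card_gt0P; first by exists eta; rewrite inE.
by exists eta.
Qed.

Lemma muV_cyl L V (LV : fsubset L V) (A : {set {ffun L -> height d}}) :
  muV R V (cyl A) =
  Ex (fun h : {ffun V -> H} => (full (fireH (@nbV d V) h) set0)%:R * (pull (fincl LV) h \in A)%:R) /
  Ex (fun h : {ffun V -> H} => (full (fireH (@nbV d V) h) set0)%:R).
Proof.
rewrite (@eq_Ex _ _ _ (fun h => (full (fireH (@nbV d V) h) set0 && (pull (fincl LV) h \in A))%:R)); last first.
  by move=> h; rewrite natr_andb.
rewrite !Ex_bool invf_div mulrA divfK; last first.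
  have := RV_card_gt0 V; rewrite Ex_bool; apply: contraTneq => ->.
  by rewrite invr0 mulr0 ltxx.
rewrite /muV RV_full //; congr (_%:R / _%:R).
apply: eq_card => eta; rewrite !inE; congr (_ && _); apply/asboolP/idP => [cy|eA w ext].
  pose w (u : site d) : height d := if insub u is Some u' then eta u' else ord0.
  have /cy : forall y : V, w (val y) = eta y by move=> y; rewrite /w valK.
  rewrite /cyl /=; congr (_ \in A); apply/ffunP => y; rewrite !ffunE.
  by rewrite /w -[val y]/(val (fincl LV y)) valK.
rewrite /cyl /=; rewrite (_ : restr L w = pull (fincl LV) eta) //.
by apply/ffunP => y; rewrite !ffunE -ext.
Qed.

(** With everything off [V] burnt, the volume [X] behaves like [V]; convergence thus applies to all
    sub-volumes of one fixed volume. *)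
Lemma muV_cyl_in L V X (LV : fsubset L V) (VX : fsubset V X) (LX : fsubset L X)
    (A : {set {ffun L -> height d}}) :
  Ex (fun h : {ffun X -> H} => (full (fireH (@nbV d X) h) (~: fsub X V))%:R *
     (pull (fincl LX) h \in A)%:R) =
  muV R V (cyl A) * Ex (fun h : {ffun X -> H} => (full (fireH (@nbV d X) h) (~: fsub X V))%:R).
Proof.
have E (f : {ffun L -> H} -> R) :
   Ex (fun h : {ffun X -> H} => (full (fireH (@nbV d X) h) (~: fsub X V))%:R * f (pull (fincl LX) h)) =
   Ex (fun h : {ffun V -> H} => (full (fireH (@nbV d V) h) set0)%:R * f (pull (fincl LV) h)).
  rewrite -(@Ex_pull R _ _ _ (fincl VX) (@fincl_inj _ _ _ VX)) ?card_ord //.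
  apply: eq_Ex => h; rewrite (fsub_image VX) (fullH_emb (@fincl_inj _ _ _ VX) (@fincl_emb _ _ VX)).
  congr (_ * f _); apply/ffunP => y; rewrite !ffunE; congr (h _).
  exact: val_inj.
rewrite (E (fun g => (g \in A)%:R)) (muV_cyl LV).
have := E (fun=> 1); under eq_Ex do rewrite mulr1; move=> ->.
under [X in _ / _ * X]eq_Ex do rewrite mulr1.
by rewrite divfK // gt_eqF // RV_card_gt0.
Qed.

End Volumes.

Lemma minimal_emb (X Y D : finType) (nbX : X -> D -> option X) (nbY : Y -> D -> option Y)
    (phi : X -> Y) (m : nat) (Pos : {set D}) (h : {ffun Y -> 'I_m}) :
  injective phi -> embedding nbX nbY phi ->
  minimal nbY Pos (phi @: setT) h = minimal nbX Pos setT (pull phi h).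
Proof.
move=> inj emb.
have tw x : toward nbY (phi @: setT) (phi x) = toward nbX setT x.
  apply/setP => e; rewrite !inE; have := emb x e.
  case: (nbX x e) => [x'|]; case: (nbY (phi x) e) => [y|] //=.
    by move=> ->; rewrite !inE imset_f.
  by move=> /negbTE.
apply/forall_inP/forall_inP => [H x _|H y /imsetP[x _ ->]].
  by rewrite ffunE -tw; apply: H; rewrite imset_f.
by have := H x (in_setT _); rewrite ffunE tw.
Qed.

Lemma cl_heldI (X : finType) (fire : X -> {set X} -> bool) (U : {set X}) : fire_mono fire ->
  cl fire U (~: U) = ~: U.
Proof.
move=> mo; apply/eqP; rewrite eqEsubset cl_sub andbT; apply: cl_min => // x.
by rewrite inE.
Qed.

Section Pasts.
Variables (d : nat) (R : realType).
Hypothesis d_gt0 : (0 < d)%N.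
Local Notation D := ('I_d * bool)%type.
Local Notation m := ((d.-1).*2.+2).
Local Notation H := 'I_m.
Implicit Types (V W L U X : {fset site d}) (v : site d).

Definition dirN (e : D) : D := (e.1, ~~ e.2).
Definition dirP : {set D} := [set e | e.2].

Lemma dirN_pos e : (dirN e \in dirP) = (e \notin dirP). Proof. by rewrite !inE. Qed.

Lemma nbV_rev V (x : V) e (y : V) : nbV x e = Some y -> nbV y (dirN e) = Some x.
Proof. by move/eqP; rewrite nbV_eq => /eqP E; apply/eqP; rewrite nbV_eq -E nbrK. Qed.

(** The rank by which minimal patterns burn: negative directions lower it. *)
Definition height_sum V (x : V) : int := \sum_i val x i.

Lemma height_sum_lt V (x : V) e (y : V) : nbV x e = Some y -> e \notin dirP -> height_sum y < height_sum x.
Proof.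
move/eqP; rewrite nbV_eq inE => /eqP E e2; rewrite /height_sum -E.
rewrite (bigD1 e.1) //= [X in _ < X](bigD1 e.1) //= ffunE eqxx (negbTE e2).
rewrite (eq_bigr (fun i => val x i)); last by move=> i ie; rewrite ffunE (negbTE ie).
by rewrite ltrD2r gtrDl.
Qed.

Definition minimal_event U : {set {ffun U -> height d}} :=
  [set g : {ffun U -> height d} | minimal (@nbV d U) dirP setT g].

Definition past_ratio v U : R :=
  Ex (fun h : {ffun U -> H} => (inner (fireH (@nbV d U) h) (fsub U [fset v]%fset) setT)%:R) /
  Ex (fun h : {ffun U -> H} => (minimal (@nbV d U) dirP setT h)%:R).

Lemma past_ratio_ge0 v U : 0 <= past_ratio v U.
Proof. by rewrite divr_ge0 // Ex_ge0 // => h; rewrite ler0n. Qed.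

Lemma minimal_exists U : 0 < Ex (fun h : {ffun U -> H} => (minimal (@nbV d U) dirP setT h)%:R : R).
Proof.
have lt (u : U) : (#|dirP :&: toward (@nbV d U) setT u| < m)%N.
  rewrite -(card_dir d_gt0) -cardsT; apply: proper_card; rewrite properT.
  apply/negP => /eqP/setP/(_ (Ordinal d_gt0, false)); rewrite !inE //=.
rewrite Ex_bool divr_gt0 // ltr0n; apply/card_gt0P.
  exists [ffun u => Ordinal (lt u)]; rewrite inE; apply/forall_inP => u _.
  by rewrite ffunE.
by exists [ffun u => Ordinal (lt u)].
Qed.

(** The past of [v] being [U], and full burning with the minimal pattern on [U], are both [outer] on
    [U] times an event in the heights of [U]. Hence their quotient does not see the volume [V]. *)
Lemma past_law V U v : fsubset U V -> v \in U ->
  Ex (fun p : {ffun V -> D} =>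
    (tree (@nbV d V) p && (held (fireP (@nbV d V) p) set0 (fsub V [fset v]%fset) == fsub V U))%:R) =
  past_ratio v U * muV R V (cyl (minimal_event U)) *
    Ex (fun p : {ffun V -> D} => (tree (@nbV d V) p)%:R).
Proof.
move=> UV vU; set Wv := fsub V _; set UU := fsub V U.
have WU : Wv \subset UU by rewrite subset_fsub // fsub1set.
have cD := card_dir d_gt0.
have E0 : Ex (fun p : {ffun V -> D} => (tree (@nbV d V) p)%:R : R) =
    Ex (fun h : {ffun V -> H} => (full (fireH (@nbV d V) h) set0)%:R).
  by rewrite (@full_transfer _ _ _ _ R cD).
rewrite E0 (muV_cyl R d_gt0 UV) -[RHS]mulrA divfK; last by rewrite gt_eqF // RV_card_gt0.
rewrite (@eq_Ex _ _ _ (fun p : {ffun V -> D} => (full (fireP (@nbV d V) p) set0)%:R *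
   (held (fireP (@nbV d V) p) set0 Wv == UU)%:R)); last by move=> p; rewrite natr_andb.
rewrite -(@equi_event _ _ _ _ R cD set0 Wv Wv (fun S _ => (S == UU)%:R) (subxx _)).
have mo h := @fireH_mono V D (@nbV d V) m h.
rewrite [LHS](@eq_Ex _ _ _ (fun h : {ffun V -> H} => (outer (fireH (@nbV d V) h) set0 UU)%:R *
   (inner (fireH (@nbV d V) h) Wv UU)%:R)); last first.
  move=> h; rewrite -!natr_andb; congr (nat_of_bool _)%:R.
  have := hold_split (mo h) (subxx Wv) WU (subxx UU) WU (sub0set (~: UU)).
  have -> : middle (fireH (@nbV d V) h) Wv UU UU.
    rewrite /middle cl_heldI // eqxx andbT.
    by apply/forall_inP => x; rewrite !inE andbC; case: (_ \in _).
  rewrite andTb => <-; rewrite andbA andbb andbC; congr (_ && _).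
  by rewrite /held -(inj_eq (@setC_inj _)) setCK.
rewrite (Ex_indep (@dep_outer _ _ _ _ R set0 UU) (@dep_inner _ _ _ _ R Wv UU)); last first.
  by rewrite -setI_eq0 setIC setICr.
have inj := @fincl_inj _ _ _ UV; have emb := @fincl_emb _ _ _ UV.
have UE : UU = fincl UV @: setT := fsub_image UV.
have -> : Ex (fun h : {ffun V -> H} => (inner (fireH (@nbV d V) h) Wv UU)%:R) =
   Ex (fun h : {ffun U -> H} => (inner (fireH (@nbV d U) h) (fsub U [fset v]%fset) setT)%:R) :> R.
  rewrite -(@Ex_pull R _ _ _ _ inj) ?card_ord //; apply: eq_Ex => h; congr (nat_of_bool _)%:R.
  by rewrite /Wv (fsub_image_in UV) ?fsub1set // UE (inner_emb inj emb).
pose mn (h : {ffun V -> H}) : R := (minimal (@nbV d V) dirP UU h)%:R.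
have Emn : Ex mn = Ex (fun h : {ffun U -> H} => (minimal (@nbV d U) dirP setT h)%:R).
  rewrite -(@Ex_pull R _ _ _ _ inj) ?card_ord //; apply: eq_Ex => h.
  by rewrite /mn UE (minimal_emb _ _ inj emb).
rewrite (@eq_Ex _ _ (fun h => (full (fireH (@nbV d V) h) set0)%:R * (pull (fincl UV) h \in minimal_event U)%:R)
   (fun h => (outer (fireH (@nbV d V) h) set0 UU)%:R * mn h)); last first.
  move=> h; rewrite /mn inE -(minimal_emb _ _ inj emb) -UE -!natr_andb; congr (nat_of_bool _)%:R.
  apply/andP/andP => -[h1 h2]; split=> //.
    by apply/eqP; apply: (minimal_outer (@nbV_rev V) dirN_pos h2 h1).
  exact: (minimal_burns (@height_sum_lt V) h2 (eqP h1)).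
have dmn : dep UU mn.
  by move=> f g fg; congr (nat_of_bool _)%:R; apply: eq_forallb_in => x xU; rewrite fg.
rewrite (Ex_indep (@dep_outer _ _ _ _ R set0 UU) dmn); last by rewrite -setI_eq0 setIC setICr.
have N := lt0r_neq0 (minimal_exists U).
by rewrite Emn /past_ratio; field.
Qed.

End Pasts.

Lemma past_path (X D : finType) (nb : X -> D -> option X) p x y :
  y \in past nb p x -> exists s, [/\ path (st nb p) y s, last y s = x & (size s < #|past nb p x|)%N].
Proof.
rewrite inE => /connectP[s0 s0p ->]; case/shortenP: s0p => s sp su _; exists s; split=> //.
rewrite -[X in (X <= _)%N]/(size (y :: s)) -(card_uniqP su); apply: subset_leq_card.
apply/subsetP => z zs; rewrite inE; case/splitPl: zs sp => s1 s2 <-.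
by rewrite cat_path last_cat => /andP[_ p2]; apply/connectP; exists s2.
Qed.

Lemma dist1_triangle d (x y z : site d) : (dist1 x z <= dist1 x y + dist1 y z)%N.
Proof. by rewrite /dist1 -big_split /=; apply: leq_sum => i _; lia. Qed.

Lemma dist1_coord d (x y : site d) k : (`|x k - y k| <= dist1 x y)%N.
Proof. by rewrite /dist1 (bigD1 k) //= leq_addr. Qed.

(** [few_big_pasts] averages over the whole box; a middle box of side [M] holds a proportion
    [1 / 2 ^ d] of the sites, hence the factor in [q0']. [L] is fixed before the margin [r]. *)
Lemma typical_point d q : (1 < d)%N -> (0 < q)%N -> exists L, forall r, exists n (x : {ffun 'I_d -> 'I_n.+1}),
  (forall k, r <= x k /\ x k + r <= n)%N /\
  (q * #|[set p | tree (@nbox d n) p && (x \in big (@nbox d n) p L)]| <=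
   #|[set p | tree (@nbox d n) p]|)%N.
Proof.
move=> d2 q0; have q0' : (0 < 2 ^ d * q)%N by rewrite muln_gt0 expn_gt0.
have [b [L [b0 bL]]] := few_big_pasts d2 q0'.
exists L => r; pose M := (2 * b * r.+1)%N; pose n := (2 * M).-1.
have M0 : (0 < M)%N by rewrite /M; nia.
have nE : n.+1 = (2 * M)%N by rewrite /n prednK //; lia.
exists n; pose sh (g : {ffun 'I_d -> 'I_M}) : {ffun 'I_d -> 'I_n.+1} := [ffun k => inord (b * r.+1 + g k)].
have shE g k : sh g k = (b * r.+1 + g k)%N :> nat.
  by rewrite ffunE inordK // nE; have := ltn_ord (g k); move: (nat_of_ord (g k)) => c; rewrite /M; nia.
have sh_inj : injective sh.
  move=> f g E; apply/ffunP => k; apply/val_inj/eqP; rewrite /= -(eqn_add2l (b * r.+1)) -!shE.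
  by rewrite E.
pose c x := #|[set p | tree (@nbox d n) p && (x \in big (@nbox d n) p L)]|.
pose T := #|[set p | tree (@nbox d n) p]|.
case: (boolP [exists g, q * c (sh g) <= T]%N) => [/existsP[g gT]|].
  exists (sh g); split=> // k; rewrite shE; have := ltn_ord (g k).
  move: (nat_of_ord (g k)) nE => a; rewrite /M; nia.
rewrite negb_exists => /forallP all; exfalso.
have bn : (b %| n.+1)%N by rewrite nE; apply/dvdnP; exists (4 * r.+1)%N; rewrite /M; nia.
have := bL n bn; apply/negP; rewrite -ltnNge (_ : n.+1 ^ d = (2 * M) ^ d)%N; last by rewrite nE.
have -> : (\sum_(p | tree (@nbox d n) p) #|big (@nbox d n) p L| = \sum_x c x)%N.
  rewrite (eq_bigr (fun p => \sum_x (x \in big (@nbox d n) p L))%N); last first.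
    by move=> p _; rewrite -sum1_card big_mkcond; apply: eq_bigr => x _; case: ifP.
  rewrite exchange_big; apply: eq_bigr => x _ /=; rewrite /c -sum1dep_card.
  by rewrite big_mkcond [RHS]big_mkcond; apply: eq_bigr => p _; case: tree => //=; case: ifP.
have sub : (\sum_g c (sh g) <= \sum_x c x)%N.
  rewrite [X in (_ <= X)%N](bigID (mem (sh @: setT))) /= big_imset /=; last by move=> ? ? _ _; apply: sh_inj.
  by rewrite [X in (_ <= X + _)%N](eq_bigl xpredT) ?leq_addr // => g; rewrite inE.
have low : (M ^ d * T.+1 <= q * \sum_g c (sh g))%N.
  rewrite big_distrr /= -[X in (X ^ _)%N]card_ord -[X in (_ ^ X)%N](card_ord d) -card_ffun -sum_nat_const.
  by apply: leq_sum => g _; rewrite ltnNge all.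
rewrite expnMn mulnCA -mulnA ltn_pmul2l ?expn_gt0 //; apply: leq_trans (leq_mul (leqnn q) sub).
apply: leq_trans low; rewrite mulnC ltn_pmul2l ?expn_gt0 ?M0 //.
Qed.

Section Box.
Variables (d n : nat) (t : site d).
Local Notation N := n.+1.
Local Notation D := ('I_d * bool)%type.
Local Notation X := {ffun 'I_d -> 'I_N}.
Implicit Types (x y : X).

Definition boxpt x : site d := [ffun k => t k + (x k)%:Z].
Definition box : {fset site d} := [fset boxpt x | x in {: X}]%fset.

Lemma boxpt_in x : boxpt x \in box. Proof. by apply/imfsetP; exists x. Qed.
Definition boxmap x : box := FSetSub (boxpt_in x).

Lemma boxpt_inj : injective boxpt.
Proof.
move=> x y /ffunP E; apply/ffunP => k; apply: val_inj; have := E k; rewrite !ffunE => /addrI.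
by case.
Qed.

Lemma boxmap_inj : injective boxmap.
Proof. by move=> x y /(congr1 val) /boxpt_inj. Qed.

Lemma boxmap_onto : boxmap @: setT = setT.
Proof.
apply/setP => u; rewrite inE; have /imfsetP[x _ E] := valP u.
by apply/imsetP; exists x => //; apply: val_inj.
Qed.

Lemma in_box (u : site d) : (forall k, t k <= u k < t k + N%:Z) -> u \in box.
Proof.
move=> ut; apply/imfsetP; exists [ffun k => inord (absz (u k - t k))] => //.
apply/ffunP => k; rewrite !ffunE inordK; have := ut k; move: (u k) (t k) => a c; lia.
Qed.

Lemma box_range (u : site d) k : u \in box -> t k <= u k < t k + N%:Z.
Proof.
case/imfsetP => x _ ->; rewrite ffunE; have := ltn_ord (x k).
by move: (t k) (nat_of_ord (x k)) => a c; lia.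
Qed.

Lemma nbox_nbr x e y : nbox x e = Some y -> nbr (boxpt x) e = boxpt y.
Proof.
case: e => i []; rewrite /nbox /=; case: ifP => // lt [<-]; apply/ffunP => k; rewrite !ffunE /=.
  by case: eqP => // ->; rewrite inordK //; move: (t i) (nat_of_ord (x i)) lt => a c; lia.
case: eqP => // ->; rewrite inordK; move: (t i) (nat_of_ord (x i)) (ltn_ord (x i)) lt => a c; lia.
Qed.

Lemma nbox_out x e : nbox x e = None -> nbr (boxpt x) e \notin box.
Proof.
move=> E; apply/negP => /(box_range e.1); rewrite ffunE eqxx ffunE; move: E.
case: e => i []; rewrite /nbox /=; case: ifP => // /negbT; rewrite -leqNgt;
  move: (t i) (nat_of_ord (x i)) => a c; lia.
Qed.

Lemma boxmap_emb : embedding (@nbox d n) (@nbV d box) boxmap.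
Proof.
move=> x e; case E: (nbox x e) => [y|]; rewrite /nbV.
  rewrite (nbox_nbr E); case: insubP => [u _ Eu|]; last by rewrite boxpt_in.
  exact: val_inj.
by rewrite insubN // (nbox_out E).
Qed.

Lemma past_dist1 p x y L : y \in past (@nbox d n) p x -> (#|past (@nbox d n) p x| <= L)%N ->
  (dist1 (boxpt y) (boxpt x) <= L)%N.
Proof.
case/past_path => s [sp <- lt] le; apply: leq_trans (leq_trans (ltnW lt) le).
elim: s y sp {lt le} => [|z s IH] y /=; first by move=> _; rewrite /dist1 big1 // => k _; rewrite subrr.
case/andP=> /eqP yz /IH le; apply: leq_trans (dist1_triangle _ (boxpt z) _) _.
suff -> : dist1 (boxpt y) (boxpt z) = 1%N by rewrite add1n ltnS.
rewrite -(nbox_nbr yz) -(dist1_nbr (boxpt y) (p y)).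
by apply: eq_bigr => k _; rewrite distnC.
Qed.

Lemma box_tree (R : realFieldType) (d0 : (0 < d)%N) :
  Ex (fun p : {ffun box -> D} => (tree (@nbV d box) p)%:R : R) =
  Ex (fun p : {ffun X -> D} => (tree (@nbox d n) p)%:R).
Proof.
rewrite -(@Ex_pull R _ _ _ _ boxmap_inj); last first.
  by rewrite card_prod card_ord card_bool muln_gt0 d0.
apply: eq_Ex => p; congr (nat_of_bool _)%:R.
by have := fullP_emb boxmap_inj boxmap_emb p; rewrite boxmap_onto setCT.
Qed.

Lemma box_past (R : realFieldType) (d0 : (0 < d)%N) x (S : {fset site d}) L :
  (forall u, (dist1 u (boxpt x) <= L)%N -> u \in S) ->
  Ex (fun p : {ffun box -> D} => (tree (@nbV d box) p &&
    ~~ (held (fireP (@nbV d box) p) set0 (fsub box [fset boxpt x]%fset) \subset fsub box S))%:R : R) <=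
  Ex (fun p : {ffun X -> D} => (tree (@nbox d n) p && (x \in big (@nbox d n) p L))%:R).
Proof.
move=> ball; rewrite -(@Ex_pull R _ _ _ _ boxmap_inj); last first.
  by rewrite card_prod card_ord card_bool muln_gt0 d0.
apply: le_Ex => p; rewrite ler_nat.
have := fullP_emb boxmap_inj boxmap_emb p; rewrite boxmap_onto setCT.
rewrite -[full _ _]/(tree (@nbV d box) p) -[full _ _]/(tree (@nbox d n) _) => ->.
case: (boolP (tree _ _)) => //= tp; case: (boolP (_ \subset _)) => //= /subsetPn[u uh uS].
have := clP_emb boxmap_inj boxmap_emb p (fsub box [fset boxpt x]%fset) (B := set0).
rewrite boxmap_onto setCT preimset0 => /(_ (subxx _)) E.
rewrite inE lt0b leqNgt; apply/negP => small; case/negP: uS; rewrite in_fsub; apply: ball.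
have : u \in boxmap @: setT by rewrite boxmap_onto inE.
case/imsetP => y _ uy; rewrite uy /=; apply: past_dist1 (ltnW small).
have : y \in ~: (boxmap @^-1: cl (fireP (@nbV d box) p) (fsub box [fset boxpt x]%fset) set0).
  by rewrite !inE -uy; move: uh; rewrite /held inE.
rewrite E tree_clC // inE => /exists_inP[z]; rewrite inE in_fsub /= inE => /eqP/boxpt_inj -> yz.
by rewrite inE.
Qed.

End Box.

Section OneEnded.
Variables (d : nat) (R : realType).
Hypothesis d2 : (1 < d)%N.
Local Notation D := ('I_d * bool)%type.
Implicit Types (V W L U S : {fset site d}) (v : site d).
Let d0 : (0 < d)%N. Proof. exact: ltnW. Qed.

Variable nu : forall L, {set {ffun L -> height d}} -> R.
Hypothesis limit : forall L (A : {set {ffun L -> height d}}) (e : R), 0 < e ->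
  exists2 W, fsubset L W & forall V, fsubset W V -> `|nu A - muV R V (cyl A)| < e.

Definition trees V : R := Ex (fun p : {ffun V -> D} => (tree (@nbV d V) p)%:R).

(* On trees, the held set is the past of W0. *)
Definition escapes V W0 W : R :=
  Ex (fun p : {ffun V -> D} => (tree (@nbV d V) p &&
    ~~ (held (fireP (@nbV d V) p) set0 (fsub V W0) \subset fsub V W))%:R).

Lemma trees_gt0 V : 0 < trees V.
Proof.
rewrite /trees -(@full_transfer _ _ _ _ R (card_dir d0)).
exact: RV_card_gt0.
Qed.

Lemma fsub_mono V W W' : fsubset W W' -> fsub V W \subset fsub V W'.
Proof. by move=> WW; apply/subsetP => x; rewrite !in_fsub; apply: (fsubsetP WW). Qed.

Lemma escapes_mono V W0 W W' : fsubset W W' -> escapes V W0 W' <= escapes V W0 W.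
Proof.
move=> WW; apply: le_Ex => p; rewrite ler_nat; case: tree => //=.
case: (boolP (_ \subset fsub V W)) => [sub|_]; last by case: (_ \subset _).
by rewrite (subset_trans sub) // fsub_mono.
Qed.

(** [S] contains finitely many candidates for the past of [v], so not escaping is a finite sum of
    the probabilities in [past_law]. *)
Lemma escapes_past V S v : fsubset S V -> v \in S ->
  escapes V [fset v]%fset S =
  (1 - \sum_(U : fpowerset S | v \in val U) past_ratio R v (val U) * muV R V (cyl (minimal_event (val U)))) *
  trees V.
Proof.
move=> SV vS; rewrite mulrBl mul1r mulr_suml /escapes.
rewrite (eq_bigr (fun U : fpowerset S => Ex (fun p : {ffun V -> D} => (tree (@nbV d V) p &&
  (held (fireP (@nbV d V) p) set0 (fsub V [fset v]%fset) == fsub V (val U)))%:R : R))); last first.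
  move=> U vU; rewrite (past_law R d0 _ vU) //.
  by apply: fsubset_trans (SV); have := valP U; rewrite fpowersetE.
rewrite -Ex_sum -ExB; apply: eq_Ex => p; case: (boolP (tree _ p)) => tp /=; last first.
  by rewrite big1 ?subr0.
set C := held _ _ _; pose U0 : {fset site d} := [fset val x | x in C]%fset.
have U0C : fsub V U0 = C.
  apply/setP => x; rewrite in_fsub; apply/imfsetP/idP => [[y yC /val_inj ->]//|xC].
  by exists x.
have vC : FSetSub (fsubsetP SV _ vS) \in C.
  rewrite /C /held tree_clC // inE; apply/exists_inP; exists (FSetSub (fsubsetP SV _ vS)) => //.
  by rewrite in_fsub /= in_fset1.
have vU0 : v \in U0 by apply/imfsetP; exists (FSetSub (fsubsetP SV _ vS)).
case: (boolP (C \subset _)) => [/subsetP CS|nCS] /=.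
  have US : U0 \in fpowerset S.
    rewrite fpowersetE; apply/fsubsetP => _ /imfsetP[x xC ->].
    by have := CS x xC; rewrite in_fsub.
  rewrite (bigD1 (FSetSub US)) //= U0C eqxx big1 ?addr0 ?subrr //.
  move=> U /andP[_ NE]; case: eqP => // E; case/eqP: NE; apply: val_inj => /=.
  apply/fsetP => u; have UV : fsubset (val U) V.
    by apply: fsubset_trans (SV); have := valP U; rewrite fpowersetE.
  apply/idP/imfsetP => [uU|[x xC ->]]; last by move: xC; rewrite /= E in_fsub.
  exists (FSetSub (fsubsetP UV _ uU)) => //=; by rewrite E in_fsub.
rewrite big1 ?subr0 // => U _; case: eqP => // E; case/negP: nCS; rewrite E.
by apply: fsub_mono; have := valP U; rewrite fpowersetE.
Qed.

Lemma common_net (s : seq {fset site d}) (A : forall U, {set {ffun U -> height d}}) (dl : {fset site d} -> R) :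
  (forall U, 0 < dl U) -> exists W, forall V, fsubset W V -> forall U, U \in s ->
    `|nu (A U) - muV R V (cyl (A U))| < dl U.
Proof.
move=> dl0; elim: s => [|U s [W IH]]; first by exists fset0.
have [W' _ H] := limit (A U) (dl0 U); exists (W `|` W')%fset => V; rewrite fsubUset => /andP[W1 W2] U'.
by rewrite inE => /orP[/eqP ->|]; [apply: H|apply: IH].
Qed.

(** The finite sum in [escapes_past] is nearly the same in all volumes beyond [W], since height
    patterns converge. It is evaluated in a box placed so that [v] is its typical point. As [S]
    depends on [L] only, [W] is chosen before that box. *)
Lemma past_bounded v (e : R) : 0 < e -> exists2 W, v \in W & forall V, fsubset W V ->
  escapes V [fset v]%fset W <= e * trees V.
Proof.
move=> e0; pose q := (Num.bound (2 / e)).+1.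
have qe : q%:R^-1 <= e / 2.
  rewrite -[X in _ <= X]invrK lef_pV2 ?posrE ?ltr0n ?invr_gt0 ?divr_gt0 // invf_div.
  apply/ltW/(lt_trans (archi_boundP _)); first by rewrite divr_ge0 // ltW.
  by rewrite ltr_nat.
have [L HL] := @typical_point d q d2 isT.
pose t0 : site d := [ffun k => v k - L%:Z].
pose S := box (2 * L) t0.
have ball u : (dist1 u v <= L)%N -> u \in S.
  move=> uv; apply: in_box => k; rewrite ffunE; have := leq_trans (dist1_coord u v k) uv.
  by move: (u k) (v k) => a c; lia.
have vS : v \in S by apply: ball; rewrite /dist1 big1 // => k _; rewrite subrr.
pose K U := past_ratio R v U; have K0 U : 0 <= K U by apply: past_ratio_ge0.
pose nS : R := #|{: fpowerset S}|%:R + 1.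
have nS0 : 0 < nS by rewrite ltr_wpDl.
(* Two volumes differ by at most [2 * dl U] on the pattern of [U]; weighted by [K U] and summed over
   the subsets of [S] this is at most [e / 2]. The other half is for [1 / q]. *)
pose dl U := e / 4 / nS / (K U + 1).
have K1 U : 0 < K U + 1 by rewrite ltr_wpDl.
have dl0 U : 0 < dl U by rewrite !divr_gt0.
have [W0 netW0] := common_net (fpowerset S) (@minimal_event d) dl0.
pose W := (S `|` W0)%fset; exists W; first by rewrite inE vS.
move=> V WV; have [SV W0V] : fsubset S V /\ fsubset W0 V by apply/andP; rewrite -fsubUset.
apply: le_trans (escapes_mono _ _ (fsubsetUl S W0)) _.
rewrite escapes_past // ler_wpM2r ?(ltW (trees_gt0 V)) //.
pose r := (\sum_(w : W) dist1 (val w) v)%N.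
have [n [x [xr xq]]] := HL r.
pose t : site d := [ffun k => v k - (x k)%:Z].
have xv : boxpt t x = v by apply/ffunP => k; rewrite !ffunE subrK.
have WB : fsubset W (box n t).
  apply/fsubsetP => w wW; apply: in_box => k; rewrite ffunE.
  have : (dist1 w v <= r)%N by rewrite /r (bigD1 (FSetSub wW)) //= leq_addr.
  move=> /(leq_trans (dist1_coord w v k)); have [] := xr k.
  by move: (w k) (v k) (nat_of_ord (x k)) => a c y; lia.
have [SB W0B] : fsubset S (box n t) /\ fsubset W0 (box n t) by apply/andP; rewrite -fsubUset.
have small : escapes (box n t) [fset v]%fset S <= q%:R^-1 * trees (box n t).
  rewrite /escapes -xv; apply: le_trans (box_past R d0 (L := L) _) _; first by rewrite xv.
  rewrite /trees box_tree // !Ex_bool mulrA ler_wpM2r ?invr_ge0 ?ler0n //.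
  by rewrite ler_pdivlMl ?ltr0n // -natrM ler_nat.
rewrite escapes_past // ler_pM2r ?trees_gt0 // in small.
have key : \sum_(U : fpowerset S | v \in val U) K (val U) * muV R (box n t) (cyl (minimal_event (val U))) -
   \sum_(U : fpowerset S | v \in val U) K (val U) * muV R V (cyl (minimal_event (val U))) <= e / 2.
  rewrite -sumrB.
  apply: le_trans (_ : \sum_(U : fpowerset S | v \in val U) (e / 2 / nS) <= _); last first.
    rewrite sumr_const -[_ *+ _]mulr_natr -[X in _ <= X]mulr1 -mulrA ler_pM2l ?divr_gt0 //.
    rewrite mulrC ler_pdivrMr // mul1r /nS ler_wpDr // ler_nat; exact: max_card.
  apply: ler_sum => U _; rewrite -mulrBr.
  have n1 := netW0 V W0V (val U) (valP U); have n2 := netW0 (box n t) W0B (val U) (valP U).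
  apply: le_trans (_ : K (val U) * (2 * dl (val U)) <= _).
    apply: ler_wpM2l => //; move: n1 n2; rewrite !ltr_norml => /andP[a1 a2] /andP[a3 a4]; lra.
  rewrite /dl (_ : K _ * _ = (e / 2 / nS) * (K (val U) / (K (val U) + 1))); last first.
    by field; rewrite !gt_eqF.
  rewrite -[X in _ <= X]mulr1; apply: ler_wpM2l; first by rewrite ltW // !divr_gt0.
  by rewrite ler_pdivrMr // mul1r lerDl.
move: small key; rewrite /K; set s1 := \sum_(U | _) _; set s2 := \sum_(U | _) _ => small key.
have := le_trans small qe; move: key; rewrite -/s1 -/s2; lra.
Qed.

(** The past of [W0] is the union of the pasts of its sites, so a union bound suffices. *)
Lemma one_ended W0 (e : R) : 0 < e -> exists2 W, fsubset W0 W & forall V, fsubset W V ->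
  escapes V W0 W <= e * trees V.
Proof.
move=> e0; pose c : R := #|{: W0}|%:R + 1; have c0 : 0 < c by rewrite ltr_wpDl.
have ec : 0 < e / c by rewrite divr_gt0.
have [f fP] := choice (fun v : site d =>
  let: ex_intro2 W h1 h2 := past_bounded v ec in ex_intro (fun W => v \in W /\ forall V, fsubset W V ->
  escapes V [fset v]%fset W <= e / c * trees V) W (conj h1 h2)).
pose W := (\bigcup_(v <- W0) f v)%fset.
have fW v : v \in W0 -> fsubset (f v) W.
  by move=> vW; apply: bigfcup_sup.
exists W; first by apply/fsubsetP => v vW; apply: (fsubsetP (fW _ vW)); case: (fP v).
move=> V WV.
apply: le_trans (_ : \sum_(v : W0) escapes V [fset val v]%fset W <= _).
  rewrite /escapes -Ex_sum; apply: le_Ex => p; case: (boolP (tree _ p)) => tp /=; last first.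
    by apply: sumr_ge0 => v _; rewrite ler0n.
  case: (boolP (_ \subset _)) => [_|/subsetPn[x]] /=; first by apply: sumr_ge0 => v _; rewrite ler0n.
  rewrite /held tree_clC // inE => /exists_inP[y]; rewrite in_fsub => yW xy xW.
  rewrite (bigD1 (FSetSub yW)) //= (_ : ~~ _ = true); last first.
    apply/subsetPn; exists x => //; rewrite tree_clC // inE; apply/exists_inP; exists y => //.
    by rewrite in_fsub /= in_fset1.
  by rewrite lerDl sumr_ge0 // => v _; rewrite ler0n.
apply: le_trans (_ : \sum_(v : W0) (e / c * trees V) <= _).
  apply: ler_sum => v _; have [_ h] := fP (val v).
  apply: le_trans (escapes_mono _ _ (fW _ (valP v))) _.
  by apply: h; apply: fsubset_trans WV; apply: fW; apply: valP.
rewrite sumr_const -[_ *+ _]mulr_natr mulrAC ler_wpM2r ?(ltW (trees_gt0 V)) //.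
rewrite -[X in _ <= X]mulr1 -mulrA ler_pM2l // mulrC ler_pdivrMr // mul1r.
by rewrite /c lerDl.
Qed.

End OneEnded.

(** * Asymptotic independence *)

Section AsymptoticIndependence.
Variables (d : nat) (R : realType).
Hypothesis d2 : (1 < d)%N.
Local Notation D := ('I_d * bool)%type.
Local Notation m := ((d.-1).*2.+2).
Local Notation H := 'I_m.
Implicit Types (V W L K U S : {fset site d}) (v : site d).
Let d0 : (0 < d)%N. Proof. exact: ltnW. Qed.

Variable nu : forall L, {set {ffun L -> height d}} -> R.
Hypothesis limit : forall L (A : {set {ffun L -> height d}}) (e : R), 0 < e ->
  exists2 W, fsubset L W & forall V, fsubset W V -> `|nu A - muV R V (cyl A)| < e.
Hypothesis nu01 : forall L (A : {set {ffun L -> height d}}), 0 <= nu A <= 1.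

Lemma dep_pull L V (LV : fsubset L V) (S : {set V}) (A : {set {ffun L -> height d}}) :
  fsub V L \subset S -> dep S (fun h : {ffun V -> H} => (pull (fincl LV) h \in A)%:R : R).
Proof.
move=> LS f g fg; congr (nat_of_bool (_ \in A))%:R; apply/ffunP => x; rewrite !ffunE fg //.
by apply: (subsetP LS); apply: fincl_fsub.
Qed.

Definition joint L K (A : {set {ffun L -> height d}}) (B : {set {ffun K -> height d}}) :
    {set {ffun (L `|` K)%fset -> height d}} :=
  [set g : {ffun (L `|` K)%fset -> height d} |
    (pull (fincl (fsubsetUl L K)) g \in A) && (pull (fincl (fsubsetUr L K)) g \in B)].

(** Up to [e / 6], [W0] fixes the law of [A], [W1] contains the past of [W0], and [W2] that of [W1].
    [mixing] uses four sixths of [e], the limits for [joint A B] and for [B] one sixth each. *)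
Lemma asymptotic_independence L (A : {set {ffun L -> height d}}) (e : R) : 0 < e ->
  exists W : {fset site d}, forall K (B : {set {ffun K -> height d}}),
    (forall u, u \in K -> u \notin W) -> `|nu (joint A B) - nu A * nu B| <= e.
Proof.
move=> e0; have e6 : 0 < e / 6 by rewrite divr_gt0.
have [W0 LW0 net0] := limit A e6.
have [W1 W01 oe0] := one_ended d2 limit W0 e6.
have [W2 W12 oe1] := one_ended d2 limit W1 e6.
exists W2 => K B KW; have [N1 LN1 net1] := limit (joint A B) e6.
have [N2 KN2 net2] := limit B e6.
pose V := (W2 `|` (N1 `|` N2))%fset.
have W2V : fsubset W2 V by rewrite fsubsetUl.
have N1V : fsubset N1 V by rewrite /V fsetUCA fsubsetUl.
have N2V : fsubset N2 V by rewrite /V fsetUA fsubsetUr.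
have W1V := fsubset_trans W12 W2V; have W0V := fsubset_trans W01 W1V.
have LV := fsubset_trans LW0 W0V; have KV := fsubset_trans KN2 N2V.
have JV := fsubset_trans LN1 N1V.
have F0 := RV_card_gt0 R d0 V.
pose full_h h := full (fireH (@nbV d V) h) set0.
pose fA (h : {ffun V -> H}) : R := (pull (fincl LV) h \in A)%:R.
pose fB (h : {ffun V -> H}) : R := (pull (fincl KV) h \in B)%:R.
have dA : dep (fsub V L) fA by apply: dep_pull.
have dB : dep (~: fsub V W2) fB.
  by apply: dep_pull; apply/subsetP => x; rewrite !inE; apply: KW.
have fA01 h : 0 <= fA h <= 1 by rewrite /fA; case: (_ \in A); rewrite ?lexx ler01.
have fB01 h : 0 <= fB h <= 1 by rewrite /fB; case: (_ \in B); rewrite ?lexx ler01.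
(* Any [U] that contains [W0] is itself a finite volume beyond [W0], so convergence along the net is
   uniform over these sets. *)
have near (U : {set V}) : fsub V W0 \subset U ->
    `|Ex (fun h : {ffun V -> H} => (full (fireH (@nbV d V) h) (~: U))%:R * fA h) -
      nu A * Ex (fun h : {ffun V -> H} => (full (fireH (@nbV d V) h) (~: U))%:R)| <=
    e / 6 * Ex (fun h : {ffun V -> H} => (full (fireH (@nbV d V) h) (~: U))%:R).
  move=> W0U; pose V' : {fset site d} := [fset val x | x in U]%fset.
  have V'V : fsubset V' V by apply/fsubsetP => _ /imfsetP[x _ ->]; apply: valP.
  have UE : U = fsub V V'.
    apply/setP => x; rewrite in_fsub; apply/idP/imfsetP => [xU|[y yU /val_inj ->] //].
    by exists x.
  have W0V' : fsubset W0 V'.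
    apply/fsubsetP => w wW; apply/imfsetP; exists (FSetSub (fsubsetP W0V _ wW)) => //.
    by apply: (subsetP W0U); rewrite in_fsub.
  have Fge : 0 <= Ex (fun h : {ffun V -> H} => (full (fireH (@nbV d V) h) (~: U))%:R : R).
    by apply: Ex_ge0 => h; rewrite ler0n.
  rewrite {1}UE (muV_cyl_in R d0 (fsubset_trans LW0 W0V') V'V) -UE -mulrBl normrM distrC.
  by rewrite [X in _ * X]ger0_norm // ler_wpM2r // ltW // net0.
have mx := mixing (card_dir d0) isT (fsub_mono V LW0) (fsub_mono V W01) dA dB fA01 fB01 (nu01 A)
  (ltW e6) near (oe0 _ W1V) (oe1 _ W2V).
set E := Ex _ in F0 mx *.
have := net1 V N1V; have := net2 V N2V.
rewrite (muV_cyl R d0 JV) (muV_cyl R d0 KV) -/E.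
set EA := Ex _ in mx *; set EB := Ex _ in mx *.
have -> : Ex (fun h : {ffun V -> H} => (full (fireH (@nbV d V) h) set0)%:R * (pull (fincl JV) h \in joint A B)%:R) = EA.
  apply: eq_Ex => h; congr (_ * _); rewrite inE natr_andb.
  have -> : pull (fincl (fsubsetUl L K)) (pull (fincl JV) h) = pull (fincl LV) h.
    by apply/ffunP => x; rewrite !ffunE; congr (h _); apply: val_inj.
  have -> // : pull (fincl (fsubsetUr L K)) (pull (fincl JV) h) = pull (fincl KV) h.
  by apply/ffunP => x; rewrite !ffunE; congr (h _); apply: val_inj.
have {}mx : `|EA / E - nu A * (EB / E)| <= 4 * (e / 6).
  rewrite [nu A * (EB / E)]mulrA -mulrBl normrM [X in _ * X]gtr0_norm ?invr_gt0 // ler_pdivrMr //.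
have /andP[a0 a1] := nu01 A; have /andP[b0 b1] := nu01 B.
move=> n2 n1.
have n3 : `|nu A * (nu B - EB / E)| <= e / 6.
  rewrite normrM ger0_norm //; apply: le_trans (ltW n2).
  by rewrite ler_piMl.
move: mx n1 n3; rewrite mulrBr; move: (EA / E) (nu A * (EB / E)) (nu A * nu B) (nu _) => a b c n.
rewrite ltr_norml !ler_norml => /andP[? ?] /andP[? ?] /andP[? ?]; apply/andP; split; lra.
Qed.

End AsymptoticIndependence.

From mathcomp Require Import all_classical all_reals all_analysis.
Import Order.TTheory GRing.Theory Num.Theory.

Local Open Scope classical_set_scope.
Local Open Scope ring_scope.

(** * Tail events *)

Section Approximation.
Variables (dd : measure_display) (T : measurableType dd) (R : realType) (P : probability T R).
Implicit Types (A B C : set T).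

Definition prob C : R := fine (P C).

Lemma probE C : measurable C -> P C = (prob C)%:E.
Proof. by move=> mC; rewrite fineK // fin_num_measure. Qed.

Lemma prob_ge0 C : 0 <= prob C. Proof. exact/fine_ge0/measure_ge0. Qed.

Lemma prob_mono A B : measurable A -> measurable B -> A `<=` B -> prob A <= prob B.
Proof.
by move=> mA mB AB; rewrite -lee_fin -!probE //; apply: le_measure => //; rewrite inE.
Qed.

Lemma prob_le1 A : measurable A -> prob A <= 1.
Proof. by move=> mA; rewrite -lee_fin -probE // probability_le1. Qed.

Lemma prob_disjoint A B : measurable A -> measurable B -> A `&` B = set0 ->
  prob (A `|` B) = prob A + prob B.
Proof.
move=> mA mB AB; apply: EFin_inj; rewrite EFinD -!probE //; last exact: measurableU.
exact: measureU.
Qed.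

Lemma prob_setU A B : measurable A -> measurable B -> prob (A `|` B) <= prob A + prob B.
Proof.
move=> mA mB; rewrite -(setDUK (@subsetUl _ A B)) prob_disjoint //.
- rewrite lerD2l prob_mono //; first by apply: measurableD => //; apply: measurableU.
  by move=> x [[|]].
- by apply: measurableD => //; apply: measurableU.
- by apply/seteqP; split=> x // [? []].
Qed.

Definition sdiff A B := (A `\` B) `|` (B `\` A).

Lemma measurable_sdiff A B : measurable A -> measurable B -> measurable (sdiff A B).
Proof. by move=> mA mB; apply: measurableU; apply: measurableD. Qed.

Lemma prob_sdiff A B : measurable A -> measurable B -> `|prob A - prob B| <= prob (sdiff A B).
Proof.
move=> mA mB; have mS := measurable_sdiff mA mB.
have half X Y : measurable X -> measurable Y -> prob X <= prob Y + prob (sdiff X Y).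
  move=> mX mY; have mXY := measurable_sdiff mX mY; apply: le_trans (prob_setU mY mXY).
  apply: prob_mono => //; first exact: measurableU.
  by move=> x Xx; have [Yx|nY] := pselect (Y x); [left|right; left].
have := half _ _ mA mB; have := half _ _ mB mA.
rewrite (_ : sdiff B A = sdiff A B); last by rewrite /sdiff setUC.
by move=> ? ?; rewrite ler_norml; apply/andP; split; lra.
Qed.

Variable F : set (set T).
Hypotheses (mF : F `<=` measurable) (F0 : F set0) (FC : forall A, F A -> F (~` A)).
Hypothesis FU : forall A B, F A -> F B -> F (A `|` B).

Definition approximable : set (set T) := [set C | measurable C /\
  forall e : R, 0 < e -> exists2 B, F B & prob (sdiff C B) < e].

Lemma approximable_sub A : F A -> approximable A.
Proof.
move=> FA; split; first exact: mF.
by move=> e e0; exists A => //; rewrite /sdiff setDv setU0 /prob measure0.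
Qed.

Lemma approximable_trans A : measurable A ->
  (forall e : R, 0 < e -> exists2 B, approximable B & prob (sdiff A B) < e) -> approximable A.
Proof.
move=> mA H; split=> // e e0; have e2 : 0 < e / 2 by rewrite divr_gt0.
have [B [mB aB] AB] := H _ e2; have [C FC' BC] := aB _ e2; exists C => //.
have mC := mF FC'; apply: le_lt_trans (_ : prob (sdiff A B `|` sdiff B C) < _).
  apply: prob_mono; [exact: measurable_sdiff|by apply: measurableU; apply: measurable_sdiff|].
  by move=> x [[? ?]|[? ?]]; have [Bx|Bx] := pselect (B x); [right; left|left; left|left; right|right; right].
apply: le_lt_trans (prob_setU _ _) _; try exact: measurable_sdiff.
lra.
Qed.

Lemma approximableC A : approximable A -> approximable (setT `\` A).
Proof.
move=> [mA aA]; split; first exact: measurableD.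
move=> e /aA[B FB AB]; exists (~` B); first exact: FC.
rewrite (_ : sdiff _ _ = sdiff A B) //; apply/seteqP; split=> x; rewrite /sdiff /=.
  by move=> [[[_ ?] /contrapT ?]|[? ?]]; [right|left; split=> //; apply: contrapT => ?]; tauto.
by move=> [[? ?]|[? ?]]; [right|left]; tauto.
Qed.

Lemma approximableU A B : approximable A -> approximable B -> approximable (A `|` B).
Proof.
move=> [mA aA] [mB aB]; split; first exact: measurableU.
move=> e e0; have e2 : 0 < e / 2 by rewrite divr_gt0.
have [A' FA' AA] := aA _ e2; have [B' FB' BB] := aB _ e2.
exists (A' `|` B'); first exact: FU.
have [mA' mB'] := (mF FA', mF FB').
apply: le_lt_trans (_ : prob (sdiff A A' `|` sdiff B B') < _).
  apply: prob_mono; [|by apply: measurableU; apply: measurable_sdiff|].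
    by apply: measurable_sdiff; apply: measurableU.
  by rewrite /sdiff => x /=; tauto.
apply: le_lt_trans (prob_setU _ _) _; try exact: measurable_sdiff.
lra.
Qed.

(** By continuity from below a countable union is within a small measure of a finite one. *)
Lemma approximable_sigma : sigma_algebra setT approximable.
Proof.
split; [exact: approximable_sub|exact: approximableC|move=> A aA].
have mA n : measurable (A n) by case: (aA n).
have mU : measurable (\bigcup_k A k) by apply: bigcupT_measurable.
pose U n := \big[setU/set0]_(i < n.+1) A i.
have aU n : approximable (U n).
  rewrite /U; elim: n => [|n IH]; first by rewrite big_ord1.
  by rewrite big_ord_recr /=; apply: approximableU.
have UE : \bigcup_n U n = \bigcup_n A n.
  by rewrite /U bigcup_bigsetU_bigcup.
apply: approximable_trans => // e e0.
have mUn n : measurable (U n) by case: (aU n).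
have nd : nondecreasing_seq U by move=> a b ab; apply/subsetPset; apply: subset_bigsetU; rewrite ltnS.
have cv : P (U n) @[n --> \oo] --> P (\bigcup_k A k).
  by rewrite -UE; apply: nondecreasing_cvg_mu => //; rewrite UE.
rewrite (probE mU) in cv; move/fine_cvg: cv => /cvgrPdist_lt/(_ e e0)[N _ /(_ N (leqnn N))] /= lt.
exists (U N) => //; apply: le_lt_trans lt.
have UA : U N `<=` \bigcup_k A k by rewrite -UE; apply: bigcup_sup.
have -> : sdiff (\bigcup_k A k) (U N) = (\bigcup_k A k) `\` U N.
  by rewrite /sdiff (_ : U N `\` _ = set0) ?setU0 // setD_eq0.
have mD : measurable ((\bigcup_k A k) `\` U N) by apply: measurableD.
rewrite -[X in prob X - _](setDUK UA) prob_disjoint // -/(prob _).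
  by rewrite addrAC subrr add0r ler_norm.
by apply/seteqP; split=> x // [? []].
Qed.

End Approximation.

Section Cylinders.
Variable d : nat.
Implicit Types (L K : {fset site d}).

Lemma pull_restr L K (LK : fsubset L K) (w : Omega0 d) : pull (fincl LK) (restr K w) = restr L w.
Proof. by apply/ffunP => y; rewrite !ffunE. Qed.

Lemma cyl_joint L K (A : {set {ffun L -> height d}}) (B : {set {ffun K -> height d}}) :
  cyl (joint A B) = cyl A `&` cyl B.
Proof.
apply/seteqP; split=> w; rewrite /cyl /= inE !pull_restr; first by case/andP.
by move=> [-> ->].
Qed.

Lemma cylC L (A : {set {ffun L -> height d}}) : ~` cyl A = cyl (finset.setC A).
Proof. by apply/seteqP; split=> w; rewrite /cyl /= finset.in_setC => /negP. Qed.

Lemma measurable_cyl L (A : {set {ffun L -> height d}}) : measurable (cyl A).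
Proof.
have -> : cyl A = \bigcup_(g in [set` A]) \bigcap_(y in [set: L]) [set w : Omega d | w (val y) = g y].
  apply/seteqP; split=> w; rewrite /cyl /=.
    by move=> wA; exists (restr L w) => // y _; rewrite /= ffunE.
  move=> [g gA wg]; rewrite (_ : restr L w = g) //.
  by apply/ffunP => y; rewrite ffunE; apply: wg.
apply: fin_bigcup_measurable; first exact: finite_finset.
move=> g _; apply: fin_bigcap_measurable; first exact: finite_finset.
by move=> y _; apply: sub_gen_smallest; exists (val y), (g y).
Qed.

Definition far_cylinders n : set (set (Omega d)) :=
  [set C | exists K (B : {set {ffun K -> height d}}),
    (forall u, u \in K -> (n <= norm1 u)%N) /\ C = cyl B].

Lemma far_cylinders_measurable n : far_cylinders n `<=` measurable.
Proof. by move=> _ [K [B [_ ->]]]; apply: measurable_cyl. Qed.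

Lemma far_cylinders0 n : far_cylinders n set0.
Proof.
exists fset0, finset.set0; split; first by move=> u; rewrite in_fset0.
by apply/seteqP; split=> w //; rewrite /cyl /= finset.in_set0.
Qed.

Lemma far_cylindersC n C : far_cylinders n C -> far_cylinders n (~` C).
Proof. by move=> [K [B [Kn ->]]]; exists K, (finset.setC B); rewrite cylC. Qed.

Lemma far_cylindersU n B C : far_cylinders n B -> far_cylinders n C -> far_cylinders n (B `|` C).
Proof.
move=> /far_cylindersC[K [B' [Kn B'E]]] /far_cylindersC[K' [C' [Kn' C'E]]].
rewrite -[_ `|` _]setCK; apply: far_cylindersC; rewrite setCU B'E C'E -cyl_joint.
exists (K `|` K')%fset, (joint B' C'); split=> // u.
by rewrite in_fsetU => /orP[/Kn|/Kn'].
Qed.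

Lemma far_events_cylinders n : @far_events d n `<=` far_cylinders n.
Proof.
move=> _ [x [h [nx ->]]].
have xK : x \in [fset x]%fset by rewrite in_fset1.
exists [fset x]%fset, [set g : {ffun [fset x]%fset -> height d} | g (FSetSub xK) == h]%SET.
split; first by move=> u; rewrite in_fset1 => /eqP ->.
by apply/seteqP; split=> w; rewrite /cyl /= inE ffunE => /eqP.
Qed.

Variables (R : realType) (mu : probability (Omega d) R).

(** The far cylinders form an algebra that contains the generators [far_events]. *)
Lemma tail_approximable E n : tail_event E -> approximable mu (far_cylinders n) E.
Proof.
move=> /(_ n); apply: smallest_sub.
  apply: approximable_sigma.
  - exact: far_cylinders_measurable.
  - exact: far_cylinders0.
  - exact: far_cylindersC.
  - exact: far_cylindersU.
move=> C /far_events_cylinders; apply: approximable_sub; exact: far_cylinders_measurable.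
Qed.

End Cylinders.

Theorem theorem9p1 (d : nat) (hd : (2 <= d)%N) (R : realType)
  (mu : probability (Omega d) R) :
  sandpile_limit mu -> tail_trivial mu.
Proof.
move=> lim E tE; have [mE _] := tail_approximable mu 0 tE.
have sq : prob mu E = prob mu E * prob mu E.
  apply/eqP; rewrite -subr_eq0 -normr_le0; apply/ler_addgt0Pl => e e0; rewrite addr0.
  have e8 : 0 < e / 8 by rewrite divr_gt0.
  (* With [n = 0] the far cylinders are all cylinders: [A] is a local approximation of [E]. *)
  have [_ /(_ _ e8)[CA [L [A [_ ->]]] near_A]] := tail_approximable mu 0 tE.
  have [|W indep] := asymptotic_independence hd (nu := fun L (A : {set {ffun L -> height d}}) => prob mu (cyl A)) lim _ A e8.
    by move=> K B; rewrite prob_ge0 prob_le1 //; apply: measurable_cyl.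
  (* A norm beyond that of every site of [W], so that the second approximation lives off [W]. *)
  pose n := (\sum_(w : W) norm1 (val w)).+1.
  have [_ /(_ _ e8)[CB [K [B [Kn ->]]] near_B]] := tail_approximable mu n tE.
  have /indep : forall u, u \in K -> u \notin W.
    move=> u uK; apply: contraTN (Kn u uK) => uW; rewrite -ltnNge /n ltnS.
    by rewrite (bigD1 (FSetSub uW)) //= leq_addr.
  move=> /(_ B); rewrite cyl_joint.
  have mA : measurable (cyl A) by apply: measurable_cyl.
  have mB : measurable (cyl B) by apply: measurable_cyl.
  have mAB : measurable (cyl A `&` cyl B) by apply: measurableI.
  have dA := prob_sdiff mu mE mA; have dB := prob_sdiff mu mE mB; have dAB := prob_sdiff mu mE mAB.
  (* Both cylinders approximate the same event, hence so does their intersection. *)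
  have : prob mu (sdiff E (cyl A `&` cyl B)) <= e / 8 + e / 8.
    apply: le_trans (lerD (ltW near_A) (ltW near_B)).
    apply: le_trans (prob_setU _ _ _); try exact: measurable_sdiff.
    apply: prob_mono; [exact: measurable_sdiff|by apply: measurableU; apply: measurable_sdiff|].
    move=> w; rewrite /sdiff /= => -[[Ew nAB]|[[Aw Bw] nE]]; last by left; right.
    by have [Aw|nA] := pselect (cyl A w); [right; left; split=> // Bw; apply: nAB|left; left].
  have {}dA := le_trans dA (ltW near_A); have {}dB := le_trans dB (ltW near_B).
  have := prob_ge0 mu E; have := prob_le1 mu mE.
  have := prob_ge0 mu (cyl A); have := prob_le1 mu mA.
  move: dA dB dAB; set p := prob mu E; set a := prob mu (cyl A); set b := prob mu (cyl B).
  set c := prob mu (_ `&` _); set s := prob mu (sdiff _ _) => dA dB dAB a1 a0 p1 p0 se ind.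
  have ab : `|a * b - p * p| <= e / 8 + e / 8.
    rewrite (_ : a * b - p * p = a * (b - p) + p * (a - p)); last by ring.
    apply: le_trans (ler_normD _ _) _; rewrite !normrM (ger0_norm a0) (ger0_norm p0) (distrC b) (distrC a) addrC.
    by apply: lerD; [apply: le_trans dA|apply: le_trans dB]; apply: ler_piMl.
  (* The three differences are at most [e / 4], [e / 8] and [e / 4]. *)
  rewrite (_ : p - p * p = (p - c) + (c - a * b) + (a * b - p * p)); last by ring.
  apply: le_trans (ler_normD _ _) _.
  have := ler_normD (p - c) (c - a * b); have := le_trans dAB se.
  by move: (`|p - c|) (`|c - a * b|) (`|a * b - p * p|) (`|_ + _|) ind ab => x y z t; lra.
have : prob mu E * (prob mu E - 1) == 0 by rewrite mulrBr mulr1 -sq subrr.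
rewrite mulf_eq0 subr_eq0 => /orP[] /eqP pE; [left|right]; by rewrite probE // pE.
Qed.
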